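(* Let $p$ be a prime, let $A$ be an $\mathbb F_p$-algebra, and let $\varepsilon:\mathrm{Spec}\,\mathcal B\to\mathrm{Spec}\,A$ be an étale morphism between affine $\mathbb F_p$-schemes. Let $U_1,\ldots,U_v$ be the functorial Artin--Schreier stratification of $\mathrm{Spec}\,A$ associated to $\varepsilon$, in reduced locally closed subschemes. Then this stratification is pure, i.e., for each $l\in\{1,\ldots,v\}$ the stratum $U_l$ is pure in $\mathrm{Spec}\,A$ (it is an affine $\mathrm{Spec}\,A$-scheme).
   Context: Functorial Artin--Schreier stratification: the numbers of geometric points of the fibers of the étale morphism $\varepsilon:\mathrm{Spec}\,\mathcal B\to\mathrm{Spec}\,A$ form a finite set of natural numbers. Let $\mu_1>\mu_2>\cdots>\mu_v$ be the shortest strictly decreasing sequence of natural numbers such that each fiber of $\varepsilon$ has a number of geometric points equal to $\mu_l$ for some $l\in\{1,\ldots,v\}$. For $l\in\{1,\ldots,v\}$, $U_l$ is the set of all points $x\in\mathrm{Spec}\,A$ such that the fiber of $\varepsilon$ at $x$ has exactly $\mu_l$ geometric points (i.e., the geometric fiber of $\varepsilon$ over an algebraic closure of the residue field of $x$ has exactly $\mu_l$ points). Each $U_l$ is locally closed in $\mathrm{Spec}\,A$ and is endowed with its reduced scheme structure; $U_l$ is open in $(\mathrm{Spec}\,A)\setminus\bigcup_{q=1}^{l-1}U_q$. A reduced locally closed subscheme $Z$ of a scheme $Y$ is called pure in $Y$ if it is an affine $Y$-scheme, i.e., if the inclusion morphism $Z\to Y$ is affine. *)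

(* Defs.v *)
From HB Require Import structures.
From mathcomp Require Import all_boot all_order all_algebra.
From mathcomp Require Import boolp classical_sets functions cardinality.
From mathcomp Require Import topology_structure ring.

Set Implicit Arguments.
Unset Strict Implicit.
Unset Printing Implicit Defensive.

Import GRing.Theory.
Local Open Scope classical_set_scope.
Local Open Scope quotient_scope.
Local Open Scope ring_scope.

(* Rings are [comPzRingType]s, so that the zero ring is allowed throughout:
   it is the coordinate ring of the empty scheme. *)

Record ideal (A : comPzRingType) := Ideal {
  ideal_set :> A -> Prop;
  ideal0 : ideal_set 0;
  idealD : forall a b, ideal_set a -> ideal_set b -> ideal_set (a + b);
  idealM : forall a b, ideal_set b -> ideal_set (a * b) }.

Section QuotientRing.
Variables (A : comPzRingType) (I : ideal A).

Lemma idealN a : I a -> I (- a).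
Proof. by move=> Ia; rewrite -mulN1r; apply: idealM. Qed.

Lemma idealB a b : I a -> I b -> I (a - b).
Proof. by move=> Ia /idealN; apply: idealD. Qed.

Definition ideal_eq (a b : A) : bool := `[< I (a - b) >].

Lemma ideal_eq_equiv : equiv_class_of ideal_eq.
Proof.
split=> [a|a b|b a c].
- by apply/asboolP; rewrite subrr; apply: ideal0.
- by apply/asboolP/asboolP=> /idealN; rewrite opprB.
- move=> /asboolP ab /asboolP bc; apply/asboolP.
  by rewrite -[a](addrNK b) -addrA; apply: idealD.
Qed.

Canonical ideal_eq_equiv_rel := EquivRelPack ideal_eq_equiv.

Definition quot := {eq_quot ideal_eq}.
HB.instance Definition _ := Choice.on quot.
HB.instance Definition _ : EqQuotient A ideal_eq quot := EqQuotient.on quot.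

Definition quot_pi (a : A) : quot := \pi a.

Lemma quot_pi_eq a b : quot_pi a = quot_pi b <-> I (a - b).
Proof.
by split=> [/eqmodP/asboolP|h]; [|apply/eqmodP/asboolP].
Qed.

Lemma quot_piP (u : quot) : exists a, u = quot_pi a.
Proof. by exists (repr u); rewrite /quot_pi reprK. Qed.

Let repr_pi a : I (repr (quot_pi a) - a).
Proof. by apply/quot_pi_eq; rewrite /quot_pi reprK. Qed.

Definition quot_add (u v : quot) := quot_pi (repr u + repr v).
Definition quot_opp (u : quot) := quot_pi (- repr u).
Definition quot_mul (u v : quot) := quot_pi (repr u * repr v).

Lemma quot_addE a b : quot_add (quot_pi a) (quot_pi b) = quot_pi (a + b).
Proof. by apply/quot_pi_eq; rewrite opprD addrACA; apply: idealD. Qed.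

Lemma quot_oppE a : quot_opp (quot_pi a) = quot_pi (- a).
Proof. by apply/quot_pi_eq; rewrite -opprD; apply: idealN. Qed.

Lemma quot_mulE a b : quot_mul (quot_pi a) (quot_pi b) = quot_pi (a * b).
Proof.
apply/quot_pi_eq; set a' := repr _; set b' := repr _.
have -> : a' * b' - a * b = b' * (a' - a) + a * (b' - b).
  by ring.
by apply: idealD; apply: idealM; apply: repr_pi.
Qed.

Let addA : associative quot_add.
Proof.
move=> u v w; have [a ->] := quot_piP u; have [b ->] := quot_piP v.
by have [c ->] := quot_piP w; rewrite !quot_addE addrA.
Qed.
Let addC : commutative quot_add.
Proof. by move=> u v; rewrite /quot_add addrC. Qed.
Let add0 : left_id (quot_pi 0) quot_add.
Proof. by move=> u; have [a ->] := quot_piP u; rewrite quot_addE add0r. Qed.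
Let addN : left_inverse (quot_pi 0) quot_opp quot_add.
Proof.
by move=> u; have [a ->] := quot_piP u; rewrite quot_oppE quot_addE addNr.
Qed.
HB.instance Definition _ := GRing.isZmodule.Build quot addA addC add0 addN.

Let mulA : associative quot_mul.
Proof.
move=> u v w; have [a ->] := quot_piP u; have [b ->] := quot_piP v.
by have [c ->] := quot_piP w; rewrite !quot_mulE mulrA.
Qed.
Let mulC : commutative quot_mul.
Proof. by move=> u v; rewrite /quot_mul mulrC. Qed.
Let mul1 : left_id (quot_pi 1) quot_mul.
Proof. by move=> u; have [a ->] := quot_piP u; rewrite quot_mulE mul1r. Qed.
Let mulD : left_distributive quot_mul quot_add.
Proof.
move=> u v w; have [a ->] := quot_piP u; have [b ->] := quot_piP v.
by have [c ->] := quot_piP w; rewrite !(quot_addE, quot_mulE) mulrDl.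
Qed.
HB.instance Definition _ :=
  GRing.Zmodule_isComPzRing.Build quot mulA mulC mul1 mulD.

Let quot_piB : zmod_morphism quot_pi.
Proof. by move=> a b; rewrite -quot_addE -quot_oppE. Qed.
Let quot_piM : monoid_morphism quot_pi.
Proof. by split=> // a b; rewrite -quot_mulE. Qed.
HB.instance Definition _ := GRing.isZmodMorphism.Build A quot quot_pi quot_piB.
HB.instance Definition _ :=
  GRing.isMonoidMorphism.Build A quot quot_pi quot_piM.

End QuotientRing.

Record spec (A : comPzRingType) := Spec {
  prime_of : ideal A;
  prime_proper : ~ prime_of 1;
  prime_mul : forall a b, prime_of (a * b) -> prime_of a \/ prime_of b }.

Coercion prime_of : spec >-> ideal.

HB.instance Definition _ (A : comPzRingType) := gen_eqMixin (spec A).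
HB.instance Definition _ (A : comPzRingType) := gen_choiceMixin (spec A).

Definition basic_open (A : comPzRingType) (f : A) : set (spec A) :=
  [set x | ~ x f].

Definition vanishing_locus (A : comPzRingType) (S : set A) : set (spec A) :=
  [set x | forall a, S a -> x a].

Definition zariski_open (A : comPzRingType) : set_system (spec A) :=
  [set U | exists S, U = ~` vanishing_locus S].

Section Zariski.
Variable A : comPzRingType.

Let openT : zariski_open (setT : set (spec A)).
Proof.
exists [set 1]; apply/esym/seteqP; split=> // x _ /(_ 1 erefl).
exact: prime_proper.
Qed.

Let openI : setI_closed (@zariski_open A).
Proof.
move=> U V [S ->] [T ->]; exists [set c | exists a b, [/\ S a, T b & c = a * b]].
apply/seteqP; split=> x /=.
  move=> [nS nT] ST; apply: nS => a Sa; apply: contrapT => nxa.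
  apply: nT => b Tb; have /prime_mul[] // : x (a * b) by apply: ST; exists a, b.
move=> nST; split=> h; apply: nST => c [a [b [Sa Tb ->]]].
  by rewrite mulrC; apply/idealM/h.
by apply/idealM/h.
Qed.

Let open_bigU (J : Type) (F : J -> set (spec A)) :
  (forall j, zariski_open (F j)) -> zariski_open (\bigcup_j F j).
Proof.
move=> /choice[S FS]; exists (\bigcup_j S j); apply/seteqP; split=> x /=.
  by move=> [j _]; rewrite FS => nS SS; apply: nS => a Sa; apply: SS; exists j.
move=> nS; apply: contrapT => nF; apply: nS => a [j _ Sja].
apply: contrapT => nxa; apply: nF; exists j => //; rewrite FS.
by move=> /(_ _ Sja).
Qed.

HB.instance Definition _ :=
  isOpenTopological.Build (spec A) openT openI open_bigU.

Lemma spec_openE (U : set (spec A)) : open U <-> zariski_open U.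
Proof.
rewrite openE; split=> [h|Uop x Ux]; last by exists U; split.
pose J := {V : set (spec A) | zariski_open V /\ V `<=` U}.
have -> : U = \bigcup_(j : J) sval j.
  apply/seteqP; split=> [x /h [V [Vop Vx VU]]|x [[V [Vop VU]] _ /= /VU] //].
  by exists (exist _ V (conj Vop VU)).
by apply: open_bigU => -[V []].
Qed.

End Zariski.

Section Comap.
Variables (A B : comPzRingType) (f : {rmorphism A -> B}) (y : spec B).

Let comap0 : y (f 0). Proof. by rewrite rmorph0; apply: ideal0. Qed.
Let comapD a b : y (f a) -> y (f b) -> y (f (a + b)).
Proof. by rewrite rmorphD; apply: idealD. Qed.
Let comapM a b : y (f b) -> y (f (a * b)).
Proof. by rewrite rmorphM; apply: idealM. Qed.

Definition comap_ideal : ideal A :=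
  @Ideal A (fun a => y (f a)) comap0 comapD comapM.

Let comap_proper : ~ comap_ideal 1.
Proof. by rewrite /= rmorph1; apply: prime_proper. Qed.
Let comap_mul a b : comap_ideal (a * b) -> comap_ideal a \/ comap_ideal b.
Proof. by rewrite /= rmorphM; apply: prime_mul. Qed.

Definition comap : spec A := Spec comap_proper comap_mul.

End Comap.

Section LocalRing.
Variables (A : comPzRingType) (x : spec A).

Lemma notin1 : ~ x 1.
Proof. exact: prime_proper. Qed.

Lemma notinM a b : ~ x a -> ~ x b -> ~ x (a * b).
Proof. by move=> na nb /prime_mul[]. Qed.

Record frac := Frac { num : A; den : A; den_notin : ~ x den }.
Arguments den_notin : clear implicits.

HB.instance Definition _ := gen_eqMixin frac.
HB.instance Definition _ := gen_choiceMixin frac.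

Definition frac_eq (s t : frac) : bool :=
  `[< exists h, ~ x h /\ h * (num s * den t - num t * den s) = 0 >].

Lemma frac_eq_equiv : equiv_class_of frac_eq.
Proof.
split=> [s|s t|t s r].
- by apply/asboolP; exists 1; split; [exact: notin1|ring].
- apply/asboolP/asboolP=> -[h [xh e]]; exists h; split=> //;
    by rewrite -opprB mulrN e oppr0.
- move=> /asboolP[h [xh e]] /asboolP[k [xk e']]; apply/asboolP.
  exists (h * k * den t).
  split; first by do !apply: notinM => //; apply: den_notin.
  have -> : h * k * den t * (num s * den r - num r * den s) =
    k * den r * (h * (num s * den t - num t * den s)) +
    h * den s * (k * (num t * den r - num r * den t)) by ring.
  by rewrite e e' !mulr0 addr0.
Qed.

Canonical frac_eq_equiv_rel := EquivRelPack frac_eq_equiv.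

Definition local_ring := {eq_quot frac_eq}.
HB.instance Definition _ := Choice.on local_ring.
HB.instance Definition _ : EqQuotient frac frac_eq local_ring :=
  EqQuotient.on local_ring.

Definition fraction_of (a f : A) (nf : ~ x f) : local_ring :=
  \pi_local_ring (Frac a nf).

Lemma fraction_of_eq a f (nf : ~ x f) b g (ng : ~ x g) :
  fraction_of a nf = fraction_of b ng <->
  exists h, ~ x h /\ h * (a * g - b * f) = 0.
Proof. by split=> [/eqmodP/asboolP|h]; [|apply/eqmodP/asboolP]. Qed.

Lemma fraction_ofP (u : local_ring) :
  exists a f (nf : ~ x f), u = fraction_of a nf.
Proof.
rewrite -[u]reprK; case: (repr u) => a f nf.
by exists a, f, nf.
Qed.

Lemma local_repr a f (nf : ~ x f) (r := repr (fraction_of a nf)) :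
  exists h, ~ x h /\ h * (num r * f - a * den r) = 0.
Proof.
apply/(fraction_of_eq _ (den_notin r) _ nf).
by rewrite -[RHS]reprK -/r; case: r.
Qed.

Definition local_add (u v : local_ring) : local_ring :=
  let s := repr u in let t := repr v in
  fraction_of (num s * den t + num t * den s)
    (notinM (den_notin s) (den_notin t)).
Definition local_opp (u : local_ring) : local_ring :=
  fraction_of (- num (repr u)) (den_notin (repr u)).
Definition local_mul (u v : local_ring) : local_ring :=
  let s := repr u in let t := repr v in
  fraction_of (num s * num t) (notinM (den_notin s) (den_notin t)).

Lemma local_addE a f (nf : ~ x f) b g (ng : ~ x g) :
  local_add (fraction_of a nf) (fraction_of b ng) =
  fraction_of (a * g + b * f) (notinM nf ng).
Proof.
rewrite /local_add; have [h [xh e]] := local_repr a nf.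
have [k [xk e']] := local_repr b ng; set r := repr _ in e *.
set s := repr _ in e' *; apply/fraction_of_eq; exists (h * k).
split; first exact: notinM.
have -> : h * k * ((num r * den s + num s * den r) * (f * g) -
    (a * g + b * f) * (den r * den s)) =
  k * den s * g * (h * (num r * f - a * den r)) +
  h * den r * f * (k * (num s * g - b * den s)) by ring.
by rewrite e e' !mulr0 addr0.
Qed.

Lemma local_oppE a f (nf : ~ x f) :
  local_opp (fraction_of a nf) = fraction_of (- a) nf.
Proof.
rewrite /local_opp; have [h [xh e]] := local_repr a nf; set r := repr _ in e *.
apply/fraction_of_eq; exists h; split=> //.
have -> : h * (- num r * f - - a * den r) =
  - (h * (num r * f - a * den r)) by ring.
by rewrite e oppr0.
Qed.

Lemma local_mulE a f (nf : ~ x f) b g (ng : ~ x g) :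
  local_mul (fraction_of a nf) (fraction_of b ng) =
  fraction_of (a * b) (notinM nf ng).
Proof.
rewrite /local_mul; have [h [xh e]] := local_repr a nf.
have [k [xk e']] := local_repr b ng; set r := repr _ in e *.
set s := repr _ in e' *; apply/fraction_of_eq; exists (h * k).
split; first exact: notinM.
have -> : h * k * (num r * num s * (f * g) - a * b * (den r * den s)) =
  k * num s * g * (h * (num r * f - a * den r)) +
  h * a * den r * (k * (num s * g - b * den s)) by ring.
by rewrite e e' !mulr0 addr0.
Qed.

Lemma fraction_of_congr a f (nf : ~ x f) b g (ng : ~ x g) :
  a * g = b * f -> fraction_of a nf = fraction_of b ng.
Proof.
move=> e; apply/fraction_of_eq; exists 1; split; first exact: notin1.
by rewrite e subrr mulr0.
Qed.

Let zero := fraction_of 0 notin1.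
Let one := fraction_of 1 notin1.

Let addA : associative local_add.
Proof.
move=> u v w; have [a [f [nf ->]]] := fraction_ofP u.
have [b [g [ng ->]]] := fraction_ofP v; have [c [h [nh ->]]] := fraction_ofP w.
by rewrite !local_addE; apply: fraction_of_congr; ring.
Qed.
Let addC : commutative local_add.
Proof.
move=> u v; have [a [f [nf ->]]] := fraction_ofP u.
have [b [g [ng ->]]] := fraction_ofP v.
by rewrite !local_addE; apply: fraction_of_congr; ring.
Qed.
Let add0 : left_id zero local_add.
Proof.
move=> u; have [a [f [nf ->]]] := fraction_ofP u.
by rewrite !local_addE; apply: fraction_of_congr; ring.
Qed.
Let addN : left_inverse zero local_opp local_add.
Proof.
move=> u; have [a [f [nf ->]]] := fraction_ofP u.
by rewrite local_oppE !local_addE; apply: fraction_of_congr; ring.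
Qed.
HB.instance Definition _ := GRing.isZmodule.Build local_ring addA addC add0 addN.

Let mulA : associative local_mul.
Proof.
move=> u v w; have [a [f [nf ->]]] := fraction_ofP u.
have [b [g [ng ->]]] := fraction_ofP v; have [c [h [nh ->]]] := fraction_ofP w.
by rewrite !local_mulE; apply: fraction_of_congr; ring.
Qed.
Let mulC : commutative local_mul.
Proof.
move=> u v; have [a [f [nf ->]]] := fraction_ofP u.
have [b [g [ng ->]]] := fraction_ofP v.
by rewrite !local_mulE; apply: fraction_of_congr; ring.
Qed.
Let mul1 : left_id one local_mul.
Proof.
move=> u; have [a [f [nf ->]]] := fraction_ofP u.
by rewrite !local_mulE; apply: fraction_of_congr; ring.
Qed.
Let mulD : left_distributive local_mul local_add.
Proof.
move=> u v w; have [a [f [nf ->]]] := fraction_ofP u.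
have [b [g [ng ->]]] := fraction_ofP v; have [c [h [nh ->]]] := fraction_ofP w.
by rewrite !(local_addE, local_mulE); apply: fraction_of_congr; ring.
Qed.
HB.instance Definition _ :=
  GRing.Zmodule_isComPzRing.Build local_ring mulA mulC mul1 mulD.

Lemma fraction_of0 : fraction_of 0 notin1 = 0. Proof. by []. Qed.
Lemma fraction_of1 : fraction_of 1 notin1 = 1. Proof. by []. Qed.
Lemma fraction_ofD a f (nf : ~ x f) b g (ng : ~ x g) :
  fraction_of a nf + fraction_of b ng =
  fraction_of (a * g + b * f) (notinM nf ng).
Proof. exact: local_addE. Qed.
Lemma fraction_ofN a f (nf : ~ x f) :
  - fraction_of a nf = fraction_of (- a) nf.
Proof. exact: local_oppE. Qed.
Lemma fraction_ofM a f (nf : ~ x f) b g (ng : ~ x g) :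
  fraction_of a nf * fraction_of b ng = fraction_of (a * b) (notinM nf ng).
Proof. exact: local_mulE. Qed.

End LocalRing.

Section ResidueField.
Variables (A : comPzRingType) (x : spec A).

(* The residue field is constructed as the fraction field of [A / x]. *)
Definition residue_domain := quot x.
HB.instance Definition _ := GRing.ComPzRing.on residue_domain.

Let domain_nonzero1 : (1 : residue_domain) != 0.
Proof.
by apply/eqP=> /quot_pi_eq; rewrite subr0; apply: prime_proper.
Qed.
HB.instance Definition _ :=
  GRing.PzSemiRing_isNonZero.Build residue_domain domain_nonzero1.

Definition residue_unit : {pred residue_domain} :=
  [pred u | `[< exists v, v * u = 1 >]].
Definition residue_inv (u : residue_domain) : residue_domain :=
  if pselect (exists v, v * u = 1) is left h then sval (cid h) else u.

Let mulV : {in residue_unit, left_inverse 1 residue_inv *%R}.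
Proof.
move=> u /asboolP hu; rewrite /residue_inv; case: pselect => // h.
exact: (svalP (cid h)).
Qed.
Let unitP (u v : residue_domain) : v * u = 1 -> residue_unit u.
Proof. by move=> h; apply/asboolP; exists v. Qed.
Let inv_out : {in [predC residue_unit], residue_inv =1 id}.
Proof.
move=> u /negP hu; rewrite /residue_inv; case: pselect => // h.
by exfalso; apply: hu; apply/asboolP.
Qed.
HB.instance Definition _ :=
  GRing.ComNzRing_hasMulInverse.Build residue_domain mulV unitP inv_out.

Let domain_mul (u v : residue_domain) : u * v = 0 -> (u == 0) || (v == 0).
Proof.
have [a ->] := quot_piP u; have [b ->] := quot_piP v.
rewrite (_ : _ * _ = quot_pi x (a * b)); last exact: quot_mulE.
move=> /quot_pi_eq; rewrite subr0 => /prime_mul[h|h];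
  apply/orP; [left|right]; apply/eqP; rewrite -[RHS]/(quot_pi x 0);
  by apply/quot_pi_eq; rewrite subr0.
Qed.
HB.instance Definition _ :=
  GRing.ComUnitRing_isIntegral.Build residue_domain domain_mul.

Definition residue_field : fieldType := {fraction residue_domain}.

Definition residue (a : A) : residue_field :=
  tofrac (quot_pi x a : residue_domain).

Let residueB : zmod_morphism residue.
Proof. by move=> a b; rewrite /residue -tofracB -[in RHS]raddfB. Qed.
Let residueM : monoid_morphism residue.
Proof. by split=> [|a b] //; rewrite /residue -tofracM -[in RHS]rmorphM. Qed.
HB.instance Definition _ :=
  GRing.isZmodMorphism.Build A residue_field residue residueB.
HB.instance Definition _ :=
  GRing.isMonoidMorphism.Build A residue_field residue residueM.

End ResidueField.

Section Sections.
Variables (A : comPzRingType) (U : set (spec A)).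

(* [U] is an arbitrary subset, but only open ones are used; [sections U] is
   then the ring of sections over [U] of the structure sheaf of [spec A]. *)
Definition locally_fraction (s : forall x : U, local_ring (val x)) : Prop :=
  forall x : U, exists V : set (spec A), exists a f : A,
    [/\ open V, V (val x) & forall y : U, V (val y) ->
      exists nf : ~ (val y : spec A) f, s y = fraction_of a nf].

Record sections := Sections {
  section_at :> forall x : U, local_ring (val x);
  section_fraction : locally_fraction section_at }.

Lemma sectionsP (s t : sections) : (forall x, s x = t x) -> s = t.
Proof.
case: s t => s hs [t ht] /= st; have e : s = t by apply: functional_extensionality_dep.
by subst t; congr Sections; apply: Prop_irrelevance.
Qed.

HB.instance Definition _ := gen_eqMixin sections.
HB.instance Definition _ := gen_choiceMixin sections.

Lemma const_fraction c :
  locally_fraction (fun x : U => fraction_of c (notin1 (x := val x))).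
Proof.
move=> x; exists setT, c, 1; split=> // [|y _]; first exact: openT.
by exists (@notin1 _ (val y)).
Qed.

Lemma add_fraction (s t : sections) : locally_fraction (fun x => s x + t x).
Proof.
move=> x; have [V [a [f [Vop Vx Vs]]]] := section_fraction s x.
have [W [b [g [Wop Wx Wt]]]] := section_fraction t x.
exists (V `&` W), (a * g + b * f), (f * g); split=> //; first exact: openI.
move=> y [/Vs[nf ->] /Wt[ng ->]].
by exists (notinM nf ng); rewrite fraction_ofD.
Qed.

Lemma opp_fraction (s : sections) : locally_fraction (fun x => - s x).
Proof.
move=> x; have [V [a [f [Vop Vx Vs]]]] := section_fraction s x.
exists V, (- a), f; split=> // y /Vs[nf ->].
by exists nf; rewrite fraction_ofN.
Qed.

Lemma mul_fraction (s t : sections) : locally_fraction (fun x => s x * t x).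
Proof.
move=> x; have [V [a [f [Vop Vx Vs]]]] := section_fraction s x.
have [W [b [g [Wop Wx Wt]]]] := section_fraction t x.
exists (V `&` W), (a * b), (f * g); split=> //; first exact: openI.
move=> y [/Vs[nf ->] /Wt[ng ->]].
by exists (notinM nf ng); rewrite fraction_ofM.
Qed.

Let zero := Sections (const_fraction 0).
Let one := Sections (const_fraction 1).
Let add s t := Sections (add_fraction s t).
Let opp s := Sections (opp_fraction s).
Let mul s t := Sections (mul_fraction s t).

Let addA : associative add.
Proof. by move=> s t r; apply: sectionsP => x /=; rewrite addrA. Qed.
Let addC : commutative add.
Proof. by move=> s t; apply: sectionsP => x /=; rewrite addrC. Qed.
Let add0 : left_id zero add.
Proof.
by move=> s; apply: sectionsP => x /=; rewrite fraction_of0 add0r.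
Qed.
Let addN : left_inverse zero opp add.
Proof.
by move=> s; apply: sectionsP => x /=; rewrite fraction_of0 addNr.
Qed.
HB.instance Definition _ := GRing.isZmodule.Build sections addA addC add0 addN.

Let mulA : associative mul.
Proof. by move=> s t r; apply: sectionsP => x /=; rewrite mulrA. Qed.
Let mulC : commutative mul.
Proof. by move=> s t; apply: sectionsP => x /=; rewrite mulrC. Qed.
Let mul1 : left_id one mul.
Proof.
by move=> s; apply: sectionsP => x /=; rewrite fraction_of1 mul1r.
Qed.
Let mulD : left_distributive mul add.
Proof. by move=> s t r; apply: sectionsP => x /=; rewrite mulrDl. Qed.
HB.instance Definition _ :=
  GRing.Zmodule_isComPzRing.Build sections mulA mulC mul1 mulD.

Lemma section_add (s t : sections) x : (s + t) x = s x + t x.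
Proof. by []. Qed.
Lemma section_mul (s t : sections) x : (s * t) x = s x * t x.
Proof. by []. Qed.
Lemma section_one x : (1 : sections) x = 1.
Proof. by []. Qed.

End Sections.

Section Restrict.
Variables (A : comPzRingType) (U W : set (spec A)) (sUW : U `<=` W).

Definition inclusion (x : U) : W := SigSub (mem_set (sUW (set_valP x))).

Lemma restrict_fraction (s : sections W) :
  locally_fraction (fun x : U => s (inclusion x)).
Proof.
move=> x; have [V [a [f [Vop Vx Vs]]]] := section_fraction s (inclusion x).
by exists V, a, f; split=> // y Vy; apply: (Vs (inclusion y)).
Qed.

Definition restrict (s : sections W) : sections U :=
  Sections (restrict_fraction s).

End Restrict.

(* An open subset [U] of [spec A] is affine when the ringed space
   [(U, O_(spec A) restricted to U)] is isomorphic to some [spec R]: the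
   homeomorphism is [h], and the isomorphism of sheaves on [U] is [phi]. Both
   sides being locally ringed, such an isomorphism of ringed spaces is one of
   locally ringed spaces. *)
Definition affine_open (A : comPzRingType) (U : set (spec A)) : Prop :=
  exists (R : comPzRingType) (h : spec R -> spec A)
    (phi : forall W : set (spec A), open W -> W `<=` U ->
      {rmorphism sections W -> sections (h @^-1` W)}),
  [/\ [/\ injective h, range h = U, continuous h &
          forall V, open V -> open (h @` V)],
      forall W (Wop : open W) (WU : W `<=` U), bijective (phi W Wop WU) &
      forall W W' (Wop : open W) (WU : W `<=` U)
        (Wop' : open W') (WU' : W' `<=` U) (WW' : W `<=` W') (s : sections W'),
        phi W Wop WU (restrict WW' s) =
        restrict (@preimage_subset _ _ h _ _ WW') (phi W' Wop' WU' s)].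

Definition locally_closed (T : topologicalType) (Z : set T) : Prop :=
  exists U F : set T, [/\ open U, closed F & Z = U `&` F].

Section ReducedSubscheme.
Variables (A : comPzRingType) (Z : set (spec A)).

Let van0 : forall x, Z x -> x 0. Proof. by move=> x _; apply: ideal0. Qed.
Let vanD a b : (forall x, Z x -> x a) -> (forall x, Z x -> x b) ->
  forall x, Z x -> x (a + b).
Proof. by move=> ha hb x Zx; apply: idealD; [apply: ha|apply: hb]. Qed.
Let vanM a b : (forall x, Z x -> x b) -> forall x, Z x -> x (a * b).
Proof. by move=> hb x Zx; apply/idealM/hb. Qed.

Definition vanishing_ideal : ideal A :=
  @Ideal A (fun a => forall x, Z x -> x a) van0 vanD vanM.

(* [spec (quot vanishing_ideal)] is the closure of [Z] with its reduced
   structure. For [Z] locally closed, hence open in its closure, the reduced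
   subscheme [Z] is the open subscheme of that scheme formed by the points
   lying over [Z], and [reduced_part V] is the preimage of [V] in it. *)
Definition reduced_part (V : set (spec A)) :
  set (spec (quot vanishing_ideal)) :=
  [set y | (Z `&` V) (comap (quot_pi vanishing_ideal) y)].

(* A morphism to [spec A] is affine when [spec A] has a cover by affine open
   subsets whose preimages are affine. *)
Definition affine_inclusion : Prop :=
  exists C : set (set (spec A)),
    [/\ forall V, C V -> affine_open V,
        \bigcup_(V in C) V = setT &
        forall V, C V -> affine_open (reduced_part V)].

Definition pure : Prop := locally_closed Z /\ affine_inclusion.

End ReducedSubscheme.

Inductive polyterm (A : Type) (n : nat) :=
  | PConst of A
  | PVar of 'I_n
  | PAdd of polyterm A n & polyterm A n
  | PMul of polyterm A n & polyterm A n.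

Arguments PVar {A n}.

Fixpoint peval (A C : comPzRingType) n (g : {rmorphism A -> C}) (c : 'I_n -> C)
    (t : polyterm A n) : C :=
  match t with
  | PConst a => g a
  | PVar i => c i
  | PAdd t1 t2 => peval g c t1 + peval g c t2
  | PMul t1 t2 => peval g c t1 * peval g c t2
  end.

Section Etale.
Variables (A B : comPzRingType) (e : {rmorphism A -> B}).

(* [B] is the quotient of the polynomial [A]-algebra in [n] variables by
   finitely many polynomials [rels], the classes of the variables being [b];
   this is stated by the universal property of that quotient, which makes sense
   over the zero ring as well. *)
Definition finitely_presented : Prop :=
  exists (n m : nat) (b : 'I_n -> B) (rels : 'I_m -> polyterm A n),
    (forall i, peval e b (rels i) = 0) /\
    forall (C : comPzRingType) (g : {rmorphism A -> C}) (c : 'I_n -> C),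
      (forall i, peval g c (rels i) = 0) ->
      (exists k : {rmorphism B -> C}, k \o e =1 g /\ k \o b =1 c) /\
      (forall k k' : {rmorphism B -> C},
         k \o e =1 g -> k \o b =1 c -> k' \o e =1 g -> k' \o b =1 c -> k =1 k').

(* Infinitesimal lifting along surjections with kernel of square zero; lifting
   along an arbitrary nilpotent ideal follows by iteration. *)
Definition formally_etale : Prop :=
  forall (C D : comPzRingType) (pi : {rmorphism C -> D}),
    (forall d, exists c, pi c = d) ->
    (forall c c', pi c = 0 -> pi c' = 0 -> c * c' = 0) ->
    forall (g : {rmorphism A -> C}) (h : {rmorphism B -> D}),
      h \o e =1 pi \o g ->
      (exists k : {rmorphism B -> C}, k \o e =1 g /\ pi \o k =1 h) /\
      (forall k k' : {rmorphism B -> C},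
         k \o e =1 g -> pi \o k =1 h -> k' \o e =1 g -> pi \o k' =1 h ->
         k =1 k').

Definition etale : Prop := formally_etale /\ finitely_presented.

End Etale.

Definition is_pushout (A B K C : comPzRingType)
    (e : {rmorphism A -> B}) (f : {rmorphism A -> K})
    (u : {rmorphism B -> C}) (v : {rmorphism K -> C}) : Prop :=
  u \o e =1 v \o f /\
  forall (D : comPzRingType) (u' : {rmorphism B -> D}) (v' : {rmorphism K -> D}),
    u' \o e =1 v' \o f ->
    (exists w : {rmorphism C -> D}, w \o u =1 u' /\ w \o v =1 v') /\
    (forall w w' : {rmorphism C -> D},
       w \o u =1 u' -> w \o v =1 v' -> w' \o u =1 u' -> w' \o v =1 v' ->
       w =1 w').

Section Stratification.
Variables (A B : comPzRingType) (e : {rmorphism A -> B}).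

Definition is_algebraic_closure (k : fieldType) (K : closedFieldType)
    (j : {rmorphism k -> K}) : Prop :=
  forall z : K, algebraicOver j z.

(* [K] is an algebraic closure of the residue field of [x], and [C] is the
   tensor product of [B] and [K] over [A], so that [spec C] is the geometric
   fiber of [spec B -> spec A] at [x]. *)
Definition geometric_fiber_card (x : spec A) (n : nat) : Prop :=
  exists (K : closedFieldType) (j : {rmorphism residue_field x -> K})
    (C : comPzRingType) (u : {rmorphism B -> C}) (v : {rmorphism K -> C}),
    [/\ is_algebraic_closure j, is_pushout e (j \o residue x) u v &
        ([set: spec C] #= `I_n)%card].

(* The subsets [stratum e mu_l], for [mu] the shortest strictly decreasing
   sequence containing all the cardinals of geometric fibers, form the
   stratification. *)
Definition fiber_card_sequence (mu : seq nat) : Prop :=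
  sorted gtn mu /\
  forall x, exists2 l, (l < size mu)%N & geometric_fiber_card x (nth 0%N mu l).

Definition stratification_sequence (mu : seq nat) : Prop :=
  fiber_card_sequence mu /\
  forall nu, fiber_card_sequence nu -> (size mu <= size nu)%N.

Definition stratum (m : nat) : set (spec A) :=
  [set x | geometric_fiber_card x m].

End Stratification.

(* Main.v *)
Require Import Defs.
From HB Require Import structures.
From mathcomp Require Import fingroup perm.
From mathcomp Require Import all_boot all_order all_algebra.
From mathcomp Require Import boolp classical_sets functions topology_structure.
From mathcomp Require Import cardinality ring.

(** Locally on the base a finite etale cover with fibres of [n] points is the
    quotient of the space of orderings of its fibres, a torsor under the
    symmetric group. This space makes sense for any etale algebra [B] over [A]:
    it is the part of the spectrum of the [n]-th tensor power [T] of [B] where an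
    idempotent [w = omega] is equal to 1, namely the families of [n] pairwise
    distinct points of a fibre. The idempotent is built from a separability
    idempotent of [B] ([etale_separability]). A point [x] has at least [n]
    geometric points above it if and only if [w] is not in [x T]
    ([geometric_points], [power_point]).

    All the algebra takes place over a noetherian ring, from which [B] comes by
    base change ([noetherian_model]) together with its separability idempotent and
    its flatness. Flatness is a consequence of infinitesimal lifting
    ([flat_lift]): lifting the identity of [B] gives an endomorphism of a
    polynomial ring that pushes the ideal of [B] into its powers, and the
    Artin-Rees lemma concludes. Over the noetherian ring the locus of the points
    with at least [n] geometric points is open ([omega_neighbourhood]), by
    noetherian induction from the fact that a separable flat algebra over a domain
    is generically finite ([separable_generically_finite]). So the strata are
    locally closed ([stratumE]).

    Affineness of a stratum is a matter of its closure, the spectrum of a quotient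
    [R] of [A]. There the stratum [U] is open, and no fibre has more than [n]
    geometric points. Since [w] is zero outside [U], it lies in [J T] for [J] the
    ideal of the complement of [U]. Its norm under the symmetric group
    ([symmetric_norm]) is [w] again, and reads [w = \sum_l F_l s_l] with [F_l] in
    [J] and [s_l] symmetric. Over [U] two orderings of a fibre differ by a
    permutation, hence a symmetric function takes the same value at both
    ([symmetric_coincide]), and by flat descent it comes from a section [g_l] of
    the structure sheaf over [U] ([symmetric_descent]). Thus
    [\sum_l F_l g_l = 1]: functions that vanish outside [U] generate the unit
    ideal over [U], and [U] is affine ([affine_criterion]). *)

Set Implicit Arguments.
Unset Strict Implicit.
Unset Printing Implicit Defensive.

Import GRing.Theory.
Local Open Scope ring_scope.

(** * Ideals and prime ideals *)

Section Span.
Variables (A : comPzRingType) (S : A -> Prop).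

Inductive span_set : A -> Prop :=
  | span_set0 : span_set 0
  | span_set_gen s : S s -> span_set s
  | span_setD a b : span_set a -> span_set b -> span_set (a + b)
  | span_setM a b : span_set b -> span_set (a * b).

Definition ideal_span : ideal A := Ideal span_set0 span_setD span_setM.

Lemma span_gen s : S s -> ideal_span s.
Proof. exact: span_set_gen. Qed.

Lemma span_min (I : ideal A) : (forall s, S s -> I s) -> forall a, ideal_span a -> I a.
Proof.
move=> SI a; elim=> [|s /SI //|b c _ Ib _ Ic|b c _ Ic]; first exact: ideal0.
  exact: idealD.
exact: idealM.
Qed.

End Span.

Arguments ideal_span : simpl never.

Lemma ideal_mulr (A : comPzRingType) (I : ideal A) a b : I a -> I (a * b).
Proof. by rewrite mulrC; apply: idealM. Qed.

Lemma ideal_sum (A : comPzRingType) (I : ideal A) (J : Type) (s : seq J)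
    (P : pred J) (F : J -> A) :
  (forall j, P j -> I (F j)) -> I (\sum_(j <- s | P j) F j).
Proof.
by move=> h; apply: (big_ind I) => //; [exact: ideal0|exact: idealD].
Qed.

Lemma span_fin (A : comPzRingType) (J : finType) (G : J -> A) a :
  ideal_span (fun z => exists j, z = G j) a -> exists c : J -> A, a = \sum_j c j * G j.
Proof.
elim=> [|s [j ->]|b c _ [x ->] _ [y ->]|b c _ [x ->]].
- by exists (fun=> 0); rewrite big1 // => j _; rewrite mul0r.
- exists (fun i => (i == j)%:R); rewrite (bigD1 j) //= eqxx mul1r.
  by rewrite big1 ?addr0 // => i /negPf->; rewrite mul0r.
- exists (fun j => x j + y j); rewrite -big_split /=.
  by apply: eq_bigr => j _; rewrite mulrDl.
- exists (fun j => b * x j); rewrite mulr_sumr.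
  by apply: eq_bigr => j _; rewrite mulrA.
Qed.

Lemma quot_pi0 (A : comPzRingType) (I : ideal A) a : quot_pi I a = 0 <-> I a.
Proof.
rewrite -[0]/(quot_pi I 0); split=> [/quot_pi_eq|h]; first by rewrite subr0.
by apply/quot_pi_eq; rewrite subr0.
Qed.

Section Factor.
Variables (A D : comPzRingType) (I : ideal A) (g : {rmorphism A -> D}).
Hypothesis gI : forall a, I a -> g a = 0.

Definition quot_factor (u : quot I) : D := g (repr u).

Lemma quot_factorE a : quot_factor (quot_pi I a) = g a.
Proof.
apply/eqP; rewrite -subr_eq0 -rmorphB; apply/eqP/gI/quot_pi_eq.
by rewrite /quot_pi reprK.
Qed.

Lemma quot_factorP :
  exists k : {rmorphism quot I -> D}, forall a, k (quot_pi I a) = g a.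
Proof.
have kB : zmod_morphism quot_factor.
  move=> u v; have [a ->] := quot_piP u; have [b ->] := quot_piP v.
  by rewrite -rmorphB !quot_factorE rmorphB.
have kM : monoid_morphism quot_factor.
  split=> [|u v]; first by rewrite -[1]/(quot_pi I 1) quot_factorE rmorph1.
  have [a ->] := quot_piP u; have [b ->] := quot_piP v.
  by rewrite -rmorphM !quot_factorE rmorphM.
pose kA := GRing.isZmodMorphism.Build (quot I) D quot_factor kB.
pose kM' := GRing.isMonoidMorphism.Build (quot I) D quot_factor kM.
pose k : {rmorphism quot I -> D} := HB.pack quot_factor kA kM'.
by exists k => a; apply: quot_factorE.
Qed.

End Factor.

(** Krull's existence theorem, by Zorn's lemma: an ideal maximal among those
    containing [I] and missing all powers of [f] is prime. *)
Lemma prime_avoiding (A : comPzRingType) (I : ideal A) (f : A) :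
  (forall n, ~ I (f ^+ n)) ->
  exists x : spec A, (forall a, I a -> x a) /\ ~ x f.
Proof.
move=> fI.
pose P (X : set A) := exists J : ideal A,
  [/\ forall a, X a -> J a, forall a, I a -> J a, forall n, ~ J (f ^+ n) &
   forall a, J a -> I a \/ X a].
(* The union of the empty chain is empty, hence not an ideal: the sets [X] are
   ideals only after the elements of [I] are added to them. *)
have [X [[J [XJ IJ fJ JX]] maxX]] : exists X, P X /\ forall Y, (X `<` Y)%classic -> ~ P Y.
  apply: Zorn_bigcup => F FP Ftot.
  pose U a := I a \/ exists2 X, F X & X a.
  have U0 : U 0 by left; apply: ideal0.
  have UD a b : U a -> U b -> U (a + b).
    have UI c d : I c -> U d -> U (c + d).
      move=> Ic [Id|[X FX Xd]]; first by left; apply: idealD.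
      have [J [XJ IJ _ JX]] := FP X FX.
      have /JX[|] : J (c + d) by apply: idealD; [exact: IJ|exact: XJ].
        by left.
      by right; exists X.
    move=> Ua Ub; case: Ua Ub => [Ia|[X FX Xa]]; first exact: UI.
    case=> [Ib|[Y FY Yb]]; first by rewrite addrC; apply: UI => //; right; exists X.
    have [Z [FZ Za Zb]] : exists Z, [/\ F Z, Z a & Z b].
      by case: (Ftot X Y FX FY) => h; [exists Y|exists X]; split=> //; apply: h.
    have [J [ZJ IJ _ JZ]] := FP Z FZ.
    have /JZ[|] : J (a + b) by apply: idealD; apply: ZJ.
      by left.
    by right; exists Z.
  have UM a b : U b -> U (a * b).
    case=> [Ib|[X FX Xb]]; first by left; apply: idealM.
    have [J [XJ IJ _ JX]] := FP X FX.
    have /JX[|] : J (a * b) by apply/idealM/XJ.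
      by left.
    by right; exists X.
  exists (Ideal U0 UD UM); split=> /=.
  - by move=> a [X FX Xa]; right; exists X.
  - by move=> a; left.
  - move=> n [/fI//|[X FX Xf]]; have [J [XJ _ fJ _]] := FP X FX.
    exact/(fJ n)/XJ.
  - by move=> a [|[X FX Xa]]; [left|right; exists X].
have big (a : A) : ~ J a -> exists n b j, J j /\ f ^+ n = a * b + j.
  move=> nJa; pose Y c := exists b j, J j /\ c = a * b + j.
  have Y0 : Y 0 by exists 0, 0; split; [exact: ideal0|rewrite mulr0 addr0].
  have YD c d : Y c -> Y d -> Y (c + d).
    move=> [b [j [Jj ->]]] [b' [j' [Jj' ->]]]; exists (b + b'), (j + j').
    by split; [exact: idealD|ring].
  have YM c d : Y d -> Y (c * d).
    move=> [b [j [Jj ->]]]; exists (c * b), (c * j).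
    by split; [exact: idealM|ring].
  have JY c : J c -> Y c by move=> Jc; exists 0, c; split=> //; ring.
  have XY : (X `<` Y)%classic.
    split; first by move=> c /XJ /JY.
    move=> /(_ a) YX; apply/nJa/XJ/YX; exists 1, 0.
    by split; [exact: ideal0|ring].
  apply: contrapT => nf; apply: (maxX _ XY); exists (Ideal Y0 YD YM).
  split=> //=; first by move=> c /IJ /JY.
    by move=> n [b [j [Jj e]]]; apply: nf; exists n, b, j.
  by move=> c; right.
have J1 : ~ J 1 by have := fJ 0%N; rewrite expr0.
have JM a b : J (a * b) -> J a \/ J b.
  move=> Jab; apply: contrapT => /not_orP[/big[n [c [j [Jj e]]]]].
  move=> /big[m [d [k [Jk e']]]]; apply: (fJ (n + m)%N).
  rewrite exprD e e'.
  have -> : (a * c + j) * (b * d + k) = c * d * (a * b) + a * c * k + (b * d + k) * j.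
    by ring.
  by apply: idealD; [apply: idealD|]; apply: idealM.
by exists (Spec J1 JM); split=> //=; move: (fJ 1%N); rewrite expr1.
Qed.

Lemma prime_over (A : comPzRingType) (I : ideal A) :
  ~ I 1 -> exists x : spec A, forall a, I a -> x a.
Proof.
move=> I1; have [|x [Ix _]] := @prime_avoiding A I 1; last by exists x.
by move=> n; rewrite expr1n.
Qed.

(** An idempotent is equal to all its positive powers. Through this lemma,
    equalities between the idempotents [omega] below are checked prime by prime. *)
Lemma idempotent_in_ideal (A : comPzRingType) (I : ideal A) (w : A) :
  w * w = w -> (forall x : spec A, (forall a, I a -> x a) -> x w) -> I w.
Proof.
move=> ww h; apply: contrapT => nIw.
have [n|x [Ix]] := @prime_avoiding A I w; last by apply; apply: h.
case: n => [|n]; last first.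
  suff -> : w ^+ n.+1 = w by [].
  by elim: n => [|n IH]; rewrite ?expr1 // exprS IH.
by rewrite expr0 => I1; apply: nIw; rewrite -[w]mulr1; apply: idealM.
Qed.

Lemma prime_prod (A : comPzRingType) (x : spec A) (J : Type) (s : seq J)
    (P : pred J) (F : J -> A) :
  (forall j, P j -> ~ x (F j)) -> ~ x (\prod_(j <- s | P j) F j).
Proof.
move=> h; apply: (big_ind (fun a => ~ x a)) => //; first exact: prime_proper.
by move=> a b na nb /prime_mul[].
Qed.

Section KernelPoint.
Variables (A : comPzRingType) (D : idomainType) (g : {rmorphism A -> D}).

Let ker0 : g 0 = 0. Proof. exact: rmorph0. Qed.
Let kerD a b : g a = 0 -> g b = 0 -> g (a + b) = 0.
Proof. by rewrite rmorphD => -> ->; rewrite addr0. Qed.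
Let kerM a b : g b = 0 -> g (a * b) = 0.
Proof. by rewrite rmorphM => ->; rewrite mulr0. Qed.

Definition kernel_ideal : ideal A := @Ideal A (fun a => g a = 0) ker0 kerD kerM.

Let ker_proper : ~ kernel_ideal 1.
Proof. by rewrite /= rmorph1; apply/eqP/oner_neq0. Qed.
Let ker_prime a b : kernel_ideal (a * b) -> kernel_ideal a \/ kernel_ideal b.
Proof.
rewrite /= rmorphM => /eqP; rewrite mulf_eq0 => /orP[]/eqP; first by left.
by right.
Qed.

Definition kernel_point : spec A := Spec ker_proper ker_prime.

End KernelPoint.

(** * Pushouts of rings *)

Section Pushout.
Variables (A B K : comPzRingType) (e : {rmorphism A -> B}) (f : {rmorphism A -> K}).

(** The tensor product is built as a quotient of the terms of the language of
    rings with constants in [B] and [K], by the congruence generated by the ring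
    axioms: its universal property is then the evaluation of terms. *)
Inductive pterm :=
  | PL of B
  | PR of K
  | PA of pterm & pterm
  | PM of pterm & pterm.

Inductive pcong : pterm -> pterm -> Prop :=
  | pc_refl s : pcong s s
  | pc_sym s t : pcong s t -> pcong t s
  | pc_trans s t r : pcong s t -> pcong t r -> pcong s r
  | pc_add s s' t t' : pcong s s' -> pcong t t' -> pcong (PA s t) (PA s' t')
  | pc_mul s s' t t' : pcong s s' -> pcong t t' -> pcong (PM s t) (PM s' t')
  | pc_addA s t r : pcong (PA s (PA t r)) (PA (PA s t) r)
  | pc_addC s t : pcong (PA s t) (PA t s)
  | pc_add0 s : pcong (PA (PL 0) s) s
  | pc_addN s : pcong (PA (PM (PL (-1)) s) s) (PL 0)
  | pc_mulA s t r : pcong (PM s (PM t r)) (PM (PM s t) r)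
  | pc_mulC s t : pcong (PM s t) (PM t s)
  | pc_mul1 s : pcong (PM (PL 1) s) s
  | pc_mulD s t r : pcong (PM (PA s t) r) (PA (PM s r) (PM t r))
  | pc_LD a b : pcong (PL (a + b)) (PA (PL a) (PL b))
  | pc_LM a b : pcong (PL (a * b)) (PM (PL a) (PL b))
  | pc_RD a b : pcong (PR (a + b)) (PA (PR a) (PR b))
  | pc_RM a b : pcong (PR (a * b)) (PM (PR a) (PR b))
  | pc_glue a : pcong (PL (e a)) (PR (f a)).

HB.instance Definition _ := gen_eqMixin pterm.
HB.instance Definition _ := gen_choiceMixin pterm.

Definition pcongb (s t : pterm) : bool := `[< pcong s t >].

Lemma pcong_equiv : equiv_class_of pcongb.
Proof.
split=> [s|s t|t s r].
- exact/asboolP/pc_refl.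
- by apply/asboolP/asboolP; apply: pc_sym.
- by move=> /asboolP h /asboolP h'; apply/asboolP/(pc_trans h h').
Qed.

Canonical pcong_equiv_rel := EquivRelPack pcong_equiv.

Definition pushout := {eq_quot pcongb}%qT.
HB.instance Definition _ := Choice.on pushout.
HB.instance Definition _ : EqQuotient pterm pcongb pushout := EqQuotient.on pushout.

Definition pclass (s : pterm) : pushout := (\pi_pushout s)%qT.

Lemma pclass_eq s t : pclass s = pclass t <-> pcong s t.
Proof. by split=> [/eqmodP/asboolP|h]; [|apply/eqmodP/asboolP]. Qed.

Lemma pclassP (u : pushout) : exists s, u = pclass s.
Proof. by exists (repr u); rewrite /pclass reprK. Qed.

Let repr_class s : pcong (repr (pclass s)) s.
Proof. by apply/pclass_eq; rewrite /pclass reprK. Qed.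

Definition padd (u v : pushout) : pushout := pclass (PA (repr u) (repr v)).
Definition pmul (u v : pushout) : pushout := pclass (PM (repr u) (repr v)).
Definition popp (u : pushout) : pushout := pmul (pclass (PL (-1))) u.

Lemma paddE s t : padd (pclass s) (pclass t) = pclass (PA s t).
Proof. by apply/pclass_eq/pc_add; apply: repr_class. Qed.
Lemma pmulE s t : pmul (pclass s) (pclass t) = pclass (PM s t).
Proof. by apply/pclass_eq/pc_mul; apply: repr_class. Qed.

Let addA : associative padd.
Proof.
move=> u v w; have [s ->] := pclassP u; have [t ->] := pclassP v.
by have [r ->] := pclassP w; rewrite !paddE; apply/pclass_eq/pc_addA.
Qed.
Let addC : commutative padd.
Proof.
move=> u v; have [s ->] := pclassP u; have [t ->] := pclassP v.
by rewrite !paddE; apply/pclass_eq/pc_addC.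
Qed.
Let add0 : left_id (pclass (PL 0)) padd.
Proof. by move=> u; have [s ->] := pclassP u; rewrite paddE; apply/pclass_eq/pc_add0. Qed.
Let addN : left_inverse (pclass (PL 0)) popp padd.
Proof.
by move=> u; have [s ->] := pclassP u; rewrite /popp pmulE paddE; apply/pclass_eq/pc_addN.
Qed.
HB.instance Definition _ := GRing.isZmodule.Build pushout addA addC add0 addN.

Let mulA : associative pmul.
Proof.
move=> u v w; have [s ->] := pclassP u; have [t ->] := pclassP v.
by have [r ->] := pclassP w; rewrite !pmulE; apply/pclass_eq/pc_mulA.
Qed.
Let mulC : commutative pmul.
Proof.
move=> u v; have [s ->] := pclassP u; have [t ->] := pclassP v.
by rewrite !pmulE; apply/pclass_eq/pc_mulC.
Qed.
Let mul1 : left_id (pclass (PL 1)) pmul.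
Proof. by move=> u; have [s ->] := pclassP u; rewrite pmulE; apply/pclass_eq/pc_mul1. Qed.
Let mulD : left_distributive pmul padd.
Proof.
move=> u v w; have [s ->] := pclassP u; have [t ->] := pclassP v.
by have [r ->] := pclassP w; rewrite !(paddE, pmulE); apply/pclass_eq/pc_mulD.
Qed.
HB.instance Definition _ := GRing.Zmodule_isComPzRing.Build pushout mulA mulC mul1 mulD.

Definition pinl (b : B) : pushout := pclass (PL b).
Definition pinr (k : K) : pushout := pclass (PR k).

Let pinlD a b : pinl (a + b) = pinl a + pinl b.
Proof. by rewrite -[RHS]/(padd _ _) paddE; apply/pclass_eq/pc_LD. Qed.
Let pinrD a b : pinr (a + b) = pinr a + pinr b.
Proof. by rewrite -[RHS]/(padd _ _) paddE; apply/pclass_eq/pc_RD. Qed.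
Let additive_sub (U V : zmodType) (g : U -> V) :
  (forall a b, g (a + b) = g a + g b) -> zmod_morphism g.
Proof.
move=> gD a b; have g0 : g 0 = 0.
  by apply: (addrI (g 0)); rewrite -gD !addr0.
have gN c : g (- c) = - g c by apply: (addrI (g c)); rewrite -gD !subrr g0.
by rewrite gD gN.
Qed.
Let pinlM : monoid_morphism pinl.
Proof.
split=> // a b; rewrite -[RHS]/(pmul _ _) pmulE; apply/pclass_eq/pc_LM.
Qed.
Let pinrM : monoid_morphism pinr.
Proof.
split=> [|a b]; last by rewrite -[RHS]/(pmul _ _) pmulE; apply/pclass_eq/pc_RM.
apply/esym/pclass_eq; rewrite -(rmorph1 f); have := pc_glue 1.
by rewrite (rmorph1 e).
Qed.
HB.instance Definition _ := GRing.isZmodMorphism.Build B pushout pinl (additive_sub pinlD).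
HB.instance Definition _ := GRing.isMonoidMorphism.Build B pushout pinl pinlM.
HB.instance Definition _ := GRing.isZmodMorphism.Build K pushout pinr (additive_sub pinrD).
HB.instance Definition _ := GRing.isMonoidMorphism.Build K pushout pinr pinrM.

Lemma pushout_ind0 (Q : pushout -> Prop) :
  (forall b, Q (pinl b)) -> (forall k, Q (pinr k)) ->
  (forall s t, Q s -> Q t -> Q (s + t)) -> (forall s t, Q s -> Q t -> Q (s * t)) ->
  forall t, Q t.
Proof.
move=> QL QR QD QM u; have [s ->] := pclassP u.
elim: s => [b|k|s Qs t Qt|s Qs t Qt]; [exact: QL|exact: QR| |].
  by rewrite -paddE; apply: QD.
by rewrite -pmulE; apply: QM.
Qed.

Fixpoint peval2 (D : comPzRingType) (u' : B -> D) (v' : K -> D) (t : pterm) : D :=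
  match t with
  | PL b => u' b
  | PR k => v' k
  | PA s t => peval2 u' v' s + peval2 u' v' t
  | PM s t => peval2 u' v' s * peval2 u' v' t
  end.

Lemma peval2_cong (D : comPzRingType) (u' : {rmorphism B -> D})
    (v' : {rmorphism K -> D}) s t :
  u' \o e =1 v' \o f -> pcong s t -> peval2 u' v' s = peval2 u' v' t.
Proof.
move=> uv; elim=> //=.
- by move=> {}s {}t r _ -> _ ->.
- by move=> s1 s2 t1 t2 _ -> _ ->.
- by move=> s1 s2 t1 t2 _ -> _ ->.
- by move=> *; rewrite addrA.
- by move=> *; rewrite addrC.
- by move=> *; rewrite rmorph0 add0r.
- by move=> r; rewrite rmorphN1 mulN1r addNr rmorph0.
- by move=> *; rewrite mulrA.
- by move=> *; rewrite mulrC.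
- by move=> *; rewrite rmorph1 mul1r.
- by move=> *; rewrite mulrDl.
- by move=> *; rewrite rmorphD.
- by move=> *; rewrite rmorphM.
- by move=> *; rewrite rmorphD.
- by move=> *; rewrite rmorphM.
Qed.

Lemma pushoutP : is_pushout e f (pinl : {rmorphism _ -> _}) (pinr : {rmorphism _ -> _}).
Proof.
split=> [a|D u' v' uv]; first by apply/pclass_eq/pc_glue.
pose w (u : pushout) : D := peval2 u' v' (repr u).
have wE s : w (pclass s) = peval2 u' v' s by apply: peval2_cong.
split.
  have wB : zmod_morphism w.
    apply: additive_sub => a b; have [s ->] := pclassP a; have [t ->] := pclassP b.
    by rewrite -[_ + _]/(padd _ _) paddE !wE.
  have wM : monoid_morphism w.
    split; first by rewrite -[1]/(pclass (PL 1)) wE /= rmorph1.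
    move=> a b; have [s ->] := pclassP a; have [t ->] := pclassP b.
    by rewrite -[_ * _]/(pmul _ _) pmulE !wE.
  pose wA := GRing.isZmodMorphism.Build pushout D w wB.
  pose wM' := GRing.isMonoidMorphism.Build pushout D w wM.
  pose w' : {rmorphism pushout -> D} := HB.pack w wA wM'.
  by exists w'; split=> z; apply: wE.
move=> g g' gu gv gu' gv'; apply: pushout_ind0 => [b|k|s t|s t].
- by rewrite [LHS]gu [RHS]gu'.
- by rewrite [LHS]gv [RHS]gv'.
- by rewrite !rmorphD => -> ->.
- by rewrite !rmorphM => -> ->.
Qed.

End Pushout.

Lemma pushout_exists (A B K : comPzRingType) (e : {rmorphism A -> B})
    (f : {rmorphism A -> K}) :
  exists (C : comPzRingType) (u : {rmorphism B -> C}) (v : {rmorphism K -> C}),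
    is_pushout e f u v.
Proof. by exists (pushout e f), (@pinl _ _ _ e f), (@pinr _ _ _ e f); apply: pushoutP. Qed.

Section PushoutTheory.
Variables (A B K C : comPzRingType) (e : {rmorphism A -> B}) (f : {rmorphism A -> K}).
Variables (u : {rmorphism B -> C}) (v : {rmorphism K -> C}).
Hypothesis po : is_pushout e f u v.

Lemma pushout_ind (Q : C -> Prop) :
  (forall b, Q (u b)) -> (forall k, Q (v k)) ->
  (forall s t, Q s -> Q t -> Q (s + t)) -> (forall s t, Q s -> Q t -> Q (s * t)) ->
  forall t, Q t.
Proof.
move=> Qu Qv QD QM t.
have [uv univ] := po; have [cuv cuniv] := pushoutP e f.
have [[w [wu wv]] _] := univ _ _ _ cuv.
have [[w' [wu' wv']] _] := cuniv _ _ _ uv.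
have w'w : w' \o w =1 idfun.
  have [_ uniq] := univ _ _ _ uv.
  apply: (uniq (w' \o w : {rmorphism _ -> _}) idfun) => // z /=.
    by rewrite -[w _]/((w \o u) z) wu; exact: wu'.
  by rewrite -[w _]/((w \o v) z) wv; exact: wv'.
rewrite -[t]w'w /=; elim/pushout_ind0: {t}(w t) => [b|k|s t|s t].
- by rewrite -[w' _]/((w' \o @pinl _ _ _ e f) b) wu'.
- by rewrite -[w' _]/((w' \o @pinr _ _ _ e f) k) wv'.
- by rewrite rmorphD; apply: QD.
- by rewrite rmorphM; apply: QM.
Qed.

Lemma pushout_sum t : exists (I : finType) (b : I -> B) (k : I -> K),
  t = \sum_i u (b i) * v (k i).
Proof.
elim/pushout_ind: t => [b|k|s t [I [b [k ->]]] [J [c [l ->]]]|s t [I [b [k ->]]] [J [c [l ->]]]].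
- by exists unit, (fun=> b), (fun=> 1); rewrite big_const card_unit /= rmorph1 mulr1 addr0.
- by exists unit, (fun=> 1), (fun=> k); rewrite big_const card_unit /= rmorph1 mul1r addr0.
- exists (I + J)%type, (fun x => match x with inl i => b i | inr j => c j end).
  exists (fun x => match x with inl i => k i | inr j => l j end).
  by rewrite big_sumType.
- exists (I * J)%type, (fun x => b x.1 * c x.2), (fun x => k x.1 * l x.2).
  rewrite big_distrlr pair_big; apply: eq_bigr => -[i j] _ /=.
  by rewrite !rmorphM; ring.
Qed.

Lemma pushout_lift (D : comPzRingType) (u' : {rmorphism B -> D}) (v' : {rmorphism K -> D}) :
  u' \o e =1 v' \o f ->
  exists w : {rmorphism C -> D}, w \o u =1 u' /\ w \o v =1 v'.
Proof. by move=> uv; have [_ /(_ _ _ _ uv)[]] := po. Qed.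

Lemma pushout_ext (D : comPzRingType) (g g' : {rmorphism C -> D}) :
  (forall b, g (u b) = g' (u b)) -> (forall k, g (v k) = g' (v k)) -> g =1 g'.
Proof.
move=> gu gv; apply: pushout_ind => // s t gs gt.
  by rewrite !rmorphD gs gt.
by rewrite !rmorphM gs gt.
Qed.

Lemma pushout_glue a : u (e a) = v (f a).
Proof. by have [uv _] := po; apply: uv. Qed.

Lemma pushout_sym : is_pushout f e v u.
Proof.
have [uv univ] := po; split=> [a|D v' u' vu]; first exact/esym/uv.
have [|[w [wu wv]] uniq] := univ D u' v'; first by move=> a; apply/esym/vu.
split; first by exists w.
by move=> g g' *; apply: uniq.
Qed.

End PushoutTheory.

Lemma pushout_paste (A A' A'' B B' B'' : comPzRingType)
    (e : {rmorphism A -> B}) (f : {rmorphism A -> A'})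
    (g : {rmorphism A' -> A''}) (u : {rmorphism B -> B'}) (e' : {rmorphism A' -> B'})
    (u' : {rmorphism B' -> B''}) (e'' : {rmorphism A'' -> B''}) :
  is_pushout e f u e' -> is_pushout e' g u' e'' ->
  is_pushout e (g \o f : {rmorphism _ -> _}) (u' \o u : {rmorphism _ -> _}) e''.
Proof.
move=> po po'; split=> [a|D k l kl] /=.
  by rewrite (pushout_glue po) (pushout_glue po').
have [w [wu we]] := pushout_lift po (u' := k) (v' := (l \o g : {rmorphism _ -> _})) kl.
have [w' [wu' we']] := pushout_lift po' (u' := w) (v' := l) we.
split; first by exists w'; split=> // b; rewrite -[RHS]wu -[RHS]wu'.
move=> h h' hu he hu' he'; apply: (pushout_ext po') => [b|a]; last first.
  by rewrite [LHS]he [RHS]he'.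
apply: (pushout_ext po (g := (h \o u' : {rmorphism _ -> _}))
  (g' := (h' \o u' : {rmorphism _ -> _}))) => [{}b|a] /=.
  by rewrite [LHS]hu [RHS]hu'.
by rewrite (pushout_glue po') [LHS]he [RHS]he'.
Qed.

Lemma pushout_cancel (A A' A'' B B' B'' : comPzRingType)
    (e : {rmorphism A -> B}) (f : {rmorphism A -> A'})
    (g : {rmorphism A' -> A''}) (u : {rmorphism B -> B'}) (e' : {rmorphism A' -> B'})
    (u' : {rmorphism B' -> B''}) (e'' : {rmorphism A'' -> B''}) :
  is_pushout e f u e' -> u' \o e' =1 e'' \o g ->
  is_pushout e (g \o f : {rmorphism _ -> _}) (u' \o u : {rmorphism _ -> _}) e'' ->
  is_pushout e' g u' e''.
Proof.
move=> po comm po'; split=> // D k l kl.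
have kl' : (k \o u) \o e =1 l \o (g \o f).
  by move=> a /=; rewrite (pushout_glue po) -[RHS]kl.
have [w [wu we]] := pushout_lift po' (u' := (k \o u : {rmorphism _ -> _})) (v' := l) kl'.
split.
  exists w; split=> //.
  apply: (pushout_ext po (g := (w \o u' : {rmorphism _ -> _})) (g' := k)) => [b|a] /=.
    exact: wu.
  by rewrite -[u' _]/((u' \o e') a) comm -[RHS]/((k \o e') a) kl; apply: we.
move=> h h' hu he hu' he'; apply: (pushout_ext po') => [b|a] /=.
  by rewrite -[LHS]/((h \o u') (u b)) -[RHS]/((h' \o u') (u b)) [LHS]hu [RHS]hu'.
by rewrite [LHS]he [RHS]he'.
Qed.

(** * Flatness *)

Lemma is_pushout_eq (A B K C : comPzRingType) (e e' : {rmorphism A -> B})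
    (f f' : {rmorphism A -> K}) (u u' : {rmorphism B -> C}) (v v' : {rmorphism K -> C}) :
  e =1 e' -> f =1 f' -> u =1 u' -> v =1 v' -> is_pushout e f u v -> is_pushout e' f' u' v'.
Proof.
move=> ee ff uu vv [uv univ]; split=> [a|D k l kl] /=.
  by rewrite -ee -ff -uu -vv; apply: uv.
have [|[w [wu wv]] uniq] := univ D k l; first by move=> a /=; rewrite ee ff; apply: kl.
split; first by exists w; split=> z /=; rewrite -?uu -?vv; [apply: wu|apply: wv].
move=> g g' gu gv gu' gv'; apply: uniq => z /=; rewrite ?uu ?vv.
- exact: gu.
- exact: gv.
- exact: gu'.
- exact: gv'.
Qed.

Lemma sum_sigT (V : nmodType) (I : finType) (J : I -> finType)
    (G : {i : I & J i} -> V) :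
  \sum_p G p = \sum_i \sum_(j : J i) G (existT _ i j).
Proof.
rewrite (sig_big_dep (fun=> true) (fun _ _ => true) (fun i j => G (existT _ i j))) /=.
by apply: eq_bigr => -[i j].
Qed.

(** The equational criterion for flatness. The coefficients of a relation range
    over an arbitrary algebra [S], and not only over [A]: this is equivalent to
    flatness, and it makes base change and composition formal. *)
Definition flat (A N : comPzRingType) (nu : {rmorphism A -> N}) : Prop :=
  forall (S : comPzRingType) (th : {rmorphism A -> S}) (T : comPzRingType)
    (u : {rmorphism S -> T}) (v : {rmorphism N -> T}),
  is_pushout th nu u v ->
  forall (I : finType) (b : I -> S) (n : I -> N),
  \sum_i u (b i) * v (n i) = 0 ->
  exists (K : finType) (rho : I -> K -> A) (m : K -> N),
    (forall i, n i = \sum_k nu (rho i k) * m k) /\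
    forall k, \sum_i th (rho i k) * b i = 0.

Lemma flat_comp (A N N' : comPzRingType) (nu : {rmorphism A -> N})
    (mu : {rmorphism N -> N'}) :
  flat nu -> flat mu -> flat (mu \o nu : {rmorphism _ -> _}).
Proof.
move=> flnu flmu S th T u v po I b n rel.
have [T1 [u1 [v1 po1]]] := pushout_exists th nu.
have [w [wu wv]] : exists w : {rmorphism T1 -> T}, w \o u1 =1 u /\ w \o v1 =1 v \o mu.
  by apply: (pushout_lift po1 (v' := (v \o mu : {rmorphism _ -> _}))); have [] := po.
have po2 : is_pushout v1 mu w v.
  apply: (pushout_cancel po1 wv).
  by apply: is_pushout_eq po => // z; apply/esym/wu.
have rel2 : \sum_i w (u1 (b i)) * v (n i) = 0.
  by rewrite -[RHS]rel; apply: eq_bigr => i _; congr (_ * _); apply: wu.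
have [K [rho [m [nE relE]]]] := flmu _ _ _ _ _ po2 _ _ _ rel2.
have /choice[F FP] : forall k, exists F : {L : finType & (I -> L -> A) * (L -> N)}%type,
    (forall i, rho i k = \sum_l nu ((projT2 F).1 i l) * (projT2 F).2 l) /\
    forall l, \sum_i th ((projT2 F).1 i l) * b i = 0.
  move=> k; have rel1 : \sum_i u1 (b i) * v1 (rho i k) = 0.
    by rewrite -[RHS](relE k); apply: eq_bigr => i _; rewrite mulrC.
  have [L [sg [p [rE sE]]]] := flnu _ _ _ _ _ po1 _ _ _ rel1.
  by exists (existT _ L (sg, p)).
exists {k : K & projT1 (F k)}, (fun i x => (projT2 (F (tag x))).1 i (tagged x)).
exists (fun x => mu ((projT2 (F (tag x))).2 (tagged x)) * m (tag x)); split.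
  move=> i; rewrite nE sum_sigT.
  apply: eq_bigr => k _; have [rE _] := FP k; rewrite rE rmorph_sum mulr_suml.
  by apply: eq_bigr => l _; rewrite rmorphM mulrA.
by move=> [k l] /=; have [_] := FP k; apply.
Qed.

Lemma flat_base_change (A N S T : comPzRingType) (nu : {rmorphism A -> N})
    (th : {rmorphism A -> S}) (u : {rmorphism S -> T}) (v : {rmorphism N -> T}) :
  is_pushout th nu u v -> flat nu -> flat u.
Proof.
move=> po fl S' th' T' u' v' po' I b t rel.
have po2 : is_pushout (th' \o th : {rmorphism _ -> _}) nu u' (v' \o v : {rmorphism _ -> _}).
  by apply/pushout_sym/(pushout_paste (pushout_sym po))/pushout_sym.
have /choice[F FP] : forall i, exists F : {J : finType & (J -> S) * (J -> N)}%type,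
    t i = \sum_j u ((projT2 F).1 j) * v ((projT2 F).2 j).
  move=> i; have [J [s [n tE]]] := pushout_sum po (t i).
  by exists (existT _ J (s, n)).
pose X := {i : I & projT1 (F i)}.
pose s (x : X) := (projT2 (F (tag x))).1 (tagged x).
pose n (x : X) := (projT2 (F (tag x))).2 (tagged x).
have rel2 : \sum_x u' (b (tag x) * th' (s x)) * (v' \o v) (n x) = 0.
  rewrite -[RHS]rel sum_sigT.
  apply: eq_bigr => i _; rewrite [in RHS]FP rmorph_sum mulr_sumr.
  apply: eq_bigr => j _; rewrite !rmorphM (pushout_glue po') /=; ring.
have [K [rho [m [nE relE]]]] := fl _ _ _ _ _ po2 _ _ _ rel2.
exists K, (fun i k => \sum_(j : projT1 (F i)) (projT2 (F i)).1 j * th (rho (existT _ i j) k)).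
exists (v \o m); split=> [i|k].
  rewrite FP; transitivity (\sum_(j : projT1 (F i)) \sum_k
      u ((projT2 (F i)).1 j * th (rho (existT _ i j) k)) * v (m k)).
    apply: eq_bigr => j _; have := nE (existT _ i j); rewrite /n /= => ->.
    rewrite rmorph_sum mulr_sumr; apply: eq_bigr => k _.
    by rewrite !rmorphM /= -(pushout_glue po); ring.
  rewrite exchange_big; apply: eq_bigr => k _ /=.
  by rewrite rmorph_sum mulr_suml.
rewrite -[RHS](relE k) sum_sigT.
apply: eq_bigr => i _; rewrite rmorph_sum mulr_suml; apply: eq_bigr => j _.
by rewrite rmorphM; ring.
Qed.

(** The case of a relation with one term. For [S] a field and [b = 1], it goes
    from vanishing in a geometric fibre to membership in the extension of a
    prime of [A], with no denominator. *)
Lemma flat_annihilator (A N : comPzRingType) (nu : {rmorphism A -> N})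
    (S : comPzRingType) (th : {rmorphism A -> S}) (T : comPzRingType)
    (u : {rmorphism S -> T}) (v : {rmorphism N -> T}) (b : S) (n : N) :
  flat nu -> is_pushout th nu u v -> u b * v n = 0 ->
  exists (K : finType) (rho : K -> A) (m : K -> N),
    n = \sum_k nu (rho k) * m k /\ forall k, th (rho k) * b = 0.
Proof.
move=> fl po rel.
have rel' : \sum_(i : unit) u ((fun=> b) i) * v ((fun=> n) i) = 0.
  by rewrite (big_pred1 tt) // => -[].
have [K [rho [m [nE relE]]]] := fl _ _ _ _ _ po _ _ _ rel'.
exists K, (rho tt), m; split=> // k; have := relE k.
by rewrite (big_pred1 tt) // => -[].
Qed.

Lemma nonzero_ring (S : comPzRingType) :
  (1 : S) != 0 -> exists S1 : comNzRingType, (S1 : comPzRingType) = S.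
Proof.
move=> S0; pose S1 : comNzRingType := HB.pack S (GRing.PzSemiRing_isNonZero.Build S S0).
by exists S1; rewrite {}/S1; case: S S0 => S [].
Qed.

Lemma nonzero_copy (S : comPzRingType) :
  (1 : S) != 0 -> exists (S1 : comNzRingType) (j : {rmorphism S -> S1})
    (j' : {rmorphism S1 -> S}), cancel j j' /\ cancel j' j.
Proof. by move=> /nonzero_ring[S1 <-]; exists S1, idfun, idfun. Qed.

(** The relation is read on the coefficients of the polynomials. For [S] the zero
    ring, over which there are no polynomials here, an identity matrix will do. *)
Lemma flat_poly (A : comNzRingType) : flat (polyC : {rmorphism A -> {poly A}}).
Proof.
move=> S th T u v po I b n rel.
have [S0|/eqP Sn0] := pselect ((1 : S) = 0).
  exists I, (fun i k => (i == k)%:R), n; split=> [i|k].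
    rewrite (bigD1 i) //= eqxx rmorph1 mul1r big1 ?addr0 // => k /negPf ki.
    by rewrite eq_sym ki rmorph0 mul0r.
  by rewrite -[LHS]mul1r S0 mul0r.
have [S1 [j [j' [jK _]]]] := nonzero_copy Sn0.
have [w [wu wv]] : exists w : {rmorphism T -> {poly S1}},
    w \o u =1 polyC \o j /\ w \o v =1 map_poly (j \o th : {rmorphism _ -> _}).
  apply: (pushout_lift po (u' := (polyC \o j : {rmorphism _ -> _}))
    (v' := (map_poly (j \o th : {rmorphism _ -> _}) : {rmorphism _ -> _}))) => a /=.
  by rewrite map_polyC.
have relP : \sum_i (j (b i))%:P * map_poly (j \o th : {rmorphism _ -> _}) (n i) = 0.
  transitivity (w (\sum_i u (b i) * v (n i))); last by rewrite rel rmorph0.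
  rewrite rmorph_sum; apply: eq_bigr => i _.
  by rewrite rmorphM -[w (u _)]/((w \o u) _) wu -[w (v _)]/((w \o v) _) wv.
pose d := (\max_i size (n i))%N.
exists 'I_d, (fun i (k : 'I_d) => (n i : {poly A})`_k), (fun k : 'I_d => 'X^k); split=> [i|k].
  rewrite -[LHS](@coefK _ (n i)) poly_def.
  rewrite (big_ord_widen d (fun k => (n i)`_k *: 'X^k)) /d; last exact: leq_bigmax.
  rewrite [RHS](bigID (fun k : 'I_d => (k < size (n i))%N)) /= [X in _ = _ + X]big1.
    by rewrite addr0; apply: eq_bigr => k _; rewrite mul_polyC.
  by move=> k; rewrite -leqNgt => /(nth_default 0) ->; rewrite rmorph0 mul0r.
apply: (can_inj jK); rewrite rmorph0.
have := congr1 (fun p : {poly S1} => p`_k) relP.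
rewrite coef_sum coef0 => <-; rewrite rmorph_sum; apply: eq_bigr => i _.
by rewrite coefCM coef_map rmorphM mulrC.
Qed.

(** * Noetherian rings and the Artin-Rees argument *)

(** The ascending chain condition is preferred to finite generation because it
    passes to polynomial rings and to free modules without choosing generators. *)
Definition noetherian (A : comPzRingType) : Prop :=
  forall I : nat -> ideal A, (forall n a, I n a -> I n.+1 a) ->
  exists n, forall m a, I m a -> I n a.

Lemma chain_le (T : Type) (W : nat -> T -> Prop) :
  (forall n a, W n a -> W n.+1 a) -> forall n m, (n <= m)%N -> forall a, W n a -> W m a.
Proof.
move=> WS n m /subnK <- a Wa; elim: (m - n)%N => [//|k IH].
by rewrite addSn; apply: WS.
Qed.

Lemma acc_maximal (T : Type) (le : T -> T -> Prop) :
  (forall F : nat -> T, (forall n, le (F n) (F n.+1)) -> exists n, forall m, le (F m) (F n)) ->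
  forall P : T -> Prop, (exists x, P x) ->
  exists x, P x /\ forall y, P y -> le x y -> le y x.
Proof.
move=> acc P [x0 Px0]; apply: contrapT => nmax.
have step (x : {x | P x}) : exists y : {y | P y}, le (sval x) (sval y) /\ ~ le (sval y) (sval x).
  case: x => x Px /=; apply: contrapT => ny; apply: nmax; exists x; split=> // y Py xy.
  by apply: contrapT => yx; apply: ny; exists (exist _ y Py).
have [f fP] := choice step.
pose F n := sval (iter n f (exist _ x0 Px0)).
have [n|n nF] := acc F; first by have [] := fP (iter n f (exist _ x0 Px0)).
by have [_] := fP (iter n f (exist _ x0 Px0)); apply; apply: (nF n.+1).
Qed.

Lemma noetherian_maximal (A : comPzRingType) (P : ideal A -> Prop) :
  noetherian A -> (exists I, P I) ->
  exists I, P I /\ forall J, P J -> (forall a, I a -> J a) -> forall a, J a -> I a.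
Proof.
by move=> nA; apply: (@acc_maximal _ (fun I J : ideal A => forall a, I a -> J a)).
Qed.

Section IdealPullback.
Variables (A B : comPzRingType) (f : {rmorphism A -> B}) (I : ideal B).
Let pb0 : I (f 0). Proof. by rewrite rmorph0; apply: ideal0. Qed.
Let pbD a b : I (f a) -> I (f b) -> I (f (a + b)).
Proof. by rewrite rmorphD; apply: idealD. Qed.
Let pbM a b : I (f b) -> I (f (a * b)).
Proof. by rewrite rmorphM; apply: idealM. Qed.
Definition ideal_pullback : ideal A := @Ideal A (fun a => I (f a)) pb0 pbD pbM.
End IdealPullback.

Lemma noetherian_quotient (A B : comPzRingType) (f : {rmorphism A -> B}) :
  (forall b, exists a, f a = b) -> noetherian A -> noetherian B.
Proof.
move=> fs nA I IS; have [|n nI] := nA (fun n => ideal_pullback f (I n)).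
  by move=> n a; apply: IS.
by exists n => m b; have [a <-] := fs b; apply: nI.
Qed.

Lemma noetherian_int : noetherian int.
Proof.
move=> I IS; have Ile := chain_le IS.
have [[n [a [Ia a0]]]|I0] := pselect (exists n a, I n a /\ a != 0); last first.
  exists 0%N => m a Ia; have -> : a = 0; last exact: ideal0.
  by apply/eqP; apply: contrapT => /negP a0; apply: I0; exists m, a.
pose P d := (0 < d)%N && `[< exists n, I n d%:Z >].
have exP : exists d, P d.
  exists `|a|%N; rewrite /P absz_gt0 a0; apply/asboolP; exists n.
  by rewrite abszEsg; apply: idealM.
case: (ex_minnP exP) => d /andP[d0 /asboolP[k Id]] mind; exists k => m b Ib.
have -> : b = (b %/ d)%Z * d; last exact: idealM.
rewrite {1}(divz_eq b d); apply/eqP; rewrite -subr_eq0 addrAC subrr add0r.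
have dz0 : (d%:Z != 0) by rewrite eqz_nat -lt0n.
apply: contrapT => /negP r0; have := mind `|(b %% d)%Z|%N.
rewrite /P absz_gt0 r0 /= leqNgt.
have -> : (`|(b %% d)%Z| < d)%N.
  by have := ltz_pmod b (d := d); rewrite ltz_nat d0 -{1}(gez0_abs (modz_ge0 b dz0)) ltz_nat; apply.
move=> /(_ _)/negP; apply; last by [].
apply/asboolP; exists (maxn k m); rewrite gez0_abs ?modz_ge0 //.
rewrite /modz; apply: idealB; first by apply: (Ile m); rewrite ?leq_maxr.
by apply/idealM/(Ile k); rewrite ?leq_maxl.
Qed.

(** Hilbert's basis theorem. The leading coefficients of the elements of degree
    at most [d] of the [n]-th ideal of a chain increase with both [n] and [d];
    they are controlled by the diagonal and by finitely many values of [d]. *)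
Section HilbertBasis.
Variables (A : comNzRingType) (I : ideal {poly A}) (d : nat).

Let lead_set a := exists p : {poly A}, [/\ I p, (size p <= d.+1)%N & p`_d = a].
Let lead0 : lead_set 0.
Proof. by exists 0; split; [exact: ideal0|rewrite size_poly0|rewrite coef0]. Qed.
Let leadD a b : lead_set a -> lead_set b -> lead_set (a + b).
Proof.
move=> [p [Ip sp <-]] [q [Iq sq <-]]; exists (p + q); split; first exact: idealD.
  by rewrite (leq_trans (size_polyD _ _)) // geq_max sp.
by rewrite coefD.
Qed.
Let leadM a b : lead_set b -> lead_set (a * b).
Proof.
move=> [p [Ip sp <-]]; exists (a%:P * p); split; first exact: idealM.
  by rewrite mul_polyC (leq_trans (size_scale_leq _ _)).
by rewrite coefCM.
Qed.
Definition lead_ideal : ideal A := Ideal lead0 leadD leadM.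

End HilbertBasis.

Lemma noetherian_poly (A : comNzRingType) : noetherian A -> noetherian {poly A}.
Proof.
move=> nA I IS; have Ile := chain_le IS.
have Ln n m d a : (n <= m)%N -> lead_ideal (I n) d a -> lead_ideal (I m) d a.
  by move=> nm [p [Ip sp <-]]; exists p; split=> //; apply: Ile Ip.
have Ld n d d' a : (d <= d')%N -> lead_ideal (I n) d a -> lead_ideal (I n) d' a.
  move=> /subnK <- La; elim: (d' - d)%N => [//|k [p [Ip sp <-]]].
  exists ('X * p); rewrite addSn; split; first exact: idealM.
    by rewrite mulrC (leq_trans (size_polyMleq _ _)) // size_polyX addn2.
  by rewrite coefXM.
(* [k0] is where the diagonal becomes stationary, and [N d] takes care of each
   degree [d] below [k0]. *)
have [|k0 k0P] := nA (fun k => lead_ideal (I k) k).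
  by move=> k a /(Ld _ _ _ _ (leqnSn k))/(Ln _ _ _ _ (leqnSn k)).
have /choice[N NP] : forall d, exists n, forall m a, lead_ideal (I m) d a -> lead_ideal (I n) d a.
  by move=> d; apply: nA => n a; apply: Ln.
pose n := maxn k0 (\max_(d < k0) N d).
have LnP m d a : lead_ideal (I m) d a -> lead_ideal (I n) d a.
  have [dk|kd] := ltnP d k0.
    move=> /NP; apply: Ln; rewrite leq_max; apply/orP; right.
    exact: (leq_bigmax (Ordinal dk)).
  move=> /(Ln _ _ _ _ (leq_maxl m d))/(Ld _ _ _ _ (leq_maxr m d))/k0P.
  by move=> /(Ld _ _ _ _ kd); apply: Ln; rewrite leq_maxl.
exists n => m p; have [s] := ubnP (size p); elim: s => // s IH in m p *.
rewrite ltnS => sp Ip; have [->|p0] := eqVneq p 0; first exact: ideal0.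
have [q [Iq sq qp]] : lead_ideal (I n) (size p).-1 p`_(size p).-1.
  apply: (LnP m); exists p; split=> //; by rewrite prednK // lt0n size_poly_eq0.
have -> : p = (p - q) + q by rewrite subrK.
apply: idealD => //; apply: (IH (maxn m n)).
  apply: leq_trans sp; rewrite -[size p]prednK ?lt0n ?size_poly_eq0 // ltnS.
  apply/leq_sizeP => j; rewrite leq_eqVlt coefB => /orP[/eqP<-|jp].
    by rewrite qp subrr.
  rewrite [p`_j]nth_default; last by rewrite -ltnS prednK ?lt0n ?size_poly_eq0 in jp *.
  rewrite nth_default ?subrr //; apply: leq_trans sq _.
  by [].
apply: idealB; first by apply: Ile Ip; rewrite leq_maxl.
by apply: Ile Iq; rewrite leq_maxr.
Qed.

Record submodule (A : comPzRingType) k := Submodule {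
  submodule_set :> 'rV[A]_k -> Prop;
  submodule0 : submodule_set 0;
  submoduleD : forall u v, submodule_set u -> submodule_set v -> submodule_set (u + v);
  submoduleZ : forall a v, submodule_set v -> submodule_set (a *: v) }.

Lemma submoduleB (A : comPzRingType) k (W : submodule A k) u v : W u -> W v -> W (u - v).
Proof.
move=> Wu Wv; apply: submoduleD => //.
by rewrite -scaleN1r; apply: submoduleZ.
Qed.

(** Induction on the rank: a chain is stationary as soon as the chain of its first
    coordinates and that of its elements with first coordinate zero are. *)
Lemma noetherian_free_module (A : comPzRingType) k : noetherian A ->
  forall W : nat -> submodule A k, (forall n v, W n v -> W n.+1 v) ->
  exists n, forall m v, W m v -> W n v.
Proof.
move=> nA; elim: k => [|k IH] W WS.
  by exists 0%N => m v _; rewrite (thinmx0 v); apply: submodule0.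
have Wle := chain_le WS; rewrite -[k.+1]/(1 + k)%N in W WS Wle *.
pose Vs n (r : 'rV[A]_k) := W n (row_mx (0 : 'rV_1) r).
have V0 n : Vs n 0 by rewrite /Vs row_mx0; apply: submodule0.
have VD n u v : Vs n u -> Vs n v -> Vs n (u + v).
  by rewrite /Vs -{3}[0]addr0 -add_row_mx; apply: submoduleD.
have VZ n a v : Vs n v -> Vs n (a *: v).
  by rewrite /Vs -{2}[0](scaler0 _ a) -scale_row_mx; apply: submoduleZ.
pose Is n (a : A) := exists r : 'rV[A]_k, W n (row_mx (a%:M : 'rV_1) r).
have I0 n : Is n 0 by exists 0; rewrite (raddf0 (@scalar_mx A 1)) row_mx0; apply: submodule0.
have ID n a b : Is n a -> Is n b -> Is n (a + b).
  move=> [r Wr] [s Ws]; exists (r + s); rewrite (raddfD (@scalar_mx A 1)) -add_row_mx.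
  exact: submoduleD.
have IM n a b : Is n b -> Is n (a * b).
  move=> [r Wr]; exists (a *: r); rewrite -scale_scalar_mx -scale_row_mx.
  exact: submoduleZ.
have [|n1 Vn] := IH (fun n => Submodule (V0 n) (@VD n) (@VZ n)).
  by move=> n v; apply: WS.
have [|n2 In] := nA (fun n => Ideal (I0 n) (@ID n) (@IM n)).
  by move=> n a [r Wr]; exists r; apply: WS.
exists (maxn n1 n2) => m v Wv.
have vE : v = row_mx ((lsubmx v 0 0)%:M : 'rV_1) (rsubmx v).
  by rewrite -mx11_scalar hsubmxK.
have [r Wr] : Is n2 (lsubmx v 0 0).
  by apply: (In m); exists (rsubmx v); rewrite -vE.
have Wd : Vs n1 (rsubmx v - r).
  apply: (Vn (maxn m n2)); rewrite /= /Vs -[0](subrr ((lsubmx v 0 0)%:M : 'rV_1)).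
  rewrite -add_row_mx -opp_row_mx -vE.
  apply: submoduleB; first by apply: Wle Wv; rewrite leq_maxl.
  by apply: Wle Wr; rewrite leq_maxr.
have -> : v = row_mx (0 : 'rV_1) (rsubmx v - r) + row_mx ((lsubmx v 0 0)%:M : 'rV_1) r.
  by rewrite add_row_mx add0r subrK.
apply: submoduleD; first by apply: Wle Wd; rewrite leq_maxl.
by apply: Wle Wr; rewrite leq_maxr.
Qed.

Fixpoint ideal_pow (A : comPzRingType) (I : ideal A) n : ideal A :=
  if n is m.+1 then ideal_span (fun z => exists a b, [/\ I a, ideal_pow I m b & z = a * b])
  else ideal_span (fun=> True).

Lemma ideal_powS (A : comPzRingType) (I : ideal A) n a b :
  I a -> ideal_pow I n b -> ideal_pow I n.+1 (a * b).
Proof. by move=> Ia Ib; apply: span_gen; exists a, b. Qed.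

Lemma ideal_pow_split (A : comPzRingType) (I I1 I2 : ideal A) :
  (forall a, I a -> exists b c, [/\ I1 b, I2 c & a = b + c]) ->
  forall p q a, ideal_pow I (p + q) a ->
  exists b c, [/\ ideal_pow I1 p b, ideal_pow I2 q c & a = b + c].
Proof.
move=> I12 p q a; have [n] := ubnP (p + q)%N; elim: n => // n IH in p q a *.
case: p => [|p].
  move=> _ _; exists a, 0; split; [exact: span_gen|exact: ideal0|by rewrite addr0].
case: q => [|q].
  move=> _ _; exists 0, a; split; [exact: ideal0|exact: span_gen|by rewrite add0r].
rewrite addSn ltnS => pq; elim=> [|_ [i [t [/I12[i1 [i2 [Ii1 Ii2 ->]]] It ->]]]||].
- by exists 0, 0; split; [exact: ideal0|exact: ideal0|rewrite addr0].
- have [b [c [Ib Ic e]]] := IH p q.+1 t pq It.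
  have [||b' [c' [Ib' Ic' e']]] := IH p.+1 q t; [by rewrite addSnnS|by rewrite addSnnS|].
  exists (i1 * b + i2 * b'), (i1 * c + i2 * c'); split.
  + by apply: idealD; [apply: ideal_powS|apply: idealM].
  + by apply: idealD; [apply: idealM|apply: ideal_powS].
  + by rewrite mulrDl {1}e e'; ring.
- move=> b c _ [b1 [c1 [? ? ->]]] _ [b2 [c2 [? ? ->]]].
  exists (b1 + b2), (c1 + c2); split; [exact: idealD|exact: idealD|ring].
- move=> b c _ [b1 [c1 [? ? ->]]].
  exists (b * b1), (b * c1); split; [exact: idealM|exact: idealM|ring].
Qed.

(** Adding one generator at a time reduces this to [ideal_pow_split]. *)
Lemma ideal_pow_in (A : comPzRingType) (N : ideal A) (s : seq A) :
  (forall g, g \in s -> exists n, N (g ^+ n)) ->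
  exists n, forall a, ideal_pow (ideal_span (fun z => z \in s)) n a -> N a.
Proof.
elim: s => [|g s IH] h.
  exists 1%N; apply: span_min => _ [a [b [Ia _ ->]]].
  suff -> : a = 0 by rewrite mul0r; apply: ideal0.
  elim: Ia => [//|//|c d _ -> _ ->|c d _ ->]; first by rewrite addr0.
  by rewrite mulr0.
have [|n2 N2] := IH; first by move=> z zs; apply: h; rewrite inE zs orbT.
have [n1 N1] := h g (mem_head _ _); exists (n1 + n2)%N => a.
move=> /(@ideal_pow_split _ _ (ideal_span (fun z => z = g)) (ideal_span (fun z => z \in s)))[].
  move=> z0; elim=> [|z|c d _ [b1 [c1 [? ? ->]]] _ [b2 [c2 [? ? ->]]]|c d _ [b1 [c1 [? ? ->]]]].
  - by exists 0, 0; split; [exact: ideal0|exact: ideal0|rewrite addr0].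
  - rewrite inE => /orP[/eqP->|zs].
      by exists g, 0; split; [exact: span_gen|exact: ideal0|rewrite addr0].
    by exists 0, z; split; [exact: ideal0|exact: span_gen|rewrite add0r].
  - exists (b1 + b2), (c1 + c2); split; [exact: idealD|exact: idealD|ring].
  - exists (c * b1), (c * c1); split; [exact: idealM|exact: idealM|ring].
move=> b [c [Ib /N2 Nc ->]]; apply: idealD => //.
have [d ->] : exists d, b = d * g ^+ n1; last exact: idealM.
move: Ib; elim: (n1) b => [|n IHn] b; first by exists b; rewrite mulr1.
elim=> [|_ [i [t [Ii /IHn[d ->] ->]]]|x y _ [d ->] _ [d' ->]|x y _ [d ->]].
- by exists 0; rewrite mul0r.
- have [d' ->] : exists d', i = d' * g.
    elim: Ii => [|_ ->|x y _ [d1 ->] _ [d2 ->]|x y _ [d1 ->]].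
    + by exists 0; rewrite mul0r.
    + by exists 1; rewrite mul1r.
    + by exists (d1 + d2); rewrite mulrDl.
    + by exists (x * d1); rewrite mulrA.
  by exists (d' * d); rewrite exprS; ring.
- by exists (d + d'); rewrite mulrDl.
- by exists (x * d); rewrite mulrA.
Qed.

(** A weak form of the Artin-Rees lemma. Take [W] maximal among the submodules
    containing [L] with [W] meeting [J] inside [L]. If [g] is in [s] and
    [g ^+ n.+1 *: r] in [W] implies [g ^+ n *: r] in [W], then [W] enlarged by
    the multiples of [g ^+ n] still meets [J] inside [L], because [g] sends [J]
    into [L]; so it is [W], and a power of [g] sends everything into [W]. *)
Lemma artin_rees (A : comPzRingType) k (s : seq A) (J L : submodule A k) :
  noetherian A -> (forall r, L r -> J r) ->
  (forall g r, g \in s -> J r -> L (g *: r)) ->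
  exists n, forall r, J r ->
    (forall i, ideal_pow (ideal_span (fun z => z \in s)) n (r 0 i)) -> L r.
Proof.
move=> nA LJ sJL.
pose Q (W : submodule A k) := (forall r, L r -> W r) /\ (forall r, W r -> J r -> L r).
have [|W [[LW WJ] maxW]] := @acc_maximal (submodule A k) (fun V W => forall r, V r -> W r)
  (fun F h => noetherian_free_module nA h) Q; first by exists L; split.
have killW g : g \in s -> exists n, forall r, W (g ^+ n *: r).
  move=> gs; pose Cs n (r : 'rV[A]_k) := W (g ^+ n *: r).
  have C0 n : Cs n 0 by rewrite /Cs scaler0; apply: submodule0.
  have CD n u v : Cs n u -> Cs n v -> Cs n (u + v).
    by rewrite /Cs scalerDr; apply: submoduleD.
  have CZ n a v : Cs n v -> Cs n (a *: v).
    by rewrite /Cs scalerA mulrC -scalerA; apply: submoduleZ.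
  have [|n nC] := noetherian_free_module nA (W := fun n => Submodule (C0 n) (@CD n) (@CZ n)).
    by move=> n v /=; rewrite /Cs exprS -scalerA; apply: submoduleZ.
  (* [Es] is [W] enlarged by the multiples of [g ^+ n]. *)
  exists n; pose Es r := exists w t, W w /\ r = w + g ^+ n *: t.
  have E0 : Es 0 by exists 0, 0; rewrite scaler0 addr0; split=> //; apply: submodule0.
  have ED u v : Es u -> Es v -> Es (u + v).
    move=> [w [t [Ww ->]]] [w' [t' [Ww' ->]]]; exists (w + w'), (t + t').
    by split; [exact: submoduleD|rewrite scalerDr addrACA].
  have EZ a v : Es v -> Es (a *: v).
    move=> [w [t [Ww ->]]]; exists (a *: w), (a *: t); split; first exact: submoduleZ.
    by rewrite scalerDr !scalerA mulrC.
  have WE r : W r -> Es r by move=> Wr; exists r, 0; rewrite scaler0 addr0.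
  have EW : forall r, Es r -> W r.
    apply: (maxW (Submodule E0 ED EZ)) => //; split=> [r /LW/WE //|r [w [t [Ww ->]]] Jr].
    apply: WJ => //; apply: submoduleD => //; apply: (nC n.+1); rewrite /= /Cs exprS -scalerA.
    have -> : g *: (g ^+ n *: t) = g *: (w + g ^+ n *: t) - g *: w.
      by rewrite scalerDr addrAC subrr add0r.
    by apply: submoduleB; [apply/LW/sJL|apply: submoduleZ].
  by move=> r; apply: EW; exists 0, r; rewrite add0r; split=> //; apply: submodule0.
pose Ns (a : A) := forall r, W (a *: r).
have N0 : Ns 0 by move=> r; rewrite scale0r; apply: submodule0.
have ND a b : Ns a -> Ns b -> Ns (a + b).
  by move=> Na Nb r; rewrite scalerDl; apply: submoduleD.
have NM a b : Ns b -> Ns (a * b) by move=> Nb r; rewrite -scalerA; apply: submoduleZ.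
have [n nN] := @ideal_pow_in _ (Ideal N0 ND NM) s killW.
exists n => r Jr rn; apply: WJ => //; rewrite (row_sum_delta r).
apply: (big_ind (W : _ -> Prop)) => [|u v|i _]; [exact: submodule0|exact: submoduleD|].
exact: (nN _ (rn i)).
Qed.

(** * Flatness from infinitesimal lifting *)

Lemma ideal_powW (A : comPzRingType) (I : ideal A) n a :
  ideal_pow I n.+1 a -> ideal_pow I n a.
Proof. by apply: span_min => _ [b [c [_ Ic ->]]]; apply: idealM. Qed.

Lemma ideal_pow1 (A : comPzRingType) (I : ideal A) a : I a -> ideal_pow I 1 a.
Proof. by move=> Ia; rewrite -[a]mulr1; apply: ideal_powS => //; apply: span_gen. Qed.

Lemma ideal_pow1W (A : comPzRingType) (I : ideal A) a : ideal_pow I 1 a -> I a.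
Proof. by apply: span_min => _ [b [c [Ib _ ->]]]; rewrite mulrC; apply: idealM. Qed.

Section FlatLift.
Variables (A P : comPzRingType) (pc : {rmorphism A -> P}) (gs : seq P).
Variable s : {rmorphism P -> P}.
Let I := ideal_span (fun z => z \in gs).
Hypothesis nP : noetherian P.
Hypothesis flpc : flat pc.
Hypothesis s_pc : s \o pc =1 pc.
Hypothesis s_id : forall p, I (s p - p).
Hypothesis s_gs : forall g, g \in gs -> ideal_pow I 2 (s g).

Let s_I a : I a -> I (s a).
Proof. by move=> Ia; rewrite -[s a](subrK a); apply: idealD. Qed.

Let s_pow n a : ideal_pow I n.+1 a -> ideal_pow I n.+2 (s a).
Proof.
elim: n a => [|n IH] a.
  move=> /ideal_pow1W; elim=> [|g /s_gs//|b c _ Ib _ Ic|b c _ Ic].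
  - by rewrite rmorph0; apply: ideal0.
  - by rewrite rmorphD; apply: idealD.
  - by rewrite rmorphM; apply: idealM.
elim=> [|_ [b [c [Ib /IH Ic ->]]]|b c _ Ib _ Ic|b c _ Ic].
- by rewrite rmorph0; apply: ideal0.
- by rewrite rmorphM; apply: ideal_powS => //; apply: s_I.
- by rewrite rmorphD; apply: idealD.
- by rewrite rmorphM; apply: idealM.
Qed.

Let iter_pow n a : I a -> ideal_pow I n.+1 (iter n s a).
Proof. by move=> Ia; elim: n => [|n IH]; [apply: ideal_pow1|apply: s_pow]. Qed.

Let iter_id n p : I (iter n s p - p).
Proof.
elim: n => [|n IH]; first by rewrite subrr; apply: ideal0.
by rewrite iterS -[s _](subrK (iter n s p)) -addrA; apply: idealD.
Qed.

(** Iterating [s] pushes [I] into higher and higher powers of itself without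
    changing classes modulo [I]. So if [\sum_i b_i p_i] vanishes modulo [I],
    some representatives of the same classes have [\sum_i b_i p_i] in a high
    power of [I], which by Artin-Rees is [\sum_i b_i z_i] with [z_i] in [I]; the
    representatives [p_i - z_i] satisfy the relation already over [P]. *)
Lemma flat_lift : flat (quot_pi I \o pc : {rmorphism A -> quot I}).
Proof.
move=> S th T u v po X b n rel.
have [SP [uP [vP poP]]] := pushout_exists th pc.
pose IS := ideal_span (fun z => exists2 g, g \in gs & z = vP g).
have vPI a : I a -> IS (vP a).
  elim=> [|g ggs|c d _ Ic _ Id|c d _ Id].
  - by rewrite rmorph0; apply: ideal0.
  - by apply: span_gen; exists g.
  - by rewrite rmorphD; apply: idealD.
  - by rewrite rmorphM; apply: idealM.
have [|v' v'E] := @quot_factorP P (quot IS) I (quot_pi IS \o vP : {rmorphism _ -> _}).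
  by move=> a /vPI /quot_pi0.
have [a|w [wu wv]] := pushout_lift po (u' := (quot_pi IS \o uP : {rmorphism _ -> _})) (v' := v').
  by rewrite /= v'E /= (pushout_glue poP).
have /choice[p pE] : forall i, exists p, n i = quot_pi I p by move=> i; apply: quot_piP.
have : IS (\sum_i uP (b i) * vP (p i)).
  apply/quot_pi0; rewrite -[RHS](rmorph0 w) -rel !rmorph_sum.
  apply: eq_bigr => i _; rewrite !rmorphM -[w (u _)]/((w \o u) _) wu.
  by rewrite -[w (v _)]/((w \o v) _) wv pE v'E.
have ISP t : IS t -> exists (Y : finType) (m : Y -> S) (q : Y -> P),
    (forall y, I (q y)) /\ t = \sum_y uP (m y) * vP (q y).
  elim=> [|_ [g ggs ->]|c d _ [Y [m [q [Iq ->]]]] _ [Y' [m' [q' [Iq' ->]]]]|].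
  - by exists void, (of_void _), (of_void _); split=> [[]|]; rewrite big1 // => -[].
  - exists unit, (fun=> 1), (fun=> g); split=> [_|]; first exact: span_gen.
    by rewrite (big_pred1 tt) => [|[]//]; rewrite rmorph1 mul1r.
  - exists (Y + Y')%type, (fun x => match x with inl y => m y | inr y => m' y end).
    exists (fun x => match x with inl y => q y | inr y => q' y end).
    by split=> [[]//|]; rewrite big_sumType.
  - move=> c d _ [Y [m [q [Iq ->]]]]; have [Y' [m' [q' ->]]] := pushout_sum poP c.
    exists (Y' * Y)%type, (fun x => m' x.1 * m x.2), (fun x => q' x.1 * q x.2).
    split=> [x|]; first exact: idealM.
    rewrite big_distrlr pair_big; apply: eq_bigr => -[i j] _ /=.
    by rewrite !rmorphM; ring.
move=> /ISP[Y [m [q [Iq relP]]]].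
have [a|sS [sSu sSv]] := pushout_lift poP (u' := uP) (v' := (vP \o s : {rmorphism _ -> _})).
  by rewrite /= -[s _]/((s \o pc) a) s_pc (pushout_glue poP).
have relPs k : \sum_i uP (b i) * vP (iter k s (p i)) =
               \sum_y uP (m y) * vP (iter k s (q y)).
  elim: k => [//|k /(congr1 sS)]; rewrite !rmorph_sum.
  have sE x y : sS (uP x * vP y) = uP x * vP (s y).
    by rewrite rmorphM -[sS (uP _)]/((sS \o uP) _) sSu -[sS (vP _)]/((sS \o vP) _) sSv.
  by under eq_bigr do rewrite sE; under [RHS]eq_bigr do rewrite sE.
(* Both sides are values at vectors of one free module over [P], to which the
   Artin-Rees lemma applies: [JT Q] is made of the vectors whose value is a
   combination of the [b i] with coefficients in [Q]. *)
pose m' (z : X + Y) := match z with inl i => b i | inr y => m y end.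
pose val (r : 'rV[P]_#|{: X + Y}|) := \sum_z uP (m' z) * vP (r 0 (enum_rank z)).
have val0 : val 0 = 0 by rewrite /val big1 // => z _; rewrite mxE rmorph0 mulr0.
have valD r r' : val (r + r') = val r + val r'.
  by rewrite -big_split; apply: eq_bigr => z _; rewrite mxE rmorphD mulrDr.
have valZ a r : val (a *: r) = vP a * val r.
  by rewrite mulr_sumr; apply: eq_bigr => z _; rewrite mxE rmorphM; ring.
pose Js (Q : P -> Prop) r := exists z : X -> P, (forall i, Q (z i)) /\
  val r = \sum_i uP (b i) * vP (z i).
have J0 (Q : ideal P) : Js Q 0.
  exists (fun=> 0); split=> [_|]; first exact: ideal0.
  by rewrite val0 big1 // => i _; rewrite rmorph0 mulr0.
have JD (Q : ideal P) r r' : Js Q r -> Js Q r' -> Js Q (r + r').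
  move=> [z [Qz zE]] [z' [Qz' z'E]]; exists (fun i => z i + z' i).
  split=> [i|]; first exact: idealD.
  by rewrite valD zE z'E -big_split; apply: eq_bigr => i _; rewrite rmorphD mulrDr.
have JZ (Q : ideal P) a r : Js Q r -> Js Q (a *: r).
  move=> [z [Qz zE]]; exists (fun i => a * z i); split=> [i|]; first exact: idealM.
  by rewrite valZ zE mulr_sumr; apply: eq_bigr => i _; rewrite rmorphM; ring.
pose JT (Q : ideal P) := Submodule (J0 Q) (@JD Q) (@JZ Q).
pose IT := ideal_span (fun _ : P => True).
have [r [z [_ zE]]|g r ggs [z [_ zE]]|N NP] := @artin_rees P _ gs (JT IT) (JT I) nP.
- by exists z; split=> // i; apply: span_gen.
- exists (fun i => g * z i); split=> [i|]; first by apply/ideal_mulr/span_gen.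
  by rewrite valZ zE mulr_sumr; apply: eq_bigr => i _; rewrite rmorphM; ring.
pose r : 'rV[P]_#|{: X + Y}| :=
  \row_k match enum_val k with inl _ => 0 | inr y => iter N s (q y) end.
have valr : val r = \sum_i uP (b i) * vP (iter N s (p i)).
  rewrite relPs /val big_sumType /= big1 ?add0r => [|i _]; last first.
    by rewrite mxE enum_rankK rmorph0 mulr0.
  by apply: eq_bigr => y _; rewrite mxE enum_rankK.
have [||z [Iz zE]] := NP r.
- by exists (fun i => iter N s (p i)); split=> // i; apply: span_gen.
- move=> k; rewrite mxE; case: (enum_val k) => [_|y]; first exact: ideal0.
  exact/ideal_powW/iter_pow.
have rel0 : \sum_i uP (b i) * vP (iter N s (p i) - z i) = 0.
  rewrite -[RHS](subrr (val r)) {1}valr zE -sumrB.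
  by apply: eq_bigr => i _; rewrite rmorphB mulrBr.
have [K [rho [l [lE rhoE]]]] := flpc poP rel0.
exists K, rho, (fun k => quot_pi I (l k)); split=> // i.
have -> : n i = quot_pi I (iter N s (p i) - z i).
  rewrite pE; apply/esym/quot_pi_eq; rewrite addrAC.
  by apply: idealB; [apply: iter_id|apply: Iz].
by rewrite lE rmorph_sum; apply: eq_bigr => k _; rewrite rmorphM.
Qed.

End FlatLift.

(** * Polynomial rings in several variables *)

Fixpoint polyn (A : comNzRingType) n : comNzRingType :=
  if n is m.+1 then ({poly (polyn A m)} : comNzRingType) else A.

Fixpoint polynC (A : comNzRingType) n : {rmorphism A -> polyn A n} :=
  match n with
  | 0 => idfun : {rmorphism A -> A}
  | m.+1 => (polyC \o polynC A m : {rmorphism A -> {poly (polyn A m)}})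
  end.

Fixpoint polynX (A : comNzRingType) n : 'I_n -> polyn A n :=
  match n return 'I_n -> polyn A n with
  | 0 => fun=> 0
  | m.+1 => fun i => if unlift ord_max i is Some j then (polynX A j)%:P else 'X
  end.

(** These lists say which polynomials come from a subring of [A]. *)
Fixpoint polyn_coefs (A : comNzRingType) n : polyn A n -> seq A :=
  match n return polyn A n -> seq A with
  | 0 => fun a => [:: a]
  | m.+1 => fun p : {poly (polyn A m)} => flatten [seq polyn_coefs x | x <- p]
  end.

Lemma polyn_ind (A : comNzRingType) n (Q : polyn A n -> Prop) :
  (forall a, Q (polynC A n a)) -> (forall i, Q (polynX A i)) ->
  (forall s t, Q s -> Q t -> Q (s + t)) -> (forall s t, Q s -> Q t -> Q (s * t)) ->
  forall p, Q p.
Proof.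
elim: n Q => [|n IH] Q QC QX QD QM; first exact: QC.
have QX' : Q 'X by have := QX ord_max; rewrite /= unlift_none.
have QP : forall a, Q a%:P.
  apply: (IH (fun a : polyn A n => Q a%:P)) => [a|i|s t|s t].
  - exact: QC.
  - by have := QX (lift ord_max i); rewrite /= liftK.
  - by rewrite rmorphD; apply: QD.
  - by rewrite rmorphM; apply: QM.
by elim/poly_ind => [|p c Qp]; [apply: (QP 0)|apply: QD => //; apply: QM].
Qed.

Lemma polyn_uniq (A : comNzRingType) n (S : comPzRingType) (k k' : {rmorphism polyn A n -> S}) :
  (forall a, k (polynC A n a) = k' (polynC A n a)) ->
  (forall i, k (polynX A i) = k' (polynX A i)) -> k =1 k'.
Proof.
move=> kC kX; apply: polyn_ind => // s t ks kt.
  by rewrite !rmorphD ks kt.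
by rewrite !rmorphM ks kt.
Qed.

Lemma zero_ring_morphism (A S : comPzRingType) :
  (1 : S) = 0 -> exists k : {rmorphism A -> S}, True.
Proof.
move=> S0; have all0 (s : S) : s = 0 by rewrite -[s]mulr1 S0 mulr0.
pose z (_ : A) : S := 0.
have zB : zmod_morphism z by move=> a b; apply/esym/all0.
have zM : monoid_morphism z by split=> [|a b]; apply/esym/all0.
pose zA := GRing.isZmodMorphism.Build A S z zB.
pose zM' := GRing.isMonoidMorphism.Build A S z zM.
by exists (HB.pack z zA zM' : {rmorphism A -> S}).
Qed.

Lemma polyn_ext (A : comNzRingType) n (S : comPzRingType) (th : {rmorphism A -> S})
    (c : 'I_n -> S) :
  exists k : {rmorphism polyn A n -> S},
    (forall a, k (polynC A n a) = th a) /\ forall i, k (polynX A i) = c i.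
Proof.
have [S0|/eqP S1] := pselect ((1 : S) = 0).
  have all0 (s : S) : s = 0 by rewrite -[s]mulr1 S0 mulr0.
  have [k _] := zero_ring_morphism (polyn A n) S0.
  by exists k; split=> z; apply: etrans (all0 _) (esym (all0 _)).
elim: n c => [|n IH] c; first by exists th; split=> // -[].
have [k [kC kX]] := IH (fun i => c (lift ord_max i)).
have [S' [j [j' [jK j'K]]]] := nonzero_copy S1.
have cc : commr_rmorph (j \o k : {rmorphism _ -> _}) (j (c ord_max)).
  by move=> x; apply: mulrC.
exists (j' \o horner_morph cc : {rmorphism {poly (polyn A n)} -> S}).
split=> [a|i] /=; first by rewrite horner_morphC /= jK kC.
case: unliftP => [i' ->|->]; first by rewrite horner_morphC /= jK kX.
by rewrite horner_morphX jK.
Qed.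

Lemma noetherian_polyn (A : comNzRingType) n : noetherian A -> noetherian (polyn A n).
Proof. by move=> nA; elim: n => //= n IH; apply: noetherian_poly. Qed.

Lemma flat_id (A : comPzRingType) : flat (idfun : {rmorphism A -> A}).
Proof.
move=> S th T u v po I b n rel; exists unit, (fun i _ => n i), (fun=> 1).
split=> [i|_]; first by rewrite (big_pred1 tt) => [|[]//]; rewrite mulr1.
have [w [wu _]] := pushout_lift po (u' := (idfun : {rmorphism S -> S})) (v' := th) (fun=> erefl).
transitivity (w (\sum_i u (b i) * v (n i))); last by rewrite rel rmorph0.
rewrite rmorph_sum; apply: eq_bigr => i _ /=.
rewrite -[n i in RHS]/(idfun (n i)) -(pushout_glue po) -rmorphM.
by rewrite -[w _]/((w \o u) _) wu mulrC.
Qed.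

Lemma flat_polyn (A : comNzRingType) n : flat (polynC A n).
Proof.
elim: n => [|n IH]; first exact: flat_id.
exact: (flat_comp IH (@flat_poly (polyn A n))).
Qed.

Lemma polyn_coefs0 (A : comNzRingType) n a : a \in polyn_coefs (0 : polyn A n) -> a = 0.
Proof.
case: n => [|n] /=; first by rewrite inE => /eqP.
by rewrite polyseq0.
Qed.

Lemma polyn_map (A A' : comNzRingType) (f : {rmorphism A' -> A}) n :
  exists m : {rmorphism polyn A' n -> polyn A n},
    [/\ forall a, m (polynC A' n a) = polynC A n (f a),
        forall i, m (polynX A' i) = polynX A i,
        injective f -> injective m &
        forall p, (forall a, a \in polyn_coefs p -> exists a', f a' = a) ->
          exists q, m q = p].
Proof.
elim: n => [|n [m [mC mX mI mL]]].
  by exists f; split=> // [[]//|p h]; apply: h; rewrite inE.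
exists (map_poly m : {rmorphism {poly (polyn A' n)} -> {poly (polyn A n)}}); split.
- by move=> a /=; rewrite map_polyC /= mC.
- move=> i /=; case: unlift => [j|]; first by rewrite map_polyC /= mX.
  by rewrite map_polyX.
- by move=> /mI mi; exact: (map_inj_poly mi (rmorph0 m)).
- move=> p pL; have /choice[q qP] : forall i, exists x, m x = (p : {poly polyn A n})`_i.
    move=> i; apply: mL => a ai; have [si|si] := ltnP i (size (p : {poly polyn A n})).
      by apply: pL; apply/flattenP; exists (polyn_coefs (p : {poly polyn A n})`_i) => //; apply/map_f/mem_nth.
    move: ai; rewrite (nth_default _ si) => ai; exists 0; rewrite rmorph0.
    by rewrite (polyn_coefs0 ai).
  exists (\poly_(i < size (p : {poly polyn A n})) q i : {poly (polyn A' n)}).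
  rewrite -[RHS]coefK; apply/polyP => i; rewrite coef_map !coef_poly.
  by case: ifP => _; [apply: qP|apply: rmorph0].
Qed.

(** The subring generated by [cs] is a quotient of a polynomial ring over the
    integers. *)
Lemma fg_subring (A : comNzRingType) (cs : seq A) :
  exists (A0 : comNzRingType) (f : {rmorphism A0 -> A}),
    [/\ noetherian A0, injective f & forall a, a \in cs -> exists a0, f a0 = a].
Proof.
have [phi [_ phiX]] := @polyn_ext int (size cs) A (intr : {rmorphism int -> A})
  (fun i => nth 0 cs i).
have ker0 : phi 0 = 0 by rewrite rmorph0.
have kerD a b : phi a = 0 -> phi b = 0 -> phi (a + b) = 0.
  by rewrite rmorphD => -> ->; rewrite addr0.
have kerM a b : phi b = 0 -> phi (a * b) = 0 by rewrite rmorphM => ->; rewrite mulr0.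
pose I := @Ideal _ (fun a => phi a = 0) ker0 kerD kerM.
have [f fE] := @quot_factorP _ _ I phi (fun a h => h).
have f_inj : injective f.
  move=> u v; have [a ->] := quot_piP u; have [b ->] := quot_piP v.
  rewrite !fE => ab; apply/quot_pi_eq => /=.
  by rewrite rmorphB ab subrr.
have Q1 : (1 : quot I) != 0.
  by apply/eqP => /(congr1 f); rewrite rmorph1 rmorph0; apply/eqP/oner_neq0.
have [A0 [j [j' [jK j'K]]]] := nonzero_copy Q1.
exists A0, (f \o j' : {rmorphism _ -> _}); split.
- apply: (noetherian_quotient (f := j)) => [b|]; first by exists (j' b).
  apply: (noetherian_quotient (f := quot_pi I)) => [b|].
    by have [a ->] := quot_piP b; exists a.
  exact/noetherian_polyn/noetherian_int.
- by apply: inj_comp; [exact: f_inj|exact: can_inj j'K].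
- move=> a /(nthP 0)[i si <-]; exists (j (quot_pi I (polynX _ (Ordinal si)))).
  by rewrite /= jK fE phiX.
Qed.

(** * Etale algebras and their noetherian models *)

(** [diag Y1 Y2] is the image of a separability idempotent [sum x_i (x) y_i] of
    [B (x) B] under the map to [T] given by [Y1] and [Y2]. In geometric terms it
    is the function on pairs of points equal to 1 where they coincide and to 0
    elsewhere. *)
Definition diag (B T : comPzRingType) (I : finType) (x y : I -> B) (Y1 Y2 : B -> T) : T :=
  \sum_i Y1 (x i) * Y2 (y i).

Definition separability (A B : comPzRingType) (e : {rmorphism A -> B})
    (I : finType) (x y : I -> B) : Prop :=
  \sum_i x i * y i = 1 /\
  forall (T : comPzRingType) (Y1 Y2 : {rmorphism B -> T}),
    Y1 \o e =1 Y2 \o e -> forall b, (Y1 b - Y2 b) * diag x y Y1 Y2 = 0.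

Definition finite_type (A B : comPzRingType) (e : {rmorphism A -> B}) : Prop :=
  exists (I : finType) (g : I -> B), forall Q : B -> Prop,
    (forall a, Q (e a)) -> (forall i, Q (g i)) ->
    (forall s t, Q s -> Q t -> Q (s + t)) -> (forall s t, Q s -> Q t -> Q (s * t)) ->
    forall b, Q b.

Section Presentation.
Variables (A : comNzRingType) (B : comPzRingType) (e : {rmorphism A -> B}).
Variables (n m : nat) (b : 'I_n -> B) (rels : 'I_m -> polyterm A n).
Hypothesis rels0 : forall i, peval e b (rels i) = 0.
Hypothesis univ : forall (C : comPzRingType) (g : {rmorphism A -> C}) (c : 'I_n -> C),
  (forall i, peval g c (rels i) = 0) ->
  (exists k : {rmorphism B -> C}, k \o e =1 g /\ k \o b =1 c) /\
  (forall k k' : {rmorphism B -> C},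
     k \o e =1 g -> k \o b =1 c -> k' \o e =1 g -> k' \o b =1 c -> k =1 k').

Let P := polyn A n.
Let pc : {rmorphism A -> P} := polynC A n.
Let pX : 'I_n -> P := @polynX A n.
Let G (j : 'I_m) : P := peval pc pX (rels j).
Let I := ideal_span (fun z => exists j, z = G j).

Lemma peval_morph (C : comPzRingType) (g : {rmorphism A -> C}) (c : 'I_n -> C)
    (k : {rmorphism P -> C}) t :
  (forall a, k (pc a) = g a) -> (forall i, k (pX i) = c i) ->
  k (peval pc pX t) = peval g c t.
Proof.
move=> kC kX; elim: t => [a|i|s IHs t IHt|s IHs t IHt] /=; rewrite ?kC ?kX //.
  by rewrite rmorphD IHs IHt.
by rewrite rmorphM IHs IHt.
Qed.

Lemma presentation_ext (C : comPzRingType) (k k' : {rmorphism B -> C}) :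
  (forall a, k (e a) = k' (e a)) -> (forall i, k (b i) = k' (b i)) -> k =1 k'.
Proof.
move=> kC kb; have [|_ uniq] := univ (C := C) (g := (k \o e : {rmorphism _ -> _})) (c := k \o b).
  move=> i; have [p [pC pb]] := polyn_ext e b.
  rewrite -(peval_morph (k := (k \o p : {rmorphism P -> C}))) => [|a|l] /=.
  - by rewrite (peval_morph _ pC pb) rels0 rmorph0.
  - by rewrite pC.
  - by rewrite pb.
by apply: uniq => // z /=; rewrite ?kC ?kb.
Qed.

(** The last two clauses make [B] the quotient of [P] by [I]. *)
Lemma presentation_quotient : exists p : {rmorphism P -> B},
  [/\ forall a, p (pc a) = e a, forall i, p (pX i) = b i,
      forall z, exists q, p q = z, forall j, p (G j) = 0 &
      forall (T : comPzRingType) (k : {rmorphism P -> T}), (forall j, k (G j) = 0) ->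
        exists Y : {rmorphism B -> T}, forall q, Y (p q) = k q].
Proof.
have [p [pC pb]] := polyn_ext e b.
have pG j : p (G j) = 0 by rewrite (peval_morph _ pC pb).
have lift (T : comPzRingType) (k : {rmorphism P -> T}) : (forall j, k (G j) = 0) ->
    exists Y : {rmorphism B -> T}, forall q, Y (p q) = k q.
  move=> kG; have [|[Y [YC Yb]] _] := univ (C := T) (g := (k \o pc : {rmorphism _ -> _})) (c := k \o pX).
    by move=> i; rewrite -(peval_morph (k := k)) //; apply: kG.
  exists Y; apply: (polyn_uniq (k := (Y \o p : {rmorphism P -> T}))) => z /=.
    by rewrite pC; apply: YC.
  by rewrite pb; apply: Yb.
exists p; split=> // z.
have [|Y YE] := lift _ (quot_pi I).
  by move=> j; apply/quot_pi0/span_gen; exists j.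
have [|p' p'E] := @quot_factorP _ _ I p.
  move=> a; elim=> [|_ [j ->]|x y _ px _ py|x y _ py]; first exact: rmorph0.
  - exact: pG.
  - by rewrite rmorphD px py addr0.
  - by rewrite rmorphM py mulr0.
have p'Y : p' \o Y =1 idfun.
  apply: (presentation_ext (k := (p' \o Y : {rmorphism _ -> _})) (k' := idfun)) => i /=.
    by rewrite -pC YE p'E.
  by rewrite -pb YE p'E.
have [q qE] := quot_piP (Y z); exists q.
by rewrite -p'E -qE; apply: p'Y.
Qed.

End Presentation.

Lemma quot_pi_surj (A : comPzRingType) (I : ideal A) (u : quot I) : exists a, quot_pi I a = u.
Proof. by have [a ->] := quot_piP u; exists a. Qed.

Definition ideal_sq (A : comPzRingType) (J : finType) (G : J -> A) : ideal A :=
  ideal_span (fun z => exists jj : J * J, z = G jj.1 * G jj.2).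

Arguments ideal_sq : simpl never.

Lemma ideal_sqM (A : comPzRingType) (J : finType) (G : J -> A) a b :
  ideal_span (fun z => exists j, z = G j) a -> ideal_span (fun z => exists j, z = G j) b ->
  ideal_sq G (a * b).
Proof.
move=> /span_fin[c ->] /span_fin[d ->]; rewrite big_distrlr.
apply: ideal_sum => i _; apply: ideal_sum => j _ /=.
have -> : c i * G i * (d j * G j) = c i * d j * (G i * G j) by ring.
by apply: (@idealM _ (ideal_sq G)); apply: span_gen; exists (i, j).
Qed.

Lemma ideal_sq_sub (A : comPzRingType) (J : finType) (G : J -> A) a :
  ideal_sq G a -> ideal_span (fun z => exists j, z = G j) a.
Proof.
by apply: span_min => _ [[i j] ->]; apply/idealM/span_gen; exists j.
Qed.

(** Uniqueness of liftings along [C/D^2 -> C/D], for [C = B (x) B] and [D] the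
    ideal of the diagonal, says that the two coprojections agree modulo [D^2].
    So [D = D^2], and [D] being finitely generated, the determinant trick
    produces an element killing [D] and congruent to 1 modulo [D]. *)
Lemma etale_separability (A : comNzRingType) (B : comPzRingType) (e : {rmorphism A -> B}) :
  etale e -> exists (I : finType) (x y : I -> B), separability e x y.
Proof.
move=> [fe [n [m [b [rels [rels0 univ]]]]]].
have ext := presentation_ext rels0 univ.
have [T2 [X1 [X2 po]]] := pushout_exists e e.
pose d l := X1 (b l) - X2 (b l).
pose D := ideal_span (fun z => exists l, z = d l).
have XD (J : ideal T2) z : (forall l, J (d l)) -> J (X1 z - X2 z).
  move=> Jd; apply/quot_pi_eq.
  apply: (ext _ (quot_pi J \o X1 : {rmorphism _ -> _}) (quot_pi J \o X2 : {rmorphism _ -> _})).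
    by move=> a /=; rewrite (pushout_glue po).
  by move=> l; apply/quot_pi_eq/Jd.
have DX z : D (X1 z - X2 z) by apply: XD => l; apply: span_gen; exists l.
pose D2 := ideal_sq d.
have [|pi piE] := @quot_factorP _ _ D2 (quot_pi D).
  by move=> a /ideal_sq_sub /quot_pi0.
have D2X z : D2 (X1 z - X2 z).
  apply/quot_pi_eq.
  have [|||_ uniq] := fe _ _ pi _ _ (quot_pi D2 \o X1 \o e : {rmorphism _ -> _})
    (quot_pi D \o X1 : {rmorphism _ -> _}).
  - by move=> u; have [t <-] := quot_pi_surj u; exists (quot_pi D2 t).
  - move=> u v; have [s <-] := quot_pi_surj u; have [t <-] := quot_pi_surj v.
    rewrite !piE => /quot_pi0 Ds /quot_pi0 Dt; rewrite -rmorphM.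
    exact/quot_pi0/ideal_sqM.
  - by move=> a; apply/esym/piE.
  apply: (uniq (quot_pi D2 \o X1 : {rmorphism _ -> _}) (quot_pi D2 \o X2 : {rmorphism _ -> _})) => u /=;
    rewrite ?piE ?(pushout_glue po) //.
  exact/esym/quot_pi_eq/DX.
have /choice[c cE] : forall l, exists c : 'I_n * 'I_n -> T2,
    d l = \sum_jj c jj * (d jj.1 * d jj.2).
  by move=> l; apply: span_fin (D2X (b l)).
pose M : 'M[T2]_n := \matrix_(l, j) \sum_i c l (i, j) * d i.
pose v : 'cV[T2]_n := \col_l d l.
have Mv : (1%:M - M) *m v = 0.
  rewrite mulmxBl mul1mx; apply/eqP; rewrite subr_eq0; apply/eqP/colP => l.
  rewrite !mxE cE; under [RHS]eq_bigr => j _ do rewrite !mxE mulr_suml.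
  rewrite exchange_big pair_big; apply: eq_bigr => -[i j] _ /=.
  by rewrite mulrA.
pose E := \det (1%:M - M).
have Ed l : E * d l = 0.
  have : (\adj (1%:M - M) *m ((1%:M - M) *m v)) l 0 = 0 by rewrite Mv mulmx0 mxE.
  by rewrite mulmxA mul_adj_mx mul_scalar_mx !mxE.
have EX z : (X1 z - X2 z) * E = 0.
  have K0 : (fun t => t * E = 0) 0 by rewrite mul0r.
  have KD s t : s * E = 0 -> t * E = 0 -> (s + t) * E = 0.
    by move=> sE tE; rewrite mulrDl sE tE addr0.
  have KM s t : t * E = 0 -> (s * t) * E = 0 by move=> tE; rewrite -mulrA tE mulr0.
  by apply: (XD (@Ideal T2 (fun t => t * E = 0) K0 KD KM)) => l /=; rewrite mulrC.
have [mu [mu1 mu2]] := pushout_lift po (u' := (idfun : {rmorphism B -> B})) (v' := idfun) (fun=> erefl).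
have muE : mu E = 1.
  rewrite -det_map_mx rmorphB /= map_scalar_mx rmorph1.
  have -> : map_mx mu M = 0; last by rewrite subr0 det1.
  apply/matrixP => l j; rewrite !mxE rmorph_sum big1 // => i _.
  rewrite rmorphM rmorphB -[mu (X1 _)]/((mu \o X1) _) mu1.
  by rewrite -[mu (X2 _)]/((mu \o X2) _) mu2 subrr mulr0.
have [I [x [y xyE]]] := pushout_sum po E.
exists I, x, y; split.
  rewrite -muE xyE rmorph_sum; apply: eq_bigr => i _; rewrite rmorphM.
  by rewrite -[mu (X1 _)]/((mu \o X1) _) mu1 -[mu (X2 _)]/((mu \o X2) _) mu2.
move=> T Y1 Y2 YY z; have [w [w1 w2]] := pushout_lift po YY.
transitivity (w ((X1 z - X2 z) * E)); last by rewrite EX rmorph0.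
rewrite rmorphM rmorphB xyE rmorph_sum; congr ((_ - _) * _).
- exact/esym/w1.
- exact/esym/w2.
- by apply: eq_bigr => i _; rewrite rmorphM; congr (_ * _); [apply/esym/w1|apply/esym/w2].
Qed.

(** Infinitesimal lifting of the identity of [B = P/I] to [P/I^2] lifts further
    to an endomorphism of [P] that is the identity modulo [I] and maps [I] into
    its square. *)
Lemma etale_endomorphism (A : comNzRingType) (B : comPzRingType) (e : {rmorphism A -> B})
    (n m : nat) (b : 'I_n -> B) (rels : 'I_m -> polyterm A n)
    (G := fun j => peval (polynC A n) (@polynX A n) (rels j)) :
  formally_etale e -> (forall i, peval e b (rels i) = 0) ->
  (forall (C : comPzRingType) (g : {rmorphism A -> C}) (c : 'I_n -> C),
    (forall i, peval g c (rels i) = 0) ->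
    (exists k : {rmorphism B -> C}, k \o e =1 g /\ k \o b =1 c) /\
    (forall k k' : {rmorphism B -> C},
     k \o e =1 g -> k \o b =1 c -> k' \o e =1 g -> k' \o b =1 c -> k =1 k')) ->
  exists x : 'I_n -> polyn A n,
    (forall l, ideal_span (fun z => exists j, z = G j) (x l - polynX A l)) /\
    forall s : {rmorphism polyn A n -> polyn A n},
      (forall a, s (polynC A n a) = polynC A n a) -> (forall l, s (polynX A l) = x l) ->
      forall j, ideal_sq G (s (G j)).
Proof.
move=> fe rels0 univ.
have [p [pC pX ps pG pL]] := presentation_quotient rels0 univ.
rewrite -/G in pG pL; set I := ideal_span _.
have pI q : I q -> p q = 0.
  elim=> [|_ [j ->]|x y _ px _ py|x y _ py]; first exact: rmorph0.
  - exact: pG.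
  - by rewrite rmorphD px py addr0.
  - by rewrite rmorphM py mulr0.
have Ip q : p q = 0 -> I q.
  move=> pq; have [j|Y YE] := pL _ (quot_pi I).
    by apply/quot_pi0; apply: span_gen; exists j.
  by apply/quot_pi0; rewrite -YE pq rmorph0.
pose D2 := ideal_sq G.
have [|pi piE] := @quot_factorP _ _ D2 p.
  by move=> a /ideal_sq_sub /pI.
have [|||[k [kC kp]] _] := fe _ _ pi _ _ (quot_pi D2 \o polynC A n : {rmorphism _ -> _})
    (idfun : {rmorphism B -> B}).
- by move=> z; have [q <-] := ps z; exists (quot_pi D2 q).
- move=> u v; have [q <-] := quot_pi_surj u; have [r <-] := quot_pi_surj v.
  rewrite !piE => /Ip Iq /Ip Ir; rewrite -rmorphM.
  exact/quot_pi0/ideal_sqM.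
- by move=> a /=; rewrite piE pC.
have /choice[x xE] : forall l, exists q, quot_pi D2 q = k (b l).
  by move=> l; apply: quot_pi_surj.
exists x; split=> [l|s sC sX j].
  apply: Ip; rewrite rmorphB pX -piE xE.
  by rewrite -[pi _]/((pi \o k) (b l)) kp subrr.
apply/quot_pi0; have sk : quot_pi D2 \o s =1 k \o p.
  apply: (polyn_uniq (k := (quot_pi D2 \o s : {rmorphism _ -> _})) (k' := (k \o p : {rmorphism _ -> _}))) => i /=.
    by rewrite sC pC; apply/esym/kC.
  by rewrite sX pX xE.
by rewrite -[LHS]/((quot_pi D2 \o s) (G j)) sk /= pG rmorph0.
Qed.

Lemma polyn_lift_family (A A0 : comNzRingType) (f : {rmorphism A0 -> A}) n
    (m : {rmorphism polyn A0 n -> polyn A n}) (J : finType) (F : J -> polyn A n) :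
  (forall p, (forall a, a \in polyn_coefs p -> exists a', f a' = a) -> exists q, m q = p) ->
  (forall a, a \in flatten [seq polyn_coefs (F j) | j <- enum J] -> exists a', f a' = a) ->
  exists F0 : J -> polyn A0 n, forall j, m (F0 j) = F j.
Proof.
move=> mL h; suff /choice[F0 F0E] : forall j, exists q, m q = F j by exists F0.
move=> j; apply: mL => a aj.
by apply: h; apply/flattenP; exists (polyn_coefs (F j)) => //; apply: map_f; rewrite mem_enum.
Qed.

(** Etaleness is certified by finitely many polynomial identities, which involve
    finitely many elements of [A]. The subring [A0] generated by them is
    noetherian, and the algebra [B0] with the same presentation over [A0] has the
    same certificate: it makes [B0] separable over [A0], and flat by [flat_lift]. *)
Lemma noetherian_model (A : comNzRingType) (B : comPzRingType) (e : {rmorphism A -> B}) :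
  etale e -> exists (A0 B0 : comPzRingType) (f : {rmorphism A0 -> A})
    (e0 : {rmorphism A0 -> B0}) (f' : {rmorphism B0 -> B}),
    [/\ noetherian A0, is_pushout f e0 e f', flat e0,
        exists (I : finType) (x y : I -> B0), separability e0 x y & finite_type e0].
Proof.
move=> et; have [S [xs [ys [xy1 sep]]]] := etale_separability et.
have [fe [n [m [b [rels [rels0 univ]]]]]] := et.
pose P := polyn A n; pose pC := polynC A n; pose pX := @polynX A n.
pose G j := peval pC pX (rels j); pose I := ideal_span (fun z => exists j, z = G j).
have [p [ppC ppX ps pG pL]] := presentation_quotient rels0 univ.
have Ip q : p q = 0 -> I q.
  move=> pq; have [j|Y YE] := pL _ (quot_pi I).
    by apply/quot_pi0; apply: span_gen; exists j.
  by apply/quot_pi0; rewrite -YE pq rmorph0.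
have [x [xI xs2]] := etale_endomorphism fe rels0 univ.
have [s [sC sX]] := polyn_ext pC x.
have /choice[al alE] : forall l, exists c : 'I_m -> P, x l - pX l = \sum_j c j * G j.
  by move=> l; apply: span_fin (xI l).
have /choice[be beE] : forall j, exists c : 'I_m * 'I_m -> P,
    s (G j) = \sum_jj c jj * (G jj.1 * G jj.2).
  by move=> j; apply: span_fin (xs2 s sC sX j).
have /choice[xt xtE] : forall i, exists q, p q = xs i by move=> i; apply: ps.
have /choice[yt ytE] : forall i, exists q, p q = ys i by move=> i; apply: ps.
have [et1 et1E] : exists c : 'I_m -> P, \sum_i xt i * yt i - 1 = \sum_j c j * G j.
  apply: span_fin; apply: Ip; rewrite rmorphB rmorph1 rmorph_sum -xy1.
  by apply/eqP; rewrite subr_eq0; apply/eqP/eq_bigr => i _; rewrite rmorphM xtE ytE.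
pose P2 := polyn A (n + n); pose pC2 := polynC A (n + n).
have [i1 [i1C i1X]] := polyn_ext pC2 (fun l : 'I_n => polynX A (lshift n l)).
have [i2 [i2C i2X]] := polyn_ext pC2 (fun l : 'I_n => polynX A (rshift n l)).
pose G2 (j : 'I_m + 'I_m) : P2 := match j with inl j => i1 (G j) | inr j => i2 (G j) end.
pose I2 := ideal_span (fun z => exists j, z = G2 j).
have /choice[de deE] : forall l, exists c : 'I_m + 'I_m -> P2,
    (i1 (pX l) - i2 (pX l)) * \sum_i i1 (xt i) * i2 (yt i) = \sum_j c j * G2 j.
  move=> l; apply: span_fin; apply/quot_pi0.
  have [j|Y1 Y1E] := pL _ (quot_pi I2 \o i1 : {rmorphism _ -> _}).
    by apply/quot_pi0; apply: span_gen; exists (inl j).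
  have [j|Y2 Y2E] := pL _ (quot_pi I2 \o i2 : {rmorphism _ -> _}).
    by apply/quot_pi0; apply: span_gen; exists (inr j).
  have YY : Y1 \o e =1 Y2 \o e by move=> a /=; rewrite -ppC Y1E Y2E /= i1C i2C.
  rewrite -[RHS](sep _ _ _ YY (b l)).
  rewrite rmorphM rmorphB rmorph_sum -!ppX Y1E Y2E; congr (_ * _).
  by apply: eq_bigr => i _; rewrite rmorphM -xtE -ytE Y1E Y2E.
(* The polynomials of the certificate in [n] variables form one family [F], and
   those in [n + n] variables another one, [F2]. *)
have [F FE] : exists F : ('I_m + 'I_n) + ('I_n * 'I_m + 'I_m * ('I_m * 'I_m)) +
      (S + S + 'I_m) -> P,
    [/\ forall j, F (inl (inl (inl j))) = G j, forall l, F (inl (inl (inr l))) = x l,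
        forall l j, F (inl (inr (inl (l, j)))) = al l j,
        forall j jj, F (inl (inr (inr (j, jj)))) = be j jj &
        [/\ forall i, F (inr (inl (inl i))) = xt i, forall i, F (inr (inl (inr i))) = yt i &
           forall j, F (inr (inr j)) = et1 j]].
  exists (fun z => match z with
    | inl (inl (inl j)) => G j | inl (inl (inr l)) => x l
    | inl (inr (inl w)) => al w.1 w.2 | inl (inr (inr w)) => be w.1 w.2
    | inr (inl (inl i)) => xt i | inr (inl (inr i)) => yt i
    | inr (inr j) => et1 j end).
  by [].
pose F2 (z : 'I_n * ('I_m + 'I_m)) := de z.1 z.2.
have [A0 [f [nA0 f_inj fL]]] := fg_subring (flatten [seq polyn_coefs (F z) | z <- enum {: _}] ++
  flatten [seq polyn_coefs (F2 z) | z <- enum {: _}]).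
have [mf [mC mX /(_ f_inj) m_inj mL]] := polyn_map f n.
have [mf2 [m2C m2X /(_ f_inj) m2_inj m2L]] := polyn_map f (n + n).
have [|F0 F0E] := polyn_lift_family (F := F) mL.
  by move=> a aF; apply: fL; rewrite mem_cat aF.
have [|D0 D0E] := polyn_lift_family (F := F2) m2L.
  by move=> a aF; apply: fL; rewrite mem_cat aF orbT.
pose G0 j := F0 (inl (inl (inl j))); pose x0 l := F0 (inl (inl (inr l))).
pose al0 l j := F0 (inl (inr (inl (l, j)))); pose be0 j jj := F0 (inl (inr (inr (j, jj)))).
pose xt0 i := F0 (inr (inl (inl i))); pose yt0 i := F0 (inr (inl (inr i))).
pose et0 j := F0 (inr (inr j)); pose de0 l j := D0 (l, j).
have [GE xE alE' beE' [xtE' ytE' etE']] := FE.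
have mG j : mf (G0 j) = G j by rewrite F0E GE.
have mx l : mf (x0 l) = x l by rewrite F0E xE.
have mxt i : mf (xt0 i) = xt i by rewrite F0E xtE'.
have myt i : mf (yt0 i) = yt i by rewrite F0E ytE'.
pose P0 := polyn A0 n; pose pC0 := polynC A0 n; pose pX0 := @polynX A0 n.
pose gs := [seq G0 j | j <- enum 'I_m]; pose I0 := ideal_span (fun z => z \in gs).
have I0G j : I0 (G0 j) by apply: span_gen; apply: map_f; rewrite mem_enum.
have [s0 [s0C s0X]] := polyn_ext pC0 x0.
have ms0 : mf \o s0 =1 s \o mf.
  apply: (polyn_uniq (k := (mf \o s0 : {rmorphism _ -> _})) (k' := (s \o mf : {rmorphism _ -> _}))) => i /=.
    by rewrite s0C !mC sC.
  by rewrite s0X mX sX mx.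
have xI0 l : I0 (x0 l - pX0 l).
  suff -> : x0 l - pX0 l = \sum_j al0 l j * G0 j by apply: ideal_sum => j _; apply: idealM.
  apply: m_inj; rewrite rmorphB mx mX alE rmorph_sum; apply: eq_bigr => j _.
  by rewrite rmorphM mG F0E alE'.
have sI0 g : g \in gs -> ideal_pow I0 2 (s0 g).
  move=> /mapP[j _ ->]; have -> : s0 (G0 j) = \sum_jj be0 j jj * (G0 jj.1 * G0 jj.2).
    apply: m_inj; rewrite -[LHS]/((mf \o s0) (G0 j)) ms0 /= mG beE rmorph_sum.
    by apply: eq_bigr => jj _; rewrite !rmorphM !mG F0E beE'.
  apply: ideal_sum => jj _; apply: idealM; apply: ideal_powS => //.
  exact: ideal_pow1.
have s0I q : I0 (s0 q - q).
  elim/polyn_ind: q => [a|l|q r Iq Ir|q r Iq Ir].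
  - by rewrite s0C subrr; apply: ideal0.
  - by rewrite s0X.
  - by rewrite rmorphD opprD addrACA; apply: idealD.
  - have -> : s0 (q * r) - q * r = s0 q * (s0 r - r) + r * (s0 q - q) by rewrite rmorphM; ring.
    by apply: idealD; apply: idealM.
pose B0 := quot I0; pose e0 : {rmorphism A0 -> B0} := quot_pi I0 \o pC0.
have fl0 : flat e0.
  exact: (flat_lift (noetherian_polyn (n := n) nA0) (@flat_polyn A0 n) s0C s0I sI0).
have [|f' f'E] := @quot_factorP _ _ I0 (p \o mf : {rmorphism P0 -> B}).
  move=> q; elim=> [|_ /mapP[j _ ->]|c d _ pc _ pd|c d _ pd].
  - exact: rmorph0.
  - by rewrite /= mG pG.
  - by rewrite rmorphD pc pd addr0.
  - by rewrite rmorphM pd mulr0.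
exists A0, B0, f, e0, f'; split=> //.
- split=> [a|D u' v' uv] /=; first by rewrite f'E /= mC ppC.
  have [k [kC kX]] := polyn_ext u' (fun l => v' (quot_pi I0 (pX0 l))).
  have kv : k \o mf =1 v' \o quot_pi I0.
    apply: (polyn_uniq (k := (k \o mf : {rmorphism _ -> _}))
      (k' := (v' \o quot_pi I0 : {rmorphism _ -> _}))) => i /=.
      by rewrite mC kC; apply: uv.
    by rewrite mX kX.
  have [j|Y YE] := pL _ k.
    rewrite -[peval _ _ _]/(G j) -mG -[LHS]/((k \o mf) (G0 j)) kv /=.
    by have /quot_pi0 -> := I0G j; rewrite rmorph0.
  split.
    exists Y; split=> [a|q] /=; first by rewrite -ppC YE kC.
    by have [r <-] := quot_pi_surj q; rewrite f'E /= YE; apply: kv.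
  move=> w w' wu wv wu' wv'; apply: (presentation_ext rels0 univ) => i.
    by rewrite [LHS]wu [RHS]wu'.
  have <- : f' (quot_pi I0 (pX0 i)) = b i by rewrite f'E /= mX ppX.
  by rewrite [LHS]wv [RHS]wv'.
- exists S, (quot_pi I0 \o xt0), (quot_pi I0 \o yt0); split.
    rewrite -[RHS]/(quot_pi I0 1); apply/eqP; rewrite -subr_eq0; apply/eqP.
    have -> : \sum_i (quot_pi I0 \o xt0) i * (quot_pi I0 \o yt0) i - quot_pi I0 1 =
              quot_pi I0 (\sum_i xt0 i * yt0 i - 1).
      rewrite rmorphB rmorph_sum; congr (_ - _).
      by apply: eq_bigr => i _; rewrite rmorphM.
    apply/quot_pi0; suff -> : \sum_i xt0 i * yt0 i - 1 = \sum_j et0 j * G0 j.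
      by apply: ideal_sum => j _; apply: idealM.
    apply: m_inj; rewrite rmorphB rmorph1 !rmorph_sum.
    under eq_bigr do rewrite rmorphM mxt myt; rewrite et1E; apply: eq_bigr => j _.
    by rewrite rmorphM mG F0E etE'.
  move=> T Y1 Y2 YY z; have [k [kC kX]] := polyn_ext (Y1 \o e0 : {rmorphism _ -> _})
    (fun l : 'I_(n + n) => match fintype.split l with
      | inl l => Y1 (quot_pi I0 (pX0 l)) | inr l => Y2 (quot_pi I0 (pX0 l)) end).
  have [j1 [j1C j1X]] := polyn_ext (polynC A0 (n + n)) (fun l : 'I_n => polynX A0 (lshift n l)).
  have [j2 [j2C j2X]] := polyn_ext (polynC A0 (n + n)) (fun l : 'I_n => polynX A0 (rshift n l)).
  have kj1 : k \o j1 =1 Y1 \o quot_pi I0.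
    apply: (polyn_uniq (k := (k \o j1 : {rmorphism _ -> _}))
      (k' := (Y1 \o quot_pi I0 : {rmorphism _ -> _}))) => i /=; first by rewrite j1C kC.
    by rewrite j1X kX (unsplitK (inl i)).
  have kj2 : k \o j2 =1 Y2 \o quot_pi I0.
    apply: (polyn_uniq (k := (k \o j2 : {rmorphism _ -> _}))
      (k' := (Y2 \o quot_pi I0 : {rmorphism _ -> _}))) => i /=.
      by rewrite j2C kC; apply: YY.
    by rewrite j2X kX (unsplitK (inr i)).
  have mj1 : mf2 \o j1 =1 i1 \o mf.
    apply: (polyn_uniq (k := (mf2 \o j1 : {rmorphism _ -> _}))
      (k' := (i1 \o mf : {rmorphism _ -> _}))) => i /=; first by rewrite j1C m2C mC i1C.
    by rewrite j1X m2X mX i1X.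
  have mj2 : mf2 \o j2 =1 i2 \o mf.
    apply: (polyn_uniq (k := (mf2 \o j2 : {rmorphism _ -> _}))
      (k' := (i2 \o mf : {rmorphism _ -> _}))) => i /=; first by rewrite j2C m2C mC i2C.
    by rewrite j2X m2X mX i2X.
  pose E := diag (quot_pi I0 \o xt0) (quot_pi I0 \o yt0) Y1 Y2.
  pose E' := \sum_i j1 (xt0 i) * j2 (yt0 i).
  have kE : k E' = E.
    rewrite rmorph_sum; apply: eq_bigr => i _; rewrite rmorphM.
    by congr (_ * _); [apply: kj1|apply: kj2].
  have gen l : (Y1 (quot_pi I0 (pX0 l)) - Y2 (quot_pi I0 (pX0 l))) * E = 0.
    have rel : (j1 (pX0 l) - j2 (pX0 l)) * E' =
        \sum_j de0 l (inl j) * j1 (G0 j) + \sum_j de0 l (inr j) * j2 (G0 j).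
      apply: m2_inj; rewrite rmorphM rmorphB rmorph_sum.
      have -> : mf2 (j1 (pX0 l)) - mf2 (j2 (pX0 l)) = i1 (pX l) - i2 (pX l).
        by rewrite -[mf2 (j1 _)]/((mf2 \o j1) _) mj1 -[mf2 (j2 _)]/((mf2 \o j2) _) mj2 /= mX.
      under eq_bigr => i _.
        rewrite rmorphM -[mf2 (j1 _)]/((mf2 \o j1) _) mj1 /= mxt.
        rewrite -[mf2 (j2 _)]/((mf2 \o j2) _) mj2 /= myt; over.
      rewrite deE big_sumType rmorphD !rmorph_sum; congr (_ + _); apply: eq_bigr => j _.
        by rewrite rmorphM D0E -[mf2 (j1 _)]/((mf2 \o j1) _) mj1 /= mG.
      by rewrite rmorphM D0E -[mf2 (j2 _)]/((mf2 \o j2) _) mj2 /= mG.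
    have <- : k ((j1 (pX0 l) - j2 (pX0 l)) * E') =
        (Y1 (quot_pi I0 (pX0 l)) - Y2 (quot_pi I0 (pX0 l))) * E.
      by rewrite rmorphM rmorphB kE; congr ((_ - _) * _); [apply: kj1|apply: kj2].
    rewrite rel rmorphD !rmorph_sum !big1 ?addr0 // => j _; rewrite rmorphM.
      by rewrite -[k (j2 _)]/((k \o j2) _) kj2 /=; have /quot_pi0 -> := I0G j; rewrite rmorph0 mulr0.
    by rewrite -[k (j1 _)]/((k \o j1) _) kj1 /=; have /quot_pi0 -> := I0G j; rewrite rmorph0 mulr0.
  have [q <-] := quot_pi_surj z; elim/polyn_ind: q => [a|//|q r Eq Er|q r Eq Er].
  - have -> : Y1 (quot_pi I0 (polynC A0 n a)) = Y2 (quot_pi I0 (polynC A0 n a)) by apply: YY.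
    by rewrite subrr mul0r.
  - rewrite !rmorphD opprD addrACA mulrDl; rewrite /E in Eq Er *.
    by rewrite Eq Er addr0.
  - rewrite /E in Eq Er *; rewrite !rmorphM; set D1 := diag _ _ _ _ in Eq Er *.
    set q1 := Y1 _ in Eq *; set q2 := Y2 _ in Eq *.
    set r1 := Y1 _ in Er *; set r2 := Y2 _ in Er *.
    have -> : (q1 * r1 - q2 * r2) * D1 = q1 * ((r1 - r2) * D1) + r2 * ((q1 - q2) * D1) by ring.
    by rewrite Eq Er !mulr0 addr0.
exists 'I_n, (fun l => quot_pi I0 (pX0 l)) => Q QC QX QD QM z.
have [q <-] := quot_pi_surj z; elim/polyn_ind: q => [a|l|q r Qq Qr|q r Qq Qr].
- exact: QC.
- exact: QX.
- by rewrite rmorphD; apply: QD.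
- by rewrite rmorphM; apply: QM.
Qed.

(** * Separability idempotents and tensor powers *)

Section Diag.
Variables (A B : comPzRingType) (e : {rmorphism A -> B}) (I : finType) (x y : I -> B).
Hypothesis sep : separability e x y.

Lemma diag_morph (T D : comPzRingType) (phi : {rmorphism T -> D}) (Y1 Y2 : B -> T) :
  phi (diag x y Y1 Y2) = diag x y (phi \o Y1) (phi \o Y2).
Proof. by rewrite rmorph_sum; apply: eq_bigr => i _; rewrite rmorphM. Qed.

Lemma eq_diag (T : comPzRingType) (Y1 Y2 Z1 Z2 : B -> T) :
  Y1 =1 Z1 -> Y2 =1 Z2 -> diag x y Y1 Y2 = diag x y Z1 Z2.
Proof. by move=> h1 h2; apply: eq_bigr => i _; rewrite h1 h2. Qed.

Lemma diag_same (T : comPzRingType) (Y : {rmorphism B -> T}) : diag x y Y Y = 1.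
Proof.
have [xy _] := sep; rewrite -(rmorph1 Y) -xy rmorph_sum.
by apply: eq_bigr => i _; rewrite rmorphM.
Qed.

Variables (T : comPzRingType) (Y1 Y2 : {rmorphism B -> T}).
Hypothesis Y12 : Y1 \o e =1 Y2 \o e.

Lemma diag_comm b : diag x y Y1 Y2 * Y1 b = diag x y Y1 Y2 * Y2 b.
Proof.
have [_ /(_ T Y1 Y2 Y12 b) h] := sep.
by apply/eqP; rewrite -subr_eq0 -mulrBr mulrC h.
Qed.

(** On the diagonal the second point may be replaced by the first. *)
Lemma diag_subst (Z : {rmorphism B -> T}) :
  diag x y Y1 Y2 * diag x y Z Y2 = diag x y Y1 Y2 * diag x y Z Y1.
Proof.
rewrite !mulr_sumr; apply: eq_bigr => i _.
by rewrite mulrCA -diag_comm mulrCA.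
Qed.

Lemma diag_idem : diag x y Y1 Y2 * diag x y Y1 Y2 = diag x y Y1 Y2.
Proof. by rewrite diag_subst diag_same mulr1. Qed.

End Diag.

Lemma diag_sym (A B : comPzRingType) (e : {rmorphism A -> B}) (I : finType) (x y : I -> B)
    (T : comPzRingType) (Y1 Y2 : {rmorphism B -> T}) :
  separability e x y -> Y1 \o e =1 Y2 \o e -> diag x y Y1 Y2 = diag x y Y2 Y1.
Proof.
move=> sep Y12; have Y21 : Y2 \o e =1 Y1 \o e by move=> a; rewrite Y12.
have h := diag_subst sep Y12 Y2; have h' := diag_subst sep Y21 Y1.
rewrite (diag_same sep) mulr1 in h.
by rewrite (diag_same sep) mulr1 in h'; rewrite [LHS]h [RHS]h' mulrC.
Qed.

Lemma diag_distinct (A B : comPzRingType) (e : {rmorphism A -> B}) (I : finType)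
    (x y : I -> B) (D : idomainType) (Y1 Y2 : {rmorphism B -> D}) b :
  separability e x y -> Y1 \o e =1 Y2 \o e -> Y1 b != Y2 b -> diag x y Y1 Y2 = 0.
Proof.
move=> sep Y12; rewrite -subr_eq0 => Yb; have := diag_comm sep Y12 b.
move=> /eqP; rewrite -subr_eq0 -mulrBr mulf_eq0 (negPf Yb) orbF.
by move/eqP.
Qed.

Lemma separability_base_change (A B S T : comPzRingType) (e : {rmorphism A -> B})
    (th : {rmorphism A -> S}) (u : {rmorphism S -> T}) (v : {rmorphism B -> T})
    (I : finType) (x y : I -> B) :
  is_pushout th e u v -> separability e x y -> separability u (v \o x) (v \o y).
Proof.
move=> po sep; split.
  have [xy _] := sep; rewrite -(rmorph1 v) -xy rmorph_sum.
  by apply: eq_bigr => i _; rewrite rmorphM.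
move=> D Y1 Y2 Y12 t; have Y12' : (Y1 \o v) \o e =1 (Y2 \o v) \o e.
  by move=> a /=; rewrite -(pushout_glue po); apply: Y12.
have dE : diag (v \o x) (v \o y) Y1 Y2 = diag x y (Y1 \o v) (Y2 \o v) by [].
rewrite dE; elim/(pushout_ind po): t => [a|b|s t ss st|s t ss st].
- by rewrite [Y1 _]Y12 subrr mul0r.
- have [_ h] := sep.
  exact: (h _ (Y1 \o v : {rmorphism _ -> _}) (Y2 \o v : {rmorphism _ -> _}) Y12').
- by rewrite !rmorphD opprD addrACA mulrDl ss st addr0.
- rewrite !rmorphM; set d := diag _ _ _ _ in ss st *.
  have -> : (Y1 s * Y1 t - Y2 s * Y2 t) * d =
    Y1 s * ((Y1 t - Y2 t) * d) + Y2 t * ((Y1 s - Y2 s) * d) by ring.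
  by rewrite ss st !mulr0 addr0.
Qed.

(** The [m]-th tensor power of [B] over [A], with its coprojections. The induction
    principle stands for the uniqueness part of the universal property. *)
Definition is_power (A B : comPzRingType) (e : {rmorphism A -> B}) m
    (T : comPzRingType) (t : {rmorphism A -> T}) (X : 'I_m -> {rmorphism B -> T}) : Prop :=
  [/\ forall i, X i \o e =1 t,
      forall (D : comPzRingType) (d : {rmorphism A -> D}) (Y : 'I_m -> {rmorphism B -> D}),
        (forall i, Y i \o e =1 d) ->
        exists w : {rmorphism T -> D}, w \o t =1 d /\ forall i, w \o X i =1 Y i &
      forall Q : T -> Prop, (forall a, Q (t a)) -> (forall i b, Q (X i b)) ->
        (forall s r, Q s -> Q r -> Q (s + r)) -> (forall s r, Q s -> Q r -> Q (s * r)) ->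
        forall z, Q z].

Lemma power_exists (A B : comPzRingType) (e : {rmorphism A -> B}) m :
  flat e -> exists (T : comPzRingType) (t : {rmorphism A -> T})
    (X : 'I_m -> {rmorphism B -> T}), is_power e t X /\ flat t.
Proof.
move=> fl; elim: m => [|m [T [t [X [[Xt univ ind] flt]]]]].
  exists A, (idfun : {rmorphism A -> A}), (fun i : 'I_0 => let: Ordinal _ h := i in
    match Bool.diff_false_true h with end); split; last exact: flat_id.
  split=> [[]//|D d Y _|Q QA _ _ _ z]; last exact: QA.
  by exists d; split=> // -[].
have [T' [u [v po]]] := pushout_exists t e.
pose X' i : {rmorphism B -> T'} :=
  if unlift ord_max i is Some j then (u \o X j : {rmorphism _ -> _}) else v.
exists T', (u \o t : {rmorphism _ -> _}), X'; split; last first.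
  exact: (flat_comp flt (flat_base_change po fl)).
split=> [i a|D d Y Yd|Q Qt QX QD QM].
- rewrite /= /X'; case: (unlift ord_max i) => [j|]; last by rewrite (pushout_glue po).
  by rewrite /=; congr (u _); apply: Xt.
- have [w [wt wX]] := univ D d (fun j => Y (lift ord_max j)) (fun j => Yd (lift ord_max j)).
  have [a|w' [w'u w'v]] := pushout_lift po (u' := w) (v' := Y ord_max).
    by rewrite [LHS]wt [RHS]Yd.
  exists w'; split=> [a|i b] /=.
    by rewrite -[LHS]/((w' \o u) (t a)) w'u; apply: wt.
  rewrite /X'; case: unliftP => [j ->|->]; last exact: w'v.
  by rewrite -[LHS]/((w' \o u) (X j b)) w'u; apply: wX.
- apply: (pushout_ind po) => // [z|b].
    elim/ind: z => [//|j b|s r Qs Qr|s r Qs Qr].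
    + by have := QX (lift ord_max j) b; rewrite /X' liftK.
    + by rewrite rmorphD; apply: QD.
    + by rewrite rmorphM; apply: QM.
  by have := QX ord_max b; rewrite /X' unlift_none.
Qed.

Lemma power_ext (A B : comPzRingType) (e : {rmorphism A -> B}) m
    (T : comPzRingType) (t : {rmorphism A -> T}) (X : 'I_m -> {rmorphism B -> T})
    (D : comPzRingType) (g g' : {rmorphism T -> D}) :
  is_power e t X -> (forall a, g (t a) = g' (t a)) ->
  (forall i b, g (X i b) = g' (X i b)) -> g =1 g'.
Proof.
move=> [_ _ ind] gt gX; apply: ind => // s r gs gr.
  by rewrite !rmorphD gs gr.
by rewrite !rmorphM gs gr.
Qed.

(** [omega Y] is the function equal to 1 at the families of pairwise distinct
    points, and to 0 at the other families. *)
Definition omega (B T : comPzRingType) (I : finType) (x y : I -> B) m (Y : 'I_m -> B -> T) : T :=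
  \prod_(ij : 'I_m * 'I_m | ij.1 != ij.2) (1 - diag x y (Y ij.1) (Y ij.2)).

Lemma eq_omega (B T : comPzRingType) (I : finType) (x y : I -> B) m (Y Z : 'I_m -> B -> T) :
  (forall i, Y i =1 Z i) -> omega x y Y = omega x y Z.
Proof. by move=> YZ; apply: eq_bigr => ij _; rewrite (eq_diag _ _ (YZ _) (YZ _)). Qed.

Lemma omega_morph (B T D : comPzRingType) (I : finType) (x y : I -> B) m
    (phi : {rmorphism T -> D}) (Y : 'I_m -> B -> T) :
  phi (omega x y Y) = omega x y (fun i => phi \o Y i).
Proof. by rewrite rmorph_prod; apply: eq_bigr => ij _; rewrite rmorphB rmorph1 diag_morph. Qed.

Section Omega.
Variables (A B : comPzRingType) (e : {rmorphism A -> B}) (I : finType) (x y : I -> B).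
Hypothesis sep : separability e x y.
Variables (T : comPzRingType) (m : nat) (Y : 'I_m -> {rmorphism B -> T}).
Hypothesis YY : forall i j, Y i \o e =1 Y j \o e.

Lemma omega_idem : omega x y Y * omega x y Y = omega x y Y.
Proof.
rewrite -big_split; apply: eq_bigr => ij _ /=.
by rewrite mulrBl mul1r mulrBr mulr1 (diag_idem sep) // subrr subr0.
Qed.

Lemma omega_diag i j : i != j -> omega x y Y * diag x y (Y i) (Y j) = 0.
Proof.
move=> ij; rewrite /omega (bigD1 (i, j)) //= mulrAC.
by rewrite mulrBl mul1r (diag_idem sep) // subrr mul0r.
Qed.

End Omega.

Lemma omega_distinct (A B : comPzRingType) (e : {rmorphism A -> B}) (I : finType)
    (x y : I -> B) (D : idomainType) m (Y : 'I_m -> {rmorphism B -> D}) :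
  separability e x y -> (forall i j, Y i \o e =1 Y j \o e) ->
  (forall i j, i != j -> exists b, Y i b != Y j b) -> omega x y Y = 1.
Proof.
move=> sep YY Yd; rewrite /omega big1 // => -[i j] /= /Yd[b Yb].
by rewrite (diag_distinct sep (YY _ _) Yb) subr0.
Qed.

Lemma omega_coincide (A B : comPzRingType) (e : {rmorphism A -> B}) (I : finType)
    (x y : I -> B) (D : comPzRingType) m (Y : 'I_m -> {rmorphism B -> D}) i j :
  separability e x y -> i != j -> Y i =1 Y j -> omega x y Y = 0.
Proof.
move=> sep ij Yij; rewrite /omega (bigD1 (i, j)) //=.
by rewrite -(eq_diag _ _ (fun=> erefl) Yij) (diag_same sep) subrr mul0r.
Qed.

(** * Separable flat algebras over a domain are generically finite *)

Lemma fraction_repr (D : idomainType) (z : {fraction D}) :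
  exists n d : D, d != 0 /\ tofrac n = tofrac d * z.
Proof.
elim/quotW: z => r; exists \n_r, \d_r; split; first exact: denom_ratioP.
unlock FracField.tofrac; rewrite -[RHS]FracField.pi_mul.
apply/eqP; rewrite FracField.equivf_def /FracField.mulf.
by rewrite !numden_Ratio ?mulf_neq0 ?oner_neq0 ?denom_ratioP // !mul1r mulrC.
Qed.

Lemma clear_denominators (D : idomainType) (J : finType) (v : J -> {fraction D}) :
  exists (d : D) (n : J -> D), d != 0 /\ forall j, tofrac (n j) = tofrac d * v j.
Proof.
have /choice[nd ndE] : forall j, exists nd : D * D, nd.2 != 0 /\ tofrac nd.1 = tofrac nd.2 * v j.
  by move=> j; have [n [d h]] := fraction_repr (v j); exists (n, d).
exists (\prod_j (nd j).2), (fun j => (nd j).1 * \prod_(i | i != j) (nd i).2); split.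
  by apply/prodf_neq0 => j _; have [] := ndE j.
move=> j; rewrite [in RHS](bigD1 j) //= !tofracM; have [_ ->] := ndE j; ring.
Qed.

(** Full row rank gives a right inverse over the fraction field. *)
Lemma independent_rows (D : idomainType) (I K : finType) (rho : I -> K -> D) :
  (forall c : I -> D, (forall k, \sum_i c i * rho i k = 0) -> forall i, c i = 0) ->
  exists (mu : K -> I -> D) (d : D), d != 0 /\
    forall i l, \sum_k rho i k * mu k l = d * (i == l)%:R.
Proof.
move=> ind; pose M : 'M[{fraction D}]_(#|I|, #|K|) :=
  \matrix_(i, k) tofrac (rho (enum_val i) (enum_val k)).
have /row_freeP[N MN] : row_free M.
  rewrite -kermx_eq0; apply/rowV0P => v /sub_kermxP vM.
  have [d [n [d0 nE]]] := clear_denominators (fun i : I => v 0 (enum_rank i)).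
  have n0 : forall i, n i = 0.
    apply: ind => k; apply/eqP; rewrite -tofrac_eq0 rmorph_sum /=; apply/eqP.
    transitivity (tofrac d * (v *m M) 0 (enum_rank k)); last by rewrite vM mxE mulr0.
    rewrite mxE mulr_sumr (reindex_onto enum_val enum_rank) /=.
      apply: eq_big => [i|i _]; rewrite ?enum_valK ?eqxx //.
      by rewrite tofracM nE !mxE enum_valK enum_rankK mulrA.
    by move=> i _; apply: enum_rankK.
  apply/rowP => i; rewrite mxE; apply/eqP.
  have := nE (enum_val i); rewrite n0 rmorph0 enum_valK => /esym/eqP.
  by rewrite mulf_eq0 tofrac_eq0 (negPf d0).
have [d [n [d0 nE]]] := clear_denominators (fun kl : K * I => N (enum_rank kl.1) (enum_rank kl.2)).
exists (fun k l => n (k, l)), d; split=> // i l; apply/eqP.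
rewrite -tofrac_eq rmorph_sum rmorphM rmorph_nat /=; apply/eqP.
have := congr1 (fun w : 'M_#|I| => tofrac d * w (enum_rank i) (enum_rank l)) MN.
rewrite !mxE (inj_eq enum_rank_inj) => <-; rewrite mulr_sumr (reindex_onto enum_val enum_rank) /=.
  apply: eq_big => [k|k _]; rewrite ?enum_valK ?eqxx // tofracM nE !mxE enum_valK enum_rankK /=.
  by rewrite mulrCA.
by move=> k _; apply: enum_rankK.
Qed.

Section Spanned.
Variables (D C : comPzRingType) (t : {rmorphism D -> C}) (L : finType) (g : L -> C).

Definition spanned (P : D -> Prop) (z : C) : Prop :=
  exists a : L -> D, (forall l, P (a l)) /\ z = \sum_l t (a l) * g l.

Variable P : ideal D.

Lemma spanned0 : spanned P 0.
Proof.
exists (fun=> 0); split=> [_|]; first exact: ideal0.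
by rewrite big1 // => l _; rewrite rmorph0 mul0r.
Qed.

Lemma spannedD z z' : spanned P z -> spanned P z' -> spanned P (z + z').
Proof.
move=> [a [Pa ->]] [a' [Pa' ->]]; exists (fun l => a l + a' l); split=> [l|].
  exact: idealD.
by rewrite -big_split; apply: eq_bigr => l _; rewrite rmorphD mulrDl.
Qed.

Lemma spannedZ d z : spanned P z -> spanned P (t d * z).
Proof.
move=> [a [Pa ->]]; exists (fun l => d * a l); split=> [l|]; first exact: idealM.
by rewrite mulr_sumr; apply: eq_bigr => l _; rewrite rmorphM mulrA.
Qed.

Lemma spanned_sum (J : Type) (s : seq J) (F : J -> C) :
  (forall j, spanned P (F j)) -> spanned P (\sum_(j <- s) F j).
Proof.
by move=> h; apply: big_ind => // [|z z']; [exact: spanned0|exact: spannedD].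
Qed.

End Spanned.

Definition unit_ideal (D : comPzRingType) : ideal D := @Ideal D (fun=> True) I (fun _ _ _ _ => I) (fun _ _ _ => I).

(** After inversion of nonzero elements of [D], the span of the [g l] is stable
    under multiplication by [C] and contains 1, hence is all of [C]. *)
Definition generically_finite (D : idomainType) (C : comPzRingType) (t : {rmorphism D -> C}) : Prop :=
  exists (L : finType) (g : L -> C),
    (exists2 s, s != 0 & spanned t g (unit_ideal D) (t s)) /\
    forall c, exists2 d, d != 0 & forall l, spanned t g (unit_ideal D) (t d * c * g l).

(** Write a nonzero multiple of the separability idempotent as
    [\sum_k x_k (x) y_k] with the least number of terms, so that the [x_k] are
    linearly independent. Flatness applied to the relation
    [\sum_k (x_k (x) c y_k - c x_k (x) y_k) = 0] expresses the [x_k] by means of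
    a matrix [rho] with independent rows, and gives the [c y_k] as combinations
    of the [y_k] after inversion of [rho]. *)
Lemma separable_generically_finite (D : idomainType) (C : comPzRingType)
    (t : {rmorphism D -> C}) (I : finType) (x y : I -> C) :
  flat t -> separability t x y -> generically_finite t.
Proof.
move=> fl sep; have [T [X1 [X2 po]]] := pushout_exists t t.
have glue := pushout_glue po.
pose E := diag x y X1 X2.
pose P r := `[< exists s (x y : 'I_r -> C), s != 0 /\ X1 (t s) * E = \sum_k X1 (x k) * X2 (y k) >].
have exP : exists r, P r.
  exists #|I|; apply/asboolP; exists 1, (x \o enum_val), (y \o enum_val).
  rewrite oner_neq0 !rmorph1 mul1r /E /diag (reindex_onto (@enum_val I I) enum_rank) /=.
    by split=> //; apply: eq_bigl => k; rewrite enum_valK eqxx.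
  by move=> i _; apply: enum_rankK.
case: (ex_minnP exP) => r /asboolP[s [x' [y' [s0 sE]]]] minr.
(* A dependence between the [x' k] would eliminate the term [k0]. *)
have indep (c : 'I_r -> D) : \sum_k t (c k) * x' k = 0 -> forall k, c k = 0.
  move=> cx k0; apply/eqP; apply: contrapT => /negP ck0.
  case: r => [|r] in x' y' sE minr c k0 cx ck0 *; first by case: k0 ck0.
  suff : (r.+1 <= r)%N by rewrite ltnn.
  apply: minr; apply/asboolP.
  exists (c k0 * s), (fun j => x' (lift k0 j)).
  exists (fun j => t (c k0) * y' (lift k0 j) - t (c (lift k0 j)) * y' k0).
  split; first by rewrite mulf_neq0.
  move: cx; rewrite (bigD1_ord k0) //= => /(congr1 X1); rewrite rmorph0 rmorphD rmorph_sum => cx.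
  rewrite !rmorphM -mulrA sE (bigD1_ord k0) //= mulrDr mulrA -rmorphM.
  have -> : X1 (t (c k0) * x' k0) = - \sum_(i < r) X1 (t (c (lift k0 i)) * x' (lift k0 i)).
    by apply/eqP; rewrite -addr_eq0 cx.
  rewrite mulNr mulr_suml mulr_sumr addrC -sumrB; apply: eq_bigr => i _.
  by rewrite rmorphB !rmorphM !glue; ring.
have act c : exists2 d, d != 0 & forall l, spanned t y' (unit_ideal D) (t d * c * y' l).
  pose b (z : 'I_r + 'I_r) := match z with inl k => c * y' k | inr k => y' k end.
  pose n (z : 'I_r + 'I_r) := match z with inl k => x' k | inr k => - (c * x' k) end.
  have rel : \sum_z X2 (b z) * X1 (n z) = 0.
    rewrite big_sumType /= -big_split /=.
    transitivity ((X2 c - X1 c) * (X1 (t s) * E)).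
      by rewrite sE mulr_sumr; apply: eq_bigr => k _; rewrite rmorphN !rmorphM; ring.
    have cm := diag_comm sep glue c; rewrite -/E in cm.
    by rewrite mulrCA mulrBl ![_ * E]mulrC cm subrr mulr0.
  have [K [rho [m [nE relE]]]] := fl _ _ _ _ _ (pushout_sym po) _ _ _ rel.
  have [a|mu [d [d0 muE]]] := @independent_rows D 'I_r K (fun k => rho (inl k)).
    move=> ah; apply: indep; under eq_bigr => k _.
      rewrite -[x' k]/(n (inl k)) nE mulr_sumr; over.
    rewrite exchange_big big1 // => k _ /=.
    transitivity (t (\sum_i a i * rho (inl i) k) * m k); last by rewrite ah rmorph0 mul0r.
    by rewrite rmorph_sum mulr_suml; apply: eq_bigr => i _; rewrite rmorphM mulrA.
  exists d => // l.
  have -> : t d * c * y' l = \sum_k t (- mu k l) * \sum_i t (rho (inr i) k) * y' i.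
    transitivity (\sum_k t (mu k l) * \sum_i t (rho (inl i) k) * (c * y' i)).
      under [RHS]eq_bigr do rewrite mulr_sumr; rewrite exchange_big /=.
      rewrite (bigD1 l) //= [X in _ + X]big1 ?addr0 => [|i /negPf il].
        transitivity (t (\sum_k rho (inl l) k * mu k l) * (c * y' l)).
          by rewrite muE eqxx mulr1 mulrA.
        by rewrite rmorph_sum mulr_suml; apply: eq_bigr => k _; rewrite rmorphM; ring.
      transitivity (t (\sum_k rho (inl i) k * mu k l) * (c * y' i)); last first.
        by rewrite muE il mulr0 rmorph0 mul0r.
      by rewrite rmorph_sum mulr_suml; apply: eq_bigr => k _; rewrite rmorphM; ring.
    apply: eq_bigr => k _; rewrite rmorphN mulNr -mulrN; congr (_ * _).
    by apply/eqP; rewrite -addr_eq0; have := relE k; rewrite big_sumType /= => ->.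
  apply: spanned_sum => k; apply: spannedZ.
  by exists (fun i => rho (inr i) k).
exists 'I_r, y'; split=> //.
have /choice[d dP] : forall k, exists d, d != 0 /\ forall l, spanned t y' (unit_ideal D) (t d * x' k * y' l).
  by move=> k; have [d d0 h] := act (x' k); exists d.
exists ((\prod_k d k) * s); first by rewrite mulf_neq0 //; apply/prodf_neq0 => k _; have [] := dP k.
have [mu [mu1 mu2]] := pushout_lift po (u' := (idfun : {rmorphism C -> C})) (v' := idfun) (fun=> erefl).
have muE : mu E = 1.
  rewrite diag_morph (eq_diag _ _ mu1 mu2); exact: (diag_same sep (idfun : {rmorphism C -> C})).
have -> : t (\prod_k d k * s) = \sum_k t (\prod_(i | i != k) d i) * (t (d k) * x' k * y' k).
  have := congr1 mu sE; rewrite rmorphM muE mulr1 -[LHS]/((mu \o X1) _) mu1 rmorph_sum /= => tsE.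
  rewrite rmorphM tsE mulr_sumr; apply: eq_bigr => k _.
  rewrite rmorphM -[mu (X1 _)]/((mu \o X1) _) mu1 -[mu (X2 _)]/((mu \o X2) _) mu2 /=.
  by rewrite (bigD1 k) //= rmorphM; ring.
by apply: spanned_sum => k; apply: spannedZ; have [_] := dP k; apply.
Qed.

Lemma spanned_mono (D C : comPzRingType) (t : {rmorphism D -> C}) (L : finType) (g : L -> C)
    (z : C) (c : L -> D) : z = \sum_l t (c l) * g l -> spanned t g (unit_ideal D) z.
Proof. by move=> ->; exists c. Qed.

(** The products of the generators serve for an algebra generated by copies of [C]. *)
Lemma generically_finite_power (D : idomainType) (C V : comPzRingType)
    (t : {rmorphism D -> C}) (tV : {rmorphism D -> V}) m (X : 'I_m -> {rmorphism C -> V}) :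
  (forall i, X i \o t =1 tV) ->
  (forall Q : V -> Prop, (forall a, Q (tV a)) -> (forall i c, Q (X i c)) ->
    (forall s r, Q s -> Q r -> Q (s + r)) -> (forall s r, Q s -> Q r -> Q (s * r)) ->
    forall z, Q z) ->
  generically_finite t -> generically_finite tV.
Proof.
move=> Xt ind [L [g [[s s0 [a [_ sE]]] act]]].
pose h (al : {ffun 'I_m -> L}) : V := \prod_i X i (g (al i)).
exists {ffun 'I_m -> L}, h; split.
  exists (s ^+ m); first by rewrite expf_neq0.
  apply: (spanned_mono (c := fun al : {ffun 'I_m -> L} => \prod_i a (al i))).
  transitivity (\prod_(i < m) \sum_l tV (a l) * X i (g l)).
    rewrite rmorphXn -[in LHS](card_ord m) -prodr_const; apply: eq_bigr => i _.
    rewrite -[LHS](Xt i) /= sE rmorph_sum; apply: eq_bigr => l _.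
    by rewrite rmorphM; congr (_ * _); apply: Xt.
  rewrite bigA_distr_bigA; apply: eq_bigr => al _ /=.
  by rewrite big_split rmorph_prod.
apply: ind => [b|i c|c c' [d d0 dE] [d' d0' dE']|c c' [d d0 dE] [d' d0' dE']].
- exists 1; rewrite ?oner_neq0 // => al; rewrite rmorph1 mul1r; apply: spannedZ.
  apply: (spanned_mono (c := fun be : {ffun 'I_m -> L} => (be == al)%:R)).
  rewrite (bigD1 al) //= eqxx rmorph1 mul1r big1 ?addr0 // => be /negPf ->.
  by rewrite rmorph0 mul0r.
- have [d d0 dE] := act c; exists d => // al.
  have [b [_ bE]] := dE (al i).
  pose upd l : {ffun 'I_m -> L} := [ffun j => if j == i then l else al j].
  have -> : tV d * X i c * h al = \sum_l tV (b l) * h (upd l).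
    rewrite /h (bigD1 i) //= mulrA.
    have -> : tV d * X i c * X i (g (al i)) = \sum_l tV (b l) * X i (g l).
      rewrite -[tV d](Xt i) /= -!(rmorphM (X i)) bE rmorph_sum; apply: eq_bigr => l _.
      by rewrite rmorphM; congr (_ * _); apply: Xt.
    rewrite mulr_suml; apply: eq_bigr => l _; rewrite -mulrA; congr (_ * _).
    rewrite [in RHS](bigD1 i) //= ffunE eqxx; congr (_ * _).
    by apply: eq_bigr => j /negPf ji; rewrite ffunE ji.
  apply: spanned_sum => l; apply: spannedZ.
  apply: (spanned_mono (c := fun be : {ffun 'I_m -> L} => (be == upd l)%:R)).
  rewrite (bigD1 (upd l)) //= eqxx rmorph1 mul1r big1 ?addr0 // => be /negPf ->.
  by rewrite rmorph0 mul0r.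
- exists (d * d'); first by rewrite mulf_neq0.
  move=> al; have -> : tV (d * d') * (c + c') * h al =
    tV d' * (tV d * c * h al) + tV d * (tV d' * c' * h al) by rewrite rmorphM; ring.
  by apply: spannedD; apply: spannedZ.
- exists (d * d'); first by rewrite mulf_neq0.
  move=> al; have [b [_ bE]] := dE' al.
  have -> : tV (d * d') * (c * c') * h al = \sum_be tV (b be) * (tV d * c * h be).
    transitivity (tV d * c * (tV d' * c' * h al)); first by rewrite rmorphM; ring.
    by rewrite bE mulr_sumr; apply: eq_bigr => be _; ring.
  by apply: spanned_sum => be; apply: spannedZ.
Qed.

(** The ideal usually written [x T], when [x] is a prime ideal of [A]. *)
Definition extended (A T : comPzRingType) (t : {rmorphism A -> T}) (x : A -> Prop) : ideal T :=
  ideal_span (fun z => exists2 a, x a & z = t a).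
Arguments extended : simpl never.

(** Where [s] does not vanish, an idempotent [w] that is zero in one fibre is
    torsion: there the algebra acts on a finitely generated module [M]
    containing a multiple of the unit, so if [w] is in [y V] then [w M] is in
    [y M], and the determinant trick kills [w M]. *)
Lemma generic_torsion (D : idomainType) (V : comPzRingType) (t : {rmorphism D -> V}) (w : V) :
  generically_finite t -> finite_type t -> w * w = w ->
  exists2 s, s != 0 & forall y : spec D, ~ y s -> extended t y w ->
    exists2 d, d != 0 & t d * w = 0.
Proof.
move=> [L [g [[s s0 sg] act]]] [I [h gen]] ww.
have /choice[d dP] : forall i, exists d, d != 0 /\ forall l, spanned t g (unit_ideal D) (t d * h i * g l).
  by move=> i; have [d d0 dE] := act (h i); exists d.
pose Dl := \prod_i d i.
have Dl0 : Dl != 0 by apply/prodf_neq0 => i _; have [] := dP i.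
have pow c : exists k, forall l, spanned t g (unit_ideal D) (t (Dl ^+ k) * c * g l).
  elim/gen: c => [a|i|c c' [k kE] [k' kE']|c c' [k kE] [k' kE']].
  - exists 0%N => l; rewrite rmorph1 mul1r; apply: spannedZ.
    apply: (spanned_mono (c := fun j => (j == l)%:R)).
    rewrite (bigD1 l) //= eqxx rmorph1 mul1r big1 ?addr0 // => j /negPf ->.
    by rewrite rmorph0 mul0r.
  - exists 1%N => l; have [_ /(_ l) dg] := dP i.
    have -> : t (Dl ^+ 1) * h i * g l = t (\prod_(j | j != i) d j) * (t (d i) * h i * g l).
      by rewrite expr1 /Dl (bigD1 i) //= rmorphM; ring.
    exact: spannedZ.
  - exists (k + k')%N => l; rewrite exprD rmorphM.
    have -> : t (Dl ^+ k) * t (Dl ^+ k') * (c + c') * g l = t (Dl ^+ k') * (t (Dl ^+ k) * c * g l) +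
      t (Dl ^+ k) * (t (Dl ^+ k') * c' * g l) by ring.
    by apply: spannedD; apply: spannedZ.
  - exists (k + k')%N => l; rewrite exprD rmorphM; have [b [_ bE]] := kE' l.
    have -> : t (Dl ^+ k) * t (Dl ^+ k') * (c * c') * g l =
        \sum_j t (b j) * (t (Dl ^+ k) * c * g j).
      transitivity (t (Dl ^+ k) * c * (t (Dl ^+ k') * c' * g l)); first by ring.
      by rewrite bE mulr_sumr; apply: eq_bigr => j _; ring.
    by apply: spanned_sum => j; apply: spannedZ.
exists (Dl * s) => [|y ys wy]; first by rewrite mulf_neq0.
have yDl : ~ y Dl by move=> yD; apply: ys; apply: ideal_mulr.
have [k kE] : exists k, forall l, spanned t g y (t (Dl ^+ k) * w * g l).
  elim: wy => [|_ [a ya ->]|b c _ [k kE] _ [k' kE']|b c _ [k' kE']].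
  - by exists 0%N => l; rewrite mulr0 mul0r; apply: spanned0.
  - exists 0%N => l; rewrite rmorph1 mul1r; exists (fun j => a * (j == l)%:R).
    split=> [j|]; first exact: ideal_mulr.
    rewrite (bigD1 l) //= eqxx mulr1 big1 ?addr0 // => j /negPf ->.
    by rewrite mulr0 rmorph0 mul0r.
  - exists (k + k')%N => l; rewrite exprD rmorphM.
    have -> : t (Dl ^+ k) * t (Dl ^+ k') * (b + c) * g l = t (Dl ^+ k') * (t (Dl ^+ k) * b * g l) +
      t (Dl ^+ k) * (t (Dl ^+ k') * c * g l) by ring.
    by apply: spannedD; apply: spannedZ.
  - have [k kE] := pow b; exists (k + k')%N => l; rewrite exprD rmorphM.
    have [a [ya aE]] := kE' l.
    have -> : t (Dl ^+ k) * t (Dl ^+ k') * (b * c) * g l =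
        \sum_j t (a j) * (t (Dl ^+ k) * b * g j).
      transitivity (t (Dl ^+ k) * b * (t (Dl ^+ k') * c * g l)); first by ring.
      by rewrite aE mulr_sumr; apply: eq_bigr => j _; ring.
    apply: spanned_sum => j; have [a' [_ ->]] := kE j.
    exists (fun l => a j * a' l); split=> [l'|]; first exact: ideal_mulr.
    by rewrite mulr_sumr; apply: eq_bigr => l' _; rewrite rmorphM mulrA.
have /choice[a aP] := kE.
pose N : 'M[D]_#|L| := \matrix_(i, j) a (enum_val i) (enum_val j).
pose M : 'M[D]_#|L| := (Dl ^+ k)%:M - N.
pose v : 'cV[V]_#|L| := \col_i (w * g (enum_val i)).
have Mv : map_mx t M *m v = 0.
  apply/colP => i; rewrite map_mxB map_scalar_mx mulmxBl mul_scalar_mx !mxE.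
  have [_ e] := aP (enum_val i); apply/eqP; rewrite subr_eq0; apply/eqP.
  transitivity (w * (t (Dl ^+ k) * w * g (enum_val i))); first by rewrite -{1}ww; ring.
  rewrite e mulr_sumr (reindex_onto (@enum_val L L) enum_rank) /=.
    by apply: eq_big => [j|j _]; rewrite ?enum_valK ?eqxx // !mxE; ring.
  by move=> j _; apply: enum_rankK.
have Mw l : t (\det M) * (w * g l) = 0.
  have : (\adj (map_mx t M) *m (map_mx t M *m v)) (enum_rank l) 0 = 0 by rewrite Mv mulmx0 mxE.
  by rewrite mulmxA mul_adj_mx mul_scalar_mx det_map_mx !mxE enum_rankK.
have yM : ~ y (\det M).
  move=> /quot_pi0; rewrite -det_map_mx map_mxB map_scalar_mx.
  have -> : map_mx (quot_pi y) N = 0.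
    apply/matrixP => i j; rewrite !mxE; apply/quot_pi0.
    by have [h' _] := aP (enum_val i); apply: h'.
  rewrite subr0 det_scalar -rmorphXn -exprM => /quot_pi0.
  elim: (k * _)%N => [|n IH]; first by rewrite expr0; apply: prime_proper.
  by rewrite exprS => /prime_mul[].
have M0 : \det M != 0 by apply/eqP => e; apply: yM; rewrite e; apply: ideal0.
exists (\det M * s); first by rewrite mulf_neq0.
have [b [_ bE]] := sg.
rewrite rmorphM bE mulr_sumr mulr_suml big1 // => l _.
transitivity (t (b l) * (t (\det M) * (w * g l))); first by ring.
by rewrite Mw mulr0.
Qed.

(** * Geometric fibres *)

Lemma spec_ext (A : comPzRingType) (x y : spec A) : (forall a, x a <-> y a) -> x = y.
Proof.
case: x y => [[I I0 ID IM] I1 Ip] [[J J0 JD JM] J1 Jp] /= IJ.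
have e : I = J by apply: funext => a; apply/propext/IJ.
subst J; have e0 : I0 = J0 by apply: Prop_irrelevance.
have eD : ID = JD by apply: Prop_irrelevance.
have eM : IM = JM by apply: Prop_irrelevance.
subst J0 JD JM; have e1 : I1 = J1 by apply: Prop_irrelevance.
by subst J1; congr Spec; apply: Prop_irrelevance.
Qed.

Lemma residue0 (A : comPzRingType) (x : spec A) a : residue x a = 0 <-> x a.
Proof.
rewrite -(quot_pi0 x); split=> [/eqP|h]; last by rewrite /residue h tofrac0.
by rewrite /residue tofrac_eq0 => /eqP.
Qed.

(** A separable flat algebra over an algebraically closed field is finite, so
    its elements act on the residue field at [q] with eigenvalues in [K]. *)
Lemma prime_rational (K : closedFieldType) (C : comPzRingType) (v : {rmorphism K -> C})
    (I : finType) (x y : I -> C) (q : spec C) :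
  flat v -> separability v x y ->
  exists a : {rmorphism C -> K}, (forall k, a (v k) = k) /\ forall c, q c <-> a c = 0.
Proof.
move=> fl sep.
have [L [g [[s s0 [b [_ sE]]] act]]] := separable_generically_finite fl sep.
(* [N] is the matrix of the multiplication by [c] on the generators [g], whose
   images in the residue field form an eigenvector. *)
have eig c : exists k, q (c - v k).
  have [d d0 /choice[n nE]] := act c.
  pose N : 'M[K]_#|L| := \matrix_(i, j) (n (enum_val j) (enum_val i) / d).
  pose w : {rmorphism K -> residue_field q} := residue q \o v.
  pose z : 'rV[residue_field q]_#|L| := \row_i residue q (g (enum_val i)).
  have z0 : z != 0.
    apply/eqP => z0; have : w s != 0 by rewrite fmorph_eq0.
    rewrite /w /= sE rmorph_sum big1 ?eqxx // => l _; rewrite rmorphM.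
    have : z 0 (enum_rank l) = 0 by rewrite z0 mxE.
    by rewrite mxE enum_rankK => gl; rewrite [X in _ * X]gl mulr0.
  have zN : z *m map_mx w N = residue q c *: z.
    apply/rowP => j; rewrite !mxE -rmorphM.
    have wd : w d != 0 by rewrite fmorph_eq0.
    apply: (mulfI wd).
    have -> : w d * residue q (c * g (enum_val j)) = residue q (v d * c * g (enum_val j)).
      by rewrite -mulrA [RHS]rmorphM.
    have [_ ->] := nE (enum_val j).
    rewrite rmorph_sum mulr_sumr [RHS](reindex_onto (@enum_val L L) enum_rank) /=.
      apply: eq_big => [i|i _]; rewrite ?enum_valK ?eqxx // !mxE.
      by rewrite [RHS]rmorphM mulrCA -(rmorphM w) [d * _]mulrC mulfVK // mulrC.
    by move=> i _; apply: enum_rankK.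
  have : eigenvalue (map_mx w N) (residue q c) by apply/eigenvalueP; exists z.
  rewrite eigenvalue_root_char -map_char_poly.
  have [rs ->] := closed_field_poly_normal (char_poly N).
  rewrite (monicP (char_poly_monic N)) scale1r rmorph_prod.
  under eq_bigr do rewrite rmorphB /= map_polyX map_polyC.
  rewrite -(big_map w xpredT (fun k => 'X - k%:P)) root_prod_XsubC => /mapP[k _ ck].
  exists k; apply/residue0; rewrite rmorphB; apply/eqP; rewrite subr_eq0; exact/eqP.
have qv k : q (v k) -> k = 0.
  move=> qk; apply/eqP; apply: contrapT => /negP k0; apply: (prime_proper (s := q)).
  by rewrite -(rmorph1 v) -(mulVf k0) rmorphM; apply: idealM.
have /choice[a aP] := eig.
have aE c k : q (c - v k) -> a c = k.
  move=> ck; apply/eqP; rewrite -subr_eq0; apply/eqP/qv; rewrite rmorphB.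
  have -> : v (a c) - v k = (c - v k) - (c - v (a c)) by ring.
  exact: idealB.
have aB : zmod_morphism a.
  move=> c c'; apply: aE; rewrite rmorphB.
  have -> : c - c' - (v (a c) - v (a c')) = (c - v (a c)) - (c' - v (a c')) by ring.
  exact: idealB.
have aM : monoid_morphism a.
  split=> [|c c']; apply: aE; first by rewrite rmorph1 subrr; apply: ideal0.
  have -> : c * c' - v (a c * a c') = c * (c' - v (a c')) + v (a c') * (c - v (a c)).
    by rewrite rmorphM; ring.
  by apply: idealD; apply: idealM.
pose aA := GRing.isZmodMorphism.Build C K a aB.
pose aA' := GRing.isMonoidMorphism.Build C K a aM.
exists (HB.pack a aA aA' : {rmorphism C -> K}); split=> [k|c] /=.
  by apply: aE; rewrite subrr; apply: ideal0.
split=> [qc|ac]; last by have := aP c; rewrite ac rmorph0 subr0.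
by apply: aE; rewrite rmorph0 subr0.
Qed.

(** All the primes of the geometric fibre are rational by [prime_rational], so its
    points are morphisms to [K]. A family of more than [n] points with values in
    a domain has two equal members by the pigeonhole principle, so [omega] is
    zero on it; flatness brings this down to the extension of [x]. *)
Lemma geometric_points (A B A0 B0 : comPzRingType) (e : {rmorphism A -> B})
    (f : {rmorphism A0 -> A}) (e0 : {rmorphism A0 -> B0}) (f' : {rmorphism B0 -> B})
    (I : finType) (xs ys : I -> B0) (x : spec A) n :
  is_pushout f e0 e f' -> flat e0 -> separability e0 xs ys -> geometric_fiber_card e x n ->
  exists (K : fieldType) (th : {rmorphism A -> K}) (a : 'I_n -> {rmorphism B0 -> K}),
    [/\ forall c, th c = 0 <-> x c, forall i, a i \o e0 =1 th \o f,
        forall i j, i != j -> exists b, a i b != a j b &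
        forall m (T : comPzRingType) (t : {rmorphism A0 -> T}) (X : 'I_m -> {rmorphism B0 -> T}),
          is_power e0 t X -> flat t -> (n < m)%N -> extended t (comap f x) (omega xs ys X)].
Proof.
move=> po fl sep [K [j [C [u [v [_ poC cardC]]]]]].
pose th : {rmorphism A -> K} := j \o residue x.
have th0 c : th c = 0 <-> x c.
  rewrite -residue0; split=> [/eqP|h]; last by rewrite /th /= h rmorph0.
  by rewrite /th /= fmorph_eq0 => /eqP.
have po' : is_pushout (th \o f : {rmorphism _ -> _}) e0 v (u \o f' : {rmorphism _ -> _}).
  exact/pushout_sym/(pushout_paste (pushout_sym po))/poC.
have flv := flat_base_change po' fl; have sepv := separability_base_change po' sep.
have /card_set_bijP[num [numT num_inj num_surj]] := cardC.
have num_inj' q q' : num q = num q' -> q = q'.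
  by apply: num_inj; apply/mem_set.
have numP q : (num q < n)%N by apply: numT.
have /choice[F FE] : forall i : 'I_n, exists q, num q = i.
  by move=> i; have [q _ qi] := num_surj i (ltn_ord i); exists q.
have /choice[al alP] := fun q => prime_rational q flv sepv.
exists K, th, (fun i => al (F i) \o (u \o f') : {rmorphism _ -> _}); split=> //.
- move=> i b /=; have [alv _] := alP (F i).
  by rewrite -(pushout_glue po) (pushout_glue poC) alv.
- move=> i i' ii'; apply: contrapT => nb; case/eqP: ii'; apply: val_inj => /=.
  rewrite -!FE; congr num; apply: spec_ext => c.
  have [alv ->] := alP (F i); have [alv' ->] := alP (F i').
  suff -> : al (F i) c = al (F i') c by [].
  apply: (pushout_ext po' (g := al (F i)) (g' := al (F i'))) => [k|b].
    by rewrite alv alv'.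
  by apply/eqP; apply: contrapT => /negP h; apply: nb; exists b.
move=> m T t X pw flt nm.
have [V [uV [vV poV]]] := pushout_exists (th \o f : {rmorphism _ -> _}) t.
have [Xt _ _] := pw.
have XX (i i' : 'I_m) : X i \o e0 =1 X i' \o e0 by move=> b; rewrite Xt [RHS]Xt.
have w0 : vV (omega xs ys X) = 0.
  suff : (ideal_span (fun z : V => False)) (vV (omega xs ys X)).
    by elim=> [//|//|r s _ -> _ ->|r s _ ->]; rewrite ?addr0 ?mulr0.
  apply: idempotent_in_ideal => [|Q _].
    by rewrite -rmorphM (omega_idem sep XX).
  pose pi : {rmorphism V -> residue_domain Q} := quot_pi Q.
  have /choice[Y YE] : forall i, exists Y : {rmorphism C -> residue_domain Q},
      Y \o v =1 pi \o uV /\ Y \o (u \o f') =1 pi \o (vV \o X i).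
    move=> i; apply: (pushout_lift po' (u' := (pi \o uV : {rmorphism _ -> _}))
      (v' := (pi \o (vV \o X i) : {rmorphism _ -> _}))) => b /=.
    by rewrite (pushout_glue poV) -[t b](Xt i).
  pose h (i : 'I_m) : 'I_n := Ordinal (numP (kernel_point (Y i))).
  have /injectivePn[i [i' ii' hii']] : ~~ injectiveb h.
    apply/negP => /injectiveP/leq_card; rewrite !card_ord leqNgt.
    by rewrite nm.
  apply/quot_pi0; rewrite -[quot_pi Q _]/(pi (vV _)) !omega_morph.
  apply: (omega_coincide (e := e0) (Y := fun i => (pi \o vV) \o X i : {rmorphism _ -> _}) sep ii') => b /=.
  have /num_inj' qq : num (kernel_point (Y i)) = num (kernel_point (Y i')) by case: hii'.
  have YaE (k : 'I_m) c : Y k c = pi (uV (al (kernel_point (Y k)) c)).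
    have [yv _] := YE k; rewrite -[RHS]yv /=; apply/eqP; rewrite -subr_eq0 -rmorphB; apply/eqP.
    have [alv kal] := alP (kernel_point (Y k)).
    by apply/(kal _); rewrite rmorphB alv subrr.
  have [_ yu] := YE i; have [_ yu'] := YE i'.
  by rewrite -[LHS]yu -[RHS]yu' /= !YaE qq.
have [|J [rho [m' [wE rhoE]]]] := flat_annihilator (b := 1) (n := omega xs ys X) flt poV.
  by rewrite w0 mulr0.
rewrite wE; apply: ideal_sum => k _; rewrite mulrC; apply: idealM; apply: span_gen.
exists (rho k) => //; apply/th0.
by have := rhoE k; rewrite mulr1.
Qed.

(** * Openness of the locus of points with many preimages *)

Lemma extended_map (A A' T T' : comPzRingType) (t : {rmorphism A -> T}) (t' : {rmorphism A' -> T'})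
    (f : {rmorphism A -> A'}) (phi : {rmorphism T -> T'}) (x : A -> Prop) (x' : A' -> Prop) z :
  phi \o t =1 t' \o f -> (forall a, x a -> x' (f a)) -> extended t x z -> extended t' x' (phi z).
Proof.
move=> phit xx'; elim=> [|_ [a xa ->]|b c _ xb _ xc|b c _ xc].
- by rewrite rmorph0; apply: ideal0.
- by rewrite [phi _]phit; apply: span_gen; exists (f a) => //; apply: xx'.
- by rewrite rmorphD; apply: idealD.
- by rewrite rmorphM; apply: idealM.
Qed.

Lemma extended_prime (A T : comPzRingType) (t : {rmorphism A -> T}) (x : A -> Prop)
    (q : ideal T) z : (forall a, x a -> q (t a)) -> extended t x z -> q z.
Proof. by move=> xq; apply: span_min => _ [a xa ->]; apply: xq. Qed.

Definition ideal_adjoin (A : comPzRingType) (J : ideal A) (a : A) : ideal A :=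
  ideal_span (fun z => J z \/ z = a).

Lemma adjoin_sub (A : comPzRingType) (J I : ideal A) a :
  (forall b, J b -> I b) -> I a -> forall b, ideal_adjoin J a b -> I b.
Proof. by move=> JI Ia; apply: span_min => _ [/JI//|->]. Qed.

Section Open.
Variables (A B : comPzRingType) (e : {rmorphism A -> B}) (I : finType) (xs ys : I -> B).
Hypothesis nA : noetherian A.
Hypothesis fle : flat e.
Hypothesis fte : finite_type e.
Hypothesis sep : separability e xs ys.
Variables (m : nat) (T : comPzRingType) (t : {rmorphism A -> T}) (X : 'I_m -> {rmorphism B -> T}).
Hypothesis pw : is_power e t X.
Hypothesis flt : flat t.
Let w := omega xs ys X.

Let XX i j : X i \o e =1 X j \o e.
Proof. by have [Xt _ _] := pw; move=> a; rewrite Xt [RHS]Xt. Qed.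

(** Over the domain [A/J] the tensor power is generically finite. If [w] were zero
    in the fibre at a general point of the closure of [J], it would be torsion
    over [A/J], hence, by flatness, zero in the fibre at [J]. *)
Lemma omega_generic (J : spec A) : ~ extended t J w ->
  exists2 s, ~ J s & forall y : spec A, (forall a, J a -> y a) -> ~ y s -> ~ extended t y w.
Proof.
move=> Jw; pose D : idomainType := residue_domain J.
pose pi : {rmorphism A -> D} := quot_pi J.
have [C [c [v poC]]] := pushout_exists pi e.
have [V [tV [vV poV]]] := pushout_exists pi t.
have /choice[X' X'P] : forall i, exists X' : {rmorphism C -> V}, X' \o c =1 tV /\ X' \o v =1 vV \o X i.
  move=> i; apply: (pushout_lift poC (v' := (vV \o X i : {rmorphism _ -> _}))) => a /=.
  by rewrite (pushout_glue poV); have [Xt _ _] := pw; rewrite -[t a](Xt i).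
have [_ _ ind] := pw.
have gfV : generically_finite tV.
  apply: (@generically_finite_power _ C V c tV m X'); first by move=> i; have [] := X'P i.
    move=> Q Qt QX QD QM; apply: (pushout_ind poV) => // z.
    elim/ind: z => [a|i b|r s Qr Qs|r s Qr Qs].
    - by rewrite -(pushout_glue poV).
    - by have [_ h] := X'P i; rewrite -[vV _]h; apply: QX.
    - by rewrite rmorphD; apply: QD.
    - by rewrite rmorphM; apply: QM.
  exact: separable_generically_finite (flat_base_change poC fle) (separability_base_change poC sep).
have ftV : finite_type tV.
  have [K [g gen]] := fte; exists ('I_m * K)%type, (fun ik => vV (X ik.1 (g ik.2))).
  move=> Q Qt Qg QD QM; apply: (pushout_ind poV) => // z.
  elim/ind: z => [a|i b|r s Qr Qs|r s Qr Qs].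
  - by rewrite -(pushout_glue poV).
  - elim/gen: b => [a|k|r s Qr Qs|r s Qr Qs].
    + by have [Xt _ _] := pw; rewrite -[X i _]/((X i \o e) a) Xt -(pushout_glue poV).
    + exact: (Qg (i, k)).
    + by rewrite !rmorphD; apply: QD.
    + by rewrite !rmorphM; apply: QM.
  - by rewrite rmorphD; apply: QD.
  - by rewrite rmorphM; apply: QM.
have [|s s0 sP] := generic_torsion (w := vV w) gfV ftV.
  by rewrite -rmorphM (omega_idem sep XX).
have [s' s'E] := quot_piP s; exists s'.
  by move=> /quot_pi0 h; move: s0; rewrite s'E; apply/negP/negPn/eqP.
move=> y Jy ys' yw.
have [|g gE] := @quot_factorP A (residue_domain y) J (quot_pi y).
  by move=> a /Jy /quot_pi0.
have [||d d0 dw] := sP (kernel_point (g : {rmorphism D -> residue_domain y})).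
- by rewrite /= s'E gE => /quot_pi0.
- apply: (extended_map (t := t) (f := pi) (x := y)) yw => [a|a /quot_pi0 ya] /=.
    by rewrite (pushout_glue poV).
  by rewrite [g _]gE.
have [K [rho [l [wE rhoE]]]] := flat_annihilator flt poV dw.
apply: Jw; rewrite wE; apply: ideal_sum => k _; rewrite mulrC; apply: idealM.
apply: span_gen; exists (rho k) => //; apply/quot_pi0/eqP.
by have /eqP := rhoE k; rewrite mulf_eq0 (negPf d0) orbF.
Qed.

(** Noetherian induction: if the locus were not a neighbourhood of [x], take an
    ideal [J] maximal among those whose zero set has, in each neighbourhood of
    [x], a point outside the locus. It is prime and contained in [x], hence in
    the locus, and so is an open part of its zero set. *)
Lemma omega_neighbourhood (x : spec A) : ~ extended t x w ->
  exists2 f, ~ x f & forall y : spec A, extended t y w -> y f.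
Proof.
move=> xw; apply: contrapT => nf.
pose P (J : ideal A) := forall f, ~ x f ->
  exists y : spec A, [/\ extended t y w, forall a, J a -> y a & ~ y f].
have [|J [PJ maxJ]] := @noetherian_maximal A P nA.
  exists (ideal_span (fun=> False)) => f xf; apply: contrapT => ny; apply: nf; exists f => // y yw.
  apply: contrapT => yf; apply: ny; exists y; split=> //.
  by apply: span_min.
have Jx a : J a -> x a.
  by move=> Ja; apply: contrapT => xa; have [y [_ Jy]] := PJ a xa; apply; apply: Jy.
have J1 : ~ J 1 by move=> /Jx; apply: prime_proper.
have outJ a : ~ J a -> exists2 f, ~ x f & forall y : spec A, extended t y w ->
    (forall b, J b -> y b) -> y a -> y f.
  move=> Ja; have nP : ~ P (ideal_adjoin J a).
    move=> /maxJ h; apply/Ja/h => [b Jb|]; first by apply: span_gen; left.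
    by apply: span_gen; right.
  apply: contrapT => nf'; apply: nP => f xf; apply: contrapT => ny; apply: nf'.
  exists f => // y yw Jy ya; apply: contrapT => yf; apply: ny; exists y; split=> //.
  exact: adjoin_sub.
have JM a b : J (a * b) -> J a \/ J b.
  move=> Jab; apply: contrapT => /not_orP[/outJ[f xf fP] /outJ[g xg gP]].
  have [|y [yw Jy yfg]] := PJ (f * g); first by move=> /prime_mul[].
  by apply: yfg; have /prime_mul[ya|yb] := Jy _ Jab; [apply/ideal_mulr/fP|apply/idealM/gP].
have [|s Js sP] := @omega_generic (Spec J1 JM).
  move=> Jw; apply: xw; move: Jw; rewrite -[w in X in _ -> X]/(idfun w).
  by apply: (extended_map (t' := t) (f := (idfun : {rmorphism A -> A}))
    (phi := (idfun : {rmorphism T -> T}))) => [//|a /Jx].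
have [f xf fP] := outJ s Js; have [y [yw Jy yf]] := PJ f xf.
by apply: (sP y) => // ys'; apply: yf; apply: fP.
Qed.

Lemma omega_open : open [set y : spec A | ~ extended t y w]%classic.
Proof.
apply/spec_openE; exists [set f | forall y : spec A, extended t y w -> y f]%classic.
apply/seteqP; split=> x /=; first by move=> /omega_neighbourhood[f xf fP] /(_ f fP).
by move=> h xw; apply: h => f; apply.
Qed.

End Open.

(** * Symmetric functions on the space of orderings of the fibres *)

Section Symmetric.
Variables (A B : comPzRingType) (e : {rmorphism A -> B}) (I : finType) (xs ys : I -> B).
Hypothesis sep : separability e xs ys.
Variables (n : nat) (T : comPzRingType) (t : {rmorphism A -> T}) (X : 'I_n -> {rmorphism B -> T}).
Hypothesis pw : is_power e t X.
Hypothesis flt : flat t.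
Let w := omega xs ys X.

Let Xt i : X i \o e =1 t. Proof. by have [h _ _] := pw. Qed.
Let XX i j : X i \o e =1 X j \o e.
Proof. by move=> a; rewrite Xt [RHS]Xt. Qed.
Let ww : w * w = w. Proof. exact: (omega_idem sep XX). Qed.

Lemma permutation_action : exists tau : 'S_n -> {rmorphism T -> T},
  forall s, tau s \o t =1 t /\ forall i, tau s \o X i =1 X (s i).
Proof.
suff /choice[tau tauP] : forall s : 'S_n, exists tau : {rmorphism T -> T},
    tau \o t =1 t /\ forall i, tau \o X i =1 X (s i) by exists tau.
by move=> s; have [_ univ _] := pw; apply: (univ T t (fun i => X (s i))).
Qed.

Variable tau : 'S_n -> {rmorphism T -> T}.
Hypothesis tauP : forall s, tau s \o t =1 t /\ forall i, tau s \o X i =1 X (s i).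

Let tau_t s a : tau s (t a) = t a. Proof. by have [h _] := tauP s; apply: h. Qed.
Let tau_X s i b : tau s (X i b) = X (s i) b. Proof. by have [_ h] := tauP s; apply: h. Qed.

Let tauM s s' z : tau s' (tau s z) = tau (s * s')%g z.
Proof.
rewrite -[LHS]/((tau s' \o tau s) z); apply: (power_ext pw) => [a|i b] /=.
  by rewrite !tau_t.
by rewrite !tau_X permM.
Qed.

Definition symmetric z := forall s, tau s z = z.

Lemma omega_symmetric : symmetric w.
Proof.
move=> s; rewrite omega_morph /w /omega [RHS](reindex (fun ij : 'I_n * 'I_n => (s ij.1, s ij.2))) /=.
  apply: eq_big => [[i j]|[i j] _] /=; first by rewrite (inj_eq perm_inj).
  by rewrite (eq_diag _ _ (Z1 := X (s i)) (Z2 := X (s j))) // => b /=; rewrite tau_X.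
by exists (fun ij => ((s^-1)%g ij.1, (s^-1)%g ij.2)) => -[i j] _ /=; rewrite ?permK ?permKV.
Qed.

Section Coincidence.
Hypothesis noMore : forall (V : comPzRingType) (Y : 'I_n.+1 -> {rmorphism B -> V}),
  (forall i j, Y i \o e =1 Y j \o e) -> omega xs ys Y = 0.
Variables (V : comPzRingType) (i1 i2 : {rmorphism T -> V}).
Hypothesis glue : i1 \o t =1 i2 \o t.

(** Over a point whose fibre has exactly [n] points, any two orderings of the
    fibre differ by a permutation. Algebraically: at a prime [q] of [V] that is
    in the locus of the two orderings, each coordinate of the second one must
    coincide with one of the first, as there is no room for [n.+1] points. *)
Lemma symmetric_coincide s : symmetric s -> (i1 s - i2 s) * (i1 w * i2 w) = 0.
Proof.
move=> sym; set d := _ * _.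
have a0 : (fun z => z * d = 0) 0 by rewrite mul0r.
have aD y z : y * d = 0 -> z * d = 0 -> (y + z) * d = 0.
  by move=> yd zd; rewrite mulrDl yd zd addr0.
have aM y z : z * d = 0 -> (y * z) * d = 0 by move=> zd; rewrite -mulrA zd mulr0.
pose an := @Ideal V (fun z => z * d = 0) a0 aD aM.
apply: contrapT => d0; have [|q anq] := @prime_over _ an; first by rewrite /= mul1r.
have qN z : q (1 - z) -> ~ q z.
  move=> q1 qz; apply: (prime_proper (s := q)); rewrite -[1](subrK z); exact: idealD.
have q1 : ~ q (i1 w).
  apply/qN/anq => /=.
  have -> : (1 - i1 w) * d = (i1 s - i2 s) * i2 w * (i1 w - i1 w * i1 w) by rewrite /d; ring.
  by rewrite -rmorphM ww subrr mulr0.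
have q2 : ~ q (i2 w).
  apply/qN/anq => /=.
  have -> : (1 - i2 w) * d = (i1 s - i2 s) * i1 w * (i2 w - i2 w * i2 w) by rewrite /d; ring.
  by rewrite -rmorphM ww subrr mulr0.
pose Y1 i : {rmorphism B -> V} := i1 \o X i.
pose Y2 i : {rmorphism B -> V} := i2 \o X i.
have Y1t i a : Y1 i (e a) = i1 (t a) by congr (i1 _); apply: Xt.
have Y2t i a : Y2 i (e a) = i1 (t a) by rewrite [RHS]glue /=; congr (i2 _); apply: Xt.
have Y11 i j : Y1 i \o e =1 Y1 j \o e by move=> a; rewrite [LHS]Y1t [RHS]Y1t.
have Y12 i j : Y1 i \o e =1 Y2 j \o e by move=> a; rewrite [LHS]Y1t [RHS]Y2t.
have Y21 i j : Y2 i \o e =1 Y1 j \o e by move=> a; rewrite [LHS]Y2t [RHS]Y1t.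
have Y22 i j : Y2 i \o e =1 Y2 j \o e by move=> a; rewrite [LHS]Y2t [RHS]Y2t.
pose eps i j := diag xs ys (Y1 i) (Y2 j).
(* The family [Y] made of the first ordering and of the [j]-th coordinate of the
   second one has [n.+1] members. *)
have /choice[f fP] : forall j, exists i, ~ q (eps i j).
  move=> j; pose Y (k : 'I_n.+1) := if unlift ord_max k is Some i then Y1 i else Y2 j.
  have YY : forall k l, Y k \o e =1 Y l \o e.
    by move=> k l; rewrite /Y; case: (unlift _ k) (unlift _ l) => [i|] [i'|].
  have Y0 := noMore YY; apply: contrapT => nf.
  have qe i : q (eps i j) by apply: contrapT => h; apply: nf; exists i.
  suff : ~ q (omega xs ys Y) by rewrite Y0; apply; apply: ideal0.
  have qB z : q z -> ~ q (1 - z) by move=> qz /qN.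
  apply: prime_prod => -[k l] /=; rewrite /Y => kl; apply: qB.
  case: unliftP kl => [i ->|->]; case: unliftP => [i' ->|->].
  - move=> ii'; have := omega_diag sep XX (_ : i != i'); rewrite (inj_eq lift_inj) in ii'.
    move=> /(_ ii')/(congr1 i1); rewrite rmorph0 rmorphM diag_morph => h.
    by have : q 0 := ideal0 q; rewrite -h => /prime_mul[].
  - by move=> _; apply: qe.
  - by move=> _; rewrite (diag_sym sep) //; apply: qe.
  - by rewrite eqxx.
have f_inj : injective f.
  move=> j j' ff; apply/eqP; apply: contrapT => /negP jj'.
  have h : eps (f j) j * eps (f j) j' * i2 w = 0.
    rewrite /eps (diag_sym sep (Y12 _ j)) (diag_sym sep (Y12 _ j')).
    rewrite (diag_subst sep (Y21 _ _)) mulrC mulrCA.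
    have jj'' : j' != j by rewrite eq_sym.
    have := congr1 i2 (omega_diag sep XX jj''); rewrite rmorph0 rmorphM diag_morph => ->.
    by rewrite mulr0.
  have : q 0 := ideal0 q; rewrite -h => /prime_mul[/prime_mul[]|//]; first exact: fP.
  by rewrite ff; apply: fP.
pose sg := perm f_inj; pose E := \prod_j eps (f j) j.
have qE : ~ q E by apply: prime_prod => j _; apply: fP.
have [_ _ ind] := pw.
have EP z : E * (i2 z - i1 (tau sg z)) = 0.
  elim/ind: z => [a|j b|y z yE zE|y z yE zE].
  - by rewrite tau_t -[i2 _]glue subrr mulr0.
  - rewrite tau_X permE /E (bigD1 j) //= mulrAC mulrBr.
    by rewrite -[i2 _]/(Y2 j b) -(diag_comm sep (Y12 _ _)) subrr mul0r.
  - by rewrite !rmorphD opprD addrACA mulrDr yE zE addr0.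
  - rewrite !rmorphM; set y1 := i1 _ in yE *; set y2 := i2 _ in yE *.
    set z1 := i1 _ in zE *; set z2 := i2 _ in zE *.
    have -> : E * (y2 * z2 - y1 * z1) = y2 * (E * (z2 - z1)) + z1 * (E * (y2 - y1)) by ring.
    by rewrite yE zE !mulr0 addr0.
apply/qE/anq => /=; rewrite /d mulrA.
have -> : E * (i1 s - i2 s) = - (E * (i2 s - i1 (tau sg s))) by rewrite sym; ring.
by rewrite EP oppr0 mul0r.
Qed.

End Coincidence.

(** Flat descent: the relation of [symmetric_coincide] in the tensor square of [T]
    has coefficients in [A] behind it, one of which is a unit at [x]. *)
Lemma symmetric_descent s (x : spec A) :
  (forall (V : comPzRingType) (Y : 'I_n.+1 -> {rmorphism B -> V}),
    (forall i j, Y i \o e =1 Y j \o e) -> omega xs ys Y = 0) ->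
  symmetric s -> ~ extended t x w -> exists r a, ~ x r /\ t r * s * w = t a * w.
Proof.
move=> noMore sym xw; have [V [i1 [i2 po]]] := pushout_exists t t.
have glue : i1 \o t =1 i2 \o t by have [] := po.
have d0 := symmetric_coincide noMore glue sym.
pose b (z : bool) := if z then w * s else - w.
pose m (z : bool) := if z then w else w * s.
have rel : \sum_z i1 (b z) * i2 (m z) = 0.
  rewrite big_bool /= -[RHS]d0 rmorphN !rmorphM; ring.
have [K [rho [l [lE rhoE]]]] := flt po rel.
have [k xk] : exists k, ~ x (rho true k).
  apply: contrapT => nk; apply: xw; rewrite -[w]/(m true) lE.
  apply: ideal_sum => k _; rewrite mulrC; apply: idealM; apply: span_gen.
  by exists (rho true k) => //; apply: contrapT => h; apply: nk; exists k.
exists (rho true k), (rho false k); split=> //.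
have := rhoE k; rewrite big_bool /= mulrN => /eqP; rewrite subr_eq0 => /eqP <-.
by rewrite [w * s]mulrC mulrA.
Qed.

(** The norm over the symmetric group of an expression of [w] with coefficients
    in an ideal [J] of [A]; the terms are grouped according to the product of
    their coefficients, which makes the groups stable under permutations. *)
Lemma symmetric_norm (J : ideal A) : extended t J w ->
  exists (L : finType) (F : L -> A) (s : L -> T),
    [/\ forall l, J (F l), forall l, symmetric (s l) & w = \sum_l t (F l) * s l].
Proof.
move=> Jw; have [K [f [c [Jf wE]]]] : exists (K : finType) (f : K -> A) (c : K -> T),
    (forall k, J (f k)) /\ w = \sum_k t (f k) * c k.
  elim: Jw => [|_ [a Ja ->]|y z _ [K [f [c [Jf ->]]]] _ [K' [f' [c' [Jf' ->]]]]|y z _ [K [f [c [Jf ->]]]]].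
  - by exists void, (of_void _), (of_void _); split=> [[]|]; rewrite big1 // => -[].
  - by exists unit, (fun=> a), (fun=> 1); split=> //; rewrite (big_pred1 tt) ?mulr1 // => -[].
  - exists (K + K')%type, (fun x => match x with inl k => f k | inr k => f' k end).
    exists (fun x => match x with inl k => c k | inr k => c' k end).
    by split=> [[]//|]; rewrite big_sumType.
  - exists K, f, (fun k => y * c k); split=> //.
    by rewrite mulr_sumr; apply: eq_bigr => k _; ring.
pose Phi := {ffun 'S_n -> K}.
pose F (phi : Phi) := \prod_s f (phi s).
pose U (phi : Phi) := \prod_s tau s (c (phi s)).
pose rep (phi : Phi) := odflt phi [pick psi | F psi == F phi].
have repF phi : F (rep phi) = F phi.
  by rewrite /rep; case: pickP => [psi /eqP //|/(_ phi)]; rewrite eqxx.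
have rep_eq phi psi : F phi = F psi -> rep phi = rep psi.
  move=> FF; rewrite /rep FF; case: pickP => // /(_ psi).
  by rewrite eqxx.
exists Phi, F, (fun phi => \sum_(psi | rep psi == phi) U psi); split.
- by move=> phi; rewrite /F (bigD1 1%g) //=; apply: ideal_mulr.
- move=> phi p; pose sh (p : 'S_n) (psi : Phi) : Phi := [ffun s => psi (s * p)%g].
  have Fsh q psi : F (sh q psi) = F psi.
    rewrite /F [RHS](reindex_inj (mulIg q)) /=.
    by apply: eq_bigr => s _; rewrite ffunE.
  have shK q : cancel (sh q) (sh q^-1)%g.
    by move=> psi; apply/ffunP => s; rewrite !ffunE mulgKV.
  have tauU psi : tau p (U psi) = U (sh p^-1%g psi).
    rewrite /U rmorph_prod [RHS](reindex_inj (mulIg p)) /=.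
    by apply: eq_bigr => s _; rewrite tauM ffunE mulgK.
  rewrite rmorph_sum [RHS](reindex_inj (can_inj (shK p^-1%g))) /=.
  apply: eq_big => [psi|psi _]; last exact: tauU.
  by rewrite (rep_eq _ _ (Fsh _ _)).
- transitivity (\prod_(s : 'S_n) tau s w).
    have wk k : w ^+ k.+1 = w by elim: k => [|k IH]; rewrite ?expr1 // exprS IH.
    rewrite (eq_bigr (fun=> w)); last by move=> s _; apply: omega_symmetric.
    by rewrite prodr_const -[#|_|]prednK ?wk //; apply/card_gt0P; exists 1%g.
  under eq_bigr do rewrite wE rmorph_sum.
  rewrite bigA_distr_bigA (partition_big rep xpredT) //=; apply: eq_bigr => phi _.
  rewrite mulr_sumr; apply: eq_bigr => psi /eqP <-; rewrite repF /F /U rmorph_prod -big_split.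
  by apply: eq_bigr => s _; rewrite rmorphM tau_t.
Qed.

End Symmetric.
Local Open Scope classical_set_scope.

(** * Open subschemes of affine schemes *)

Lemma open_nbhd (A : comPzRingType) (W : set (spec A)) :
  (forall x, W x -> exists2 r, ~ x r & forall z : spec A, ~ z r -> W z) -> open W.
Proof.
move=> h; apply/spec_openE; exists [set r | forall z : spec A, ~ z r -> W z].
apply/seteqP; split=> x /=; first by move=> /h[r xr rW] /(_ r rW).
by move=> nx; apply: contrapT => Wx; apply: nx => r rW; apply: contrapT => /rW.
Qed.

Lemma open_basic (A : comPzRingType) (W : set (spec A)) x :
  open W -> W x -> exists2 r, ~ x r & forall z : spec A, ~ z r -> W z.
Proof.
move=> /spec_openE[S ->] nx; have [r [Sr xr]] : exists r, S r /\ ~ x r.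
  apply: contrapT => nr; apply: nx => r Sr; apply: contrapT => xr.
  by apply: nr; exists r.
by exists r => // z zr /(_ r Sr).
Qed.

Lemma comap_continuous (A B : comPzRingType) (f : {rmorphism A -> B}) : continuous (comap f).
Proof.
apply/continuousP => W Wo; apply: open_nbhd => y /= /(open_basic Wo)[r yr rW].
by exists (f r) => // z zr; apply: rW.
Qed.

Lemma section_irrelevance (A : comPzRingType) (W : set (spec A)) (s : sections W) x
    (m m' : x \in W) : s (SigSub m) = s (SigSub m').
Proof. by rewrite (bool_irrelevance m m'). Qed.

Lemma affine_openT (A : comPzRingType) : affine_open [set: spec A].
Proof.
exists A, idfun, (fun W _ _ => idfun : {rmorphism sections W -> sections W}); split.
- split.
  + by [].
  + by apply/seteqP; split=> // x _; exists x.
  + by apply/continuousP.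
  + move=> V Vo; suff -> : idfun @` V = V by [].
    by apply/seteqP; split=> [_ [y Vy <-]|y Vy] //; exists y.
- by move=> W Wo WT; exists idfun.
- move=> W W' Wo WT Wo' WT' WW' s; apply: sectionsP => x /=.
  exact: section_irrelevance.
Qed.

Section Affine.
Variables (R : comPzRingType) (U : set (spec R)).
Hypothesis openU : open U.
Hypothesis denseU : forall r : R, (forall y, U y -> y r) -> r = 0.

Let G := sections U.

Definition const_section (a : R) : G := Sections (@const_fraction R U a).

Let constB : zmod_morphism const_section.
Proof.
move=> a b; apply: sectionsP => z.
rewrite -[RHS]/(fraction_of a _ - fraction_of b _) fraction_ofN fraction_ofD.
by apply: fraction_of_congr; ring.
Qed.
Let constM : monoid_morphism const_section.
Proof.
split=> [|a b]; first exact: sectionsP.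
apply: sectionsP => z; rewrite -[RHS]/(fraction_of a _ * fraction_of b _) fraction_ofM.
by apply: fraction_of_congr; ring.
Qed.
HB.instance Definition _ := GRing.isZmodMorphism.Build R G const_section constB.
HB.instance Definition _ := GRing.isMonoidMorphism.Build R G const_section constM.
Let res : {rmorphism R -> G} := const_section.

Let pt x (Ux : U x) : U := SigSub (mem_set Ux).

Lemma const_section0 r x : U x -> res r = 0 -> exists2 h, ~ x h & h * r = 0.
Proof.
move=> Ux /(congr1 (fun s : G => s (pt Ux))) /=.
rewrite -[RHS]/(fraction_of 0 _) => /fraction_of_eq[h [xh hr]].
by exists h => //; rewrite -hr; ring.
Qed.

Lemma const_section_in r x : U x -> res r = 0 -> x r.
Proof.
move=> Ux /(const_section0 Ux)[h xh hr].
have : x (h * r) by rewrite hr; apply: ideal0.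
by move=> /prime_mul[].
Qed.

(** Since the points of [U] detect zero, a section is zero as soon as all its
    values lie in the maximal ideals of the stalks. *)
Lemma section_eq0 (s : G) :
  (forall (z : U) b g (ng : ~ (val z : spec R) g), s z = fraction_of b ng -> (val z : spec R) b) ->
  s = 0.
Proof.
move=> h; apply: sectionsP => y; have [V [a [f [Vo Vy Vs]]]] := section_fraction s y.
have [nf ->] := Vs y Vy; rewrite -[RHS]/(fraction_of 0 _); apply/fraction_of_eq.
have [k yk kV] := open_basic (openI Vo openU) (conj Vy (set_valP y)).
exists k; split=> //; rewrite mulr1 mul0r subr0; apply: denseU => z Uz.
have [zk|zk] := pselect (z k); first exact: ideal_mulr.
have [Vz _] := kV z zk; have [nf' sE] := Vs (pt Uz) Vz.
exact/idealM/(h _ _ _ _ sE).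
Qed.

(** A denominator [d] that vanishes outside the neighbourhood where the fraction
    represents [s] makes the equality hold on all of [U]. *)
Lemma local_form (s : G) x : U x ->
  exists d c, [/\ ~ x d, forall z : spec R, ~ z d -> U z & res d * s = res c].
Proof.
move=> Ux; have [V [a [f [Vo Vx Vs]]]] := section_fraction s (pt Ux).
have [k xk kV] := open_basic (openI Vo openU) (conj Vx Ux).
have [nf _] := Vs _ Vx.
exists (k * f), (k * a); split=> [|z zkf|].
- exact: notinM.
- by have [] := kV z => // zk; apply/zkf/ideal_mulr.
apply/eqP; rewrite -subr_eq0; apply/eqP/section_eq0 => z b g ng.
rewrite -[LHS]/(fraction_of (k * f) _ * s z - fraction_of (k * a) _).
have [c [l [nl sE]]] := fraction_ofP (s z).
have [zk|zk] := pselect ((val z : spec R) k).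
  rewrite sE fraction_ofM fraction_ofN fraction_ofD => /fraction_of_eq[h [zh]] e.
  have : (val z : spec R) (h * (l * b)).
    have -> : h * (l * b) = k * (h * (f * c - a * l) * g) -
      h * ((k * f * c * 1 + - (k * a) * (1 * l)) * g - b * (1 * l * 1)) by ring.
    by rewrite e subr0; apply: ideal_mulr.
  by move=> /prime_mul[//|/prime_mul[]].
have [Vz _] := kV _ zk; have [nf' ->] := Vs _ Vz.
rewrite fraction_ofM fraction_ofN fraction_ofD => /fraction_of_eq[h [zh]] e.
have : (val z : spec R) (h * (f * b)).
  have -> : h * (f * b) = - (h * ((k * f * a * 1 + - (k * a) * (1 * f)) * g - b * (1 * f * 1))) by ring.
  by rewrite e oppr0; apply: ideal0.
by move=> /prime_mul[//|/prime_mul[]].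
Qed.

(** The sections whose value lies in the maximal ideal of the stalk at [x]. *)
Section StalkPoint.
Variables (x : spec R) (Ux : U x).

Let Q (s : G) := exists d c, [/\ ~ x d, res d * s = res c & x c].

Let Q0 : Q 0.
Proof.
exists 1, 0; split; [exact: prime_proper|by rewrite mulr0 rmorph0|exact: ideal0].
Qed.
Let QD s s' : Q s -> Q s' -> Q (s + s').
Proof.
move=> [d [c [xd e xc]]] [d' [c' [xd' e' xc']]]; exists (d * d'), (d' * c + d * c').
split; [exact: notinM| |by apply: idealD; apply: idealM].
by rewrite rmorphD !rmorphM /= -e -e'; ring.
Qed.
Let QM s s' : Q s' -> Q (s * s').
Proof.
move=> [d [c [xd e xc]]]; have [d' [c' [xd' _ e']]] := local_form s Ux.
exists (d' * d), (c' * c); split; [exact: notinM| |exact: idealM].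
by rewrite !rmorphM /= -e -e'; ring.
Qed.
Let Q1 : ~ Ideal Q0 QD QM 1.
Proof.
move=> [d [c [xd e xc]]]; apply: xd; rewrite -[d](subrK c); apply: idealD => //.
by apply: (const_section_in Ux); rewrite rmorphB -e mulr1 subrr.
Qed.
Let QP s s' : Ideal Q0 QD QM (s * s') -> Ideal Q0 QD QM s \/ Ideal Q0 QD QM s'.
Proof.
move=> [d0 [c0 [xd0 e0 xc0]]].
have [d [c [xd _ e]]] := local_form s Ux; have [d' [c' [xd' _ e']]] := local_form s' Ux.
have : x (d0 * (c * c')).
  rewrite -[_ * (_ * _)](subrK (d * d' * c0)); apply: idealD; last exact: idealM.
  apply: (const_section_in Ux); rewrite rmorphB !rmorphM -e -e' -e0 /=; ring.
by move=> /prime_mul[//|/prime_mul[xc|xc]]; [left; exists d, c|right; exists d', c'].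
Qed.

Definition stalk_point : spec G := Spec Q1 QP.

Lemma comap_stalk_point : comap res stalk_point = x.
Proof.
apply: spec_ext => r; split=> [[d [c [xd e xc]]]|xr]; last first.
  exists 1, r; split; [exact: prime_proper|by rewrite rmorph1 mul1r|by []].
have : x (d * r).
  rewrite -[d * r](subrK c); apply: idealD => //.
  by apply: (const_section_in Ux); rewrite rmorphB rmorphM e subrr.
by move=> /prime_mul[].
Qed.

End StalkPoint.

Hypothesis covered : forall q : spec G, U (comap res q).

Let h := comap res : spec G -> spec R.

Lemma section_in_point (q : spec G) s d c : ~ h q d -> res d * s = res c -> q s <-> h q c.
Proof.
move=> qd e; rewrite -[h q c]/(q (res c)) -e; split; first exact: idealM.
by move=> /prime_mul[/qd|].
Qed.

Lemma comap_res_inj : injective h.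
Proof.
move=> q q' qq; apply: spec_ext => s.
have [d [c [qd _ e]]] := local_form s (covered q).
have qd' : ~ h q' d by rewrite -qq.
by rewrite (section_in_point qd e) (section_in_point qd' e) qq.
Qed.

Lemma comap_res_range : range h = U.
Proof.
apply/seteqP; split=> [_ [q _ <-]|x Ux]; first exact: covered.
by exists (stalk_point Ux) => //; apply: comap_stalk_point.
Qed.

Lemma comap_res_open V : open V -> open (h @` V).
Proof.
move=> Vo; apply: open_nbhd => _ [q Vq <-].
have [b qb bV] := open_basic Vo Vq; have [d [c [qd dU e]]] := local_form b (covered q).
have qc : ~ h q c by rewrite -(section_in_point qd e).
exists (d * c) => [|z zdc]; first exact: notinM.
have zd : ~ z d by move=> zd; apply/zdc/ideal_mulr.
have hz := comap_stalk_point (dU z zd); exists (stalk_point (dU z zd)) => //.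
apply: bV; rewrite (section_in_point (d := d) (c := c)) // /h hz // => zc.
exact/zdc/idealM.
Qed.

Section StalkMap.
Variable q : spec G.

Definition stalk_map (u : local_ring (h q)) : local_ring q :=
  @fraction_of G q (res (num (repr u))) (res (den (repr u))) (@den_notin R (h q) (repr u)).

Lemma stalk_mapE a f (nf : ~ h q f) (nf' : ~ q (res f)) :
  stalk_map (fraction_of a nf) = fraction_of (res a) nf'.
Proof.
apply/fraction_of_eq; have [k [qk e]] := local_repr a nf; exists (res k); split=> //.
by rewrite -!rmorphM -rmorphB -rmorphM e rmorph0.
Qed.

Lemma stalk_mapE' a f (nf : ~ h q f) :
  stalk_map (fraction_of a nf) = @fraction_of G q (res a) (res f) nf.
Proof. exact: stalk_mapE. Qed.

Lemma stalk_map_zmod : zmod_morphism stalk_map.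
Proof.
move=> u v; have [a [f [nf ->]]] := fraction_ofP u; have [b [g [ng ->]]] := fraction_ofP v.
rewrite fraction_ofN fraction_ofD !stalk_mapE' fraction_ofN fraction_ofD.
by apply: fraction_of_congr; rewrite rmorphD !rmorphM rmorphN.
Qed.

Lemma stalk_map_monoid : monoid_morphism stalk_map.
Proof.
split=> [|u v].
  by rewrite -[1 in LHS]fraction_of1 stalk_mapE'; apply: fraction_of_congr; rewrite rmorph1.
have [a [f [nf ->]]] := fraction_ofP u; have [b [g [ng ->]]] := fraction_ofP v.
rewrite fraction_ofM !stalk_mapE' fraction_ofM.
by apply: fraction_of_congr; rewrite !rmorphM.
Qed.

Lemma stalk_map_inj : injective stalk_map.
Proof.
move=> u v; have [a [f [nf ->]]] := fraction_ofP u; have [b [g [ng ->]]] := fraction_ofP v.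
rewrite !stalk_mapE' => /fraction_of_eq[s [qs]] e.
have [d [c [qd _ e']]] := local_form s (covered q).
have qc : ~ h q c by rewrite -(section_in_point qd e').
have : res (c * (a * g - b * f)) = 0.
  by rewrite rmorphM -e' -mulrA rmorphB !rmorphM e mulr0.
move=> /(const_section0 (covered q))[k qk kc]; apply/fraction_of_eq.
exists (k * c); split; first exact: notinM.
by rewrite -mulrA.
Qed.

Lemma fraction_local_form (s s' : G) (ns : ~ q s') d c d' c' :
  ~ h q d -> ~ h q d' -> res d * s = res c -> res d' * s' = res c' ->
  exists nf : ~ q (res (d * c')), fraction_of s ns = fraction_of (res (c * d')) nf.
Proof.
move=> qd qd' e e'; have qc' : ~ h q c' by rewrite -(section_in_point qd' e').
have nf : ~ h q (d * c') by apply: notinM.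
exists nf; apply: fraction_of_congr; rewrite !rmorphM -e -e'; ring.
Qed.

End StalkMap.

Section Comparison.
Variables (W : set (spec R)) (Wo : open W) (WU : W `<=` U).

Let lift (q : h @^-1` W) : W := SigSub (mem_set (set_valP q : W (h (val q)))).

Lemma comparison_fraction (s : sections W) :
  locally_fraction (fun q : h @^-1` W => stalk_map (s (lift q))).
Proof.
move=> q; have [V [a [f [Vo Vq Vs]]]] := section_fraction s (lift q).
exists (h @^-1` V), (res a), (res f); split=> // [|q' Vq'].
  by move: (@comap_continuous _ _ res) => /continuousP; apply.
by have [nf ->] := Vs (lift q') Vq'; exists nf; apply: stalk_mapE.
Qed.

Definition comparison (s : sections W) : sections (h @^-1` W) := Sections (comparison_fraction s).

Let comparisonB : zmod_morphism comparison.
Proof. by move=> s s'; apply: sectionsP => q; apply: stalk_map_zmod. Qed.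
Let comparisonM : monoid_morphism comparison.
Proof.
split=> [|s s']; apply: sectionsP => q; first exact: (stalk_map_monoid _).1.
exact: (stalk_map_monoid _).2.
Qed.
HB.instance Definition _ :=
  GRing.isZmodMorphism.Build (sections W) (sections (h @^-1` W)) comparison comparisonB.
HB.instance Definition _ :=
  GRing.isMonoidMorphism.Build (sections W) (sections (h @^-1` W)) comparison comparisonM.

Let over (x : W) : exists q : h @^-1` W, h (val q) = val x.
Proof.
have Wx := set_valP x; have Ux := WU Wx.
have Wq : (h @^-1` W) (stalk_point Ux) by rewrite /= /h comap_stalk_point.
by exists (SigSub (mem_set Wq)); apply: comap_stalk_point.
Qed.

Lemma comparison_inj : injective comparison.
Proof.
move=> s s' ss; apply: sectionsP => x; have [q qx] := over x.
have -> : x = lift q by apply: val_inj.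
apply: (@stalk_map_inj (val q)).
by have := congr1 (fun s : sections (h @^-1` W) => s q) ss.
Qed.

Let fraction_over (t : sections (h @^-1` W)) (x : W) :
  exists p : Defs.frac (val x), forall q : h @^-1` W, h (val q) = val x ->
    forall nf : ~ (val q : spec G) (res (den p)), t q = fraction_of (res (num p)) nf.
Proof.
have [q qx] := over x; have [al [be [nbe tE]]] := fraction_ofP (t q).
have [d [c [qd _ e]]] := local_form al (covered (val q)).
have [d' [c' [qd' _ e']]] := local_form be (covered (val q)).
have [nf tE'] := fraction_local_form nbe qd qd' e e'.
have xf : ~ (val x : spec R) (d * c') by rewrite -qx.
exists (Frac (c * d') xf) => q' qx' nf' /=.
have qq : q' = q by apply/val_inj/comap_res_inj; rewrite qx qx'.
by subst q'; rewrite tE tE'; apply: fraction_of_congr.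
Qed.

Lemma comparison_surj (t : sections (h @^-1` W)) : exists s, comparison s = t.
Proof.
pose s (x : W) := let p := projT1 (cid (fraction_over t x)) in
  fraction_of (num p) (@den_notin _ _ p).
have sP (q : h @^-1` W) : stalk_map (s (lift q)) = t q.
  rewrite /s; case: cid => p pP /=.
  by rewrite stalk_mapE'; apply/esym/pP.
have sf : locally_fraction s.
  move=> x; have [q qx] := over x; have xE : x = lift q by apply: val_inj.
  have [V [al [be [Vo Vq Vt]]]] := section_fraction t q.
  have [nbe tE] := Vt q Vq.
  have [d [c [qd dU e]]] := local_form al (covered (val q)).
  have [d' [c' [qd' dU' e']]] := local_form be (covered (val q)).
  have qc' : ~ h (val q) c' by rewrite -(section_in_point qd' e').
  exists ((h @` V) `&` [set z : spec R | ~ z (d * d' * c')]), (c * d'), (d * c'); split.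
  - apply: openI; first exact: comap_res_open.
    by apply: open_nbhd => z zd; exists (d * d' * c').
  - split; first by rewrite -qx; exists (val q).
    by rewrite /= -qx; do !apply: notinM.
  move=> y [[q' Vq' qy] /= ny].
  have Wq' : (h @^-1` W) q' by rewrite /= qy; apply: set_valP.
  pose q1 : h @^-1` W := SigSub (mem_set Wq').
  have yE : y = lift q1 by apply: val_inj; rewrite /= qy.
  have n1 : ~ h q' d by rewrite qy => yd; apply/ny/ideal_mulr/ideal_mulr.
  have n2 : ~ h q' d' by rewrite qy => yd; apply: ny; apply/ideal_mulr/idealM.
  have [nbe' tE'] := Vt q1 Vq'.
  have [nf fE] := fraction_local_form nbe' n1 n2 e e'.
  rewrite yE; exists nf; apply: (@stalk_map_inj (val q1)).
  by rewrite sP tE' fE stalk_mapE'.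
by exists (Sections sf); apply: sectionsP => q; apply: sP.
Qed.

Lemma comparison_bij : bijective comparison.
Proof.
have /choice[g gE] := comparison_surj.
by exists g => // s; apply: comparison_inj.
Qed.

End Comparison.

(** [U] is the spectrum of its ring of sections: near each of its points a section
    is a fraction of elements of [R], by [local_form], so that the two spaces
    have the same points, open sets and stalks. *)
Lemma affine_of_covered : affine_open U.
Proof.
exists G, h, (fun W (Wo : open W) (WU : W `<=` U) =>
  (comparison (W := W) : {rmorphism sections W -> sections (h @^-1` W)})); split.
- split.
  + exact: comap_res_inj.
  + exact: comap_res_range.
  + exact: comap_continuous.
  + exact: comap_res_open.
- by move=> W Wo WU; apply: comparison_bij.
- move=> W W' Wo WU Wo' WU' WW' s; apply: sectionsP => q /=.
  congr stalk_map; exact: section_irrelevance.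
Qed.

End Affine.

(** A prime of the ring of sections misses one of the [F l], since these generate
    the unit ideal; as [F l] is zero outside [U], the prime lies over [U]. *)
Lemma affine_criterion (R : comPzRingType) (U : set (spec R)) (L : finType)
    (F : L -> R) (g : L -> sections U) :
  open U -> (forall r : R, (forall y, U y -> y r) -> r = 0) ->
  (forall l (y : spec R), ~ y (F l) -> U y) ->
  \sum_l const_section U (F l) * g l = 1 -> affine_open U.
Proof.
move=> Uo Ud FU Fg; apply: affine_of_covered => // q.
apply: contrapT => nU; apply: (prime_proper (s := q)); rewrite -Fg.
apply: ideal_sum => l _; rewrite mulrC; apply: idealM.
by apply: contrapT => ql; apply: nU; apply: (FU l).
Qed.
(** * Purity of the strata *)

Lemma power_point (A B : comPzRingType) (e : {rmorphism A -> B}) (I : finType) (xs ys : I -> B)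
    (K : fieldType) (th : {rmorphism A -> K}) m (a : 'I_m -> {rmorphism B -> K})
    (T : comPzRingType) (t : {rmorphism A -> T}) (X : 'I_m -> {rmorphism B -> T}) :
  separability e xs ys -> is_power e t X -> (forall i, a i \o e =1 th) ->
  (forall i j, i != j -> exists b, a i b != a j b) ->
  exists phi : {rmorphism T -> K}, phi \o t =1 th /\ phi (omega xs ys X) = 1.
Proof.
move=> sep [_ univ _] ath aa; have [phi [phit phiX]] := univ K th a ath.
exists phi; split=> //; rewrite omega_morph (eq_omega _ _ phiX).
by apply: (omega_distinct sep) => // i j b; rewrite [LHS]ath [RHS]ath.
Qed.

Lemma power_point_extended (A T : comPzRingType) (t : {rmorphism A -> T}) (K : fieldType)
    (th : {rmorphism A -> K}) (phi : {rmorphism T -> K}) (x : A -> Prop) w :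
  phi \o t =1 th -> phi w = 1 -> (forall r, x r -> th r = 0) -> ~ extended t x w.
Proof.
move=> phit phiw xth xw; have : kernel_ideal phi w.
  by apply: (extended_prime _ xw) => r /xth; rewrite -phit.
by rewrite /= phiw; apply/eqP/oner_neq0.
Qed.

Lemma sections_sum (R : comPzRingType) (U : set (spec R)) (L : finType) (s : L -> sections U) x :
  (\sum_l s l) x = \sum_l s l x.
Proof. exact: (big_morph (fun s : sections U => s x)). Qed.

Lemma fraction_of_sum (R : comPzRingType) (x : spec R) (L : finType) (c : L -> R) f (nf : ~ x f) :
  \sum_l fraction_of (c l) nf = fraction_of (\sum_l c l) nf.
Proof.
apply/esym/(big_morph (fun c => fraction_of c nf)) => [a b|].
  by rewrite fraction_ofD; apply: fraction_of_congr; ring.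
by rewrite -fraction_of0; apply: fraction_of_congr; rewrite !mul0r.
Qed.

Section Affineness.
Variables (R B : comPzRingType) (e : {rmorphism R -> B}) (I : finType) (xs ys : I -> B).
Variables (n : nat) (T : comPzRingType) (t : {rmorphism R -> T}) (X : 'I_n -> {rmorphism B -> T}).
Hypothesis sep : separability e xs ys.
Hypothesis pw : is_power e t X.
Hypothesis flt : flat t.
Variable U : set (spec R).
Hypothesis openU : open U.
Hypothesis denseU : forall r : R, (forall y, U y -> y r) -> r = 0.
Let w := omega xs ys X.
Hypothesis atMost : forall (V : comPzRingType) (Y : 'I_n.+1 -> {rmorphism B -> V}),
  (forall i j, Y i \o e =1 Y j \o e) -> omega xs ys Y = 0.
Hypothesis inside : forall y : spec R, U y ->
  exists (K : fieldType) (th : {rmorphism R -> K}) (phi : {rmorphism T -> K}),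
    [/\ forall r, th r = 0 <-> y r, phi \o t =1 th & phi w = 1].
Hypothesis outside : forall y : spec R, ~ U y -> extended t y w.

Let ww : w * w = w.
Proof.
have [Xt _ _] := pw; apply: (omega_idem sep) => i j a.
by rewrite Xt [RHS]Xt.
Qed.

Let torsion_free r : t r * w = 0 -> r = 0.
Proof.
move=> rw; apply: denseU => y /inside[K [th [phi [thy phit phiw]]]]; apply/thy.
by rewrite -phit /= -[LHS]mulr1 -phiw -rmorphM rw rmorph0.
Qed.

(** The hypotheses say that fibres have exactly [n] geometric points over [U] and
    fewer elsewhere. Let [J] be the ideal of the complement of [U]. As [w] is zero
    over that complement, it lies in [J T]; its norm gives [w] as a sum of
    [F l * s l] with [F l] in [J] and [s l] symmetric. The [s l] descend to
    sections over [U], for which the same sum is 1. *)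
Lemma affine_locus : affine_open U.
Proof.
pose J := vanishing_ideal (~` U).
have Jw : extended t J w.
  apply: (idempotent_in_ideal ww) => q Jq.
  have nU : ~ U (comap t q).
    move=> Uy; have [r yr rU] := open_basic openU Uy; apply: yr; apply: Jq.
    have Jr : forall y : spec R, ~ U y -> y r by move=> y; apply: contra_notP => /rU.
    by apply: span_gen; exists r.
  exact: (extended_prime _ (outside nU)).
have [tau tauP] := permutation_action pw.
have [L [F [s [JF ssym wE]]]] := symmetric_norm sep pw tauP Jw.
(* The denominator at [x] is chosen common to all the [s l]. *)
have den (x : U) : exists d : R * (L -> R), ~ (val x : spec R) d.1 /\
    forall l, t d.1 * s l * w = t (d.2 l) * w.
  have xw : ~ extended t (val x : spec R) w.
    have [K [th [phi [thy phit phiw]]]] := inside (set_valP x).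
    by apply: (power_point_extended phit phiw) => r /thy.
  have /choice[c cP] : forall l, exists c : R * R, ~ (val x : spec R) c.1 /\ t c.1 * s l * w = t c.2 * w.
    move=> l; have [r [a [xr ra]]] := symmetric_descent sep pw flt tauP atMost (ssym l) xw.
    by exists (r, a).
  exists (\prod_l (c l).1, fun l => \prod_(k | k != l) (c k).1 * (c l).2) => /=; split.
    by apply: prime_prod => l _; have [] := cP l.
  move=> l; have [_ cl] := cP l; rewrite (bigD1 l) //= !rmorphM.
  rewrite -[RHS]mulrA -cl; ring.
have {den} [d dP] : exists d : U -> R * (L -> R), forall x, ~ (val x : spec R) (d x).1 /\
    forall l, t (d x).1 * s l * w = t ((d x).2 l) * w.
  by have [d dP] := choice den; exists d.
pose g l (x : U) := @fraction_of R (val x) ((d x).2 l) (d x).1 (dP x).1.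
have gf l : locally_fraction (g l).
  move=> x; exists [set z : spec R | ~ z (d x).1], ((d x).2 l), (d x).1; split.
  - by apply: open_nbhd => z zd; exists (d x).1.
  - by have [] := dP x.
  move=> y /= yd; exists yd; apply: fraction_of_congr.
  apply/eqP; rewrite -subr_eq0; apply/eqP/torsion_free.
  have [_ /(_ l) ex] := dP x; have [_ /(_ l) ey] := dP y.
  rewrite rmorphB !rmorphM mulrBl mulrAC -ey [t ((d x).2 l) * _ * w]mulrAC -ex.
  ring.
apply: (@affine_criterion R U L F (fun l => Sections (gf l))) => // [l y yF|].
  by apply: contrapT => nU; apply/yF/JF.
apply: sectionsP => x; rewrite sections_sum.
have [_ dl] := dP x.
rewrite (eq_bigr (fun l => fraction_of (F l * (d x).2 l) (dP x).1)) => [|l _].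
  rewrite fraction_of_sum -[RHS]fraction_of1; apply: fraction_of_congr.
  rewrite mulr1 mul1r; apply/eqP; rewrite -subr_eq0; apply/eqP/torsion_free.
  rewrite rmorphB rmorph_sum mulrBl mulr_suml.
  under eq_bigr => l _ do rewrite rmorphM -mulrA -dl mulrA mulrCA -mulrA.
  apply/eqP; rewrite subr_eq0; apply/eqP.
  transitivity (t (d x).1 * (w * \sum_l t (F l) * s l)); last by rewrite -wE -/w ww.
  rewrite !mulr_sumr; apply: eq_bigr => l _; ring.
rewrite -[LHS]/(fraction_of (F l) _ * fraction_of _ _) fraction_ofM.
by apply: fraction_of_congr; ring.
Qed.

End Affineness.

Section Strata.
Variables (A B A0 B0 : comPzRingType) (e : {rmorphism A -> B}).
Variables (f : {rmorphism A0 -> A}) (e0 : {rmorphism A0 -> B0}) (f' : {rmorphism B0 -> B}).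
Variables (I : finType) (xs ys : I -> B0).
Hypothesis nA0 : noetherian A0.
Hypothesis po : is_pushout f e0 e f'.
Hypothesis fl : flat e0.
Hypothesis ft : finite_type e0.
Hypothesis sep : separability e0 xs ys.
Hypothesis cards : forall x, exists n, geometric_fiber_card e x n.

(** Membership in a stratum is read on two idempotents of tensor powers over the
    noetherian ring [A0], since every point has some number of geometric points. *)
Lemma stratumE n (T T' : comPzRingType) (t : {rmorphism A0 -> T}) (X : 'I_n -> {rmorphism B0 -> T})
    (t' : {rmorphism A0 -> T'}) (X' : 'I_n.+1 -> {rmorphism B0 -> T'}) x :
  is_power e0 t X -> flat t -> is_power e0 t' X' -> flat t' ->
  stratum e n x <-> ~ extended t (comap f x) (omega xs ys X) /\
                    extended t' (comap f x) (omega xs ys X').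
Proof.
move=> pw flt pw' flt'; split.
  move=> /(geometric_points po fl sep)[K [th [a [thx ath aa ext]]]].
  have [phi [phit phiw]] := power_point (th := (th \o f : {rmorphism _ -> _})) sep pw ath aa.
  split; last exact: ext.
  by apply: (power_point_extended phit phiw) => r xr /=; apply/thx.
move=> [nx x']; have [n' gx] := cards x.
have [K [th [a [thx ath aa ext]]]] := geometric_points po fl sep gx.
suff nn : n = n' by rewrite /stratum /= nn.
apply/eqP; rewrite eqn_leq; apply/andP; split; rewrite leqNgt; apply/negP => lt.
  exact/nx/ext.
pose b (i : 'I_n.+1) := a (widen_ord lt i).
have [|i j ij|phi [phit phiw]] := power_point (th := (th \o f : {rmorphism _ -> _})) (a := b) sep pw'.
- by move=> i; apply: ath.
- apply: aa; apply: contra_neq ij => /(congr1 val) /= ij; exact: val_inj.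
by apply: (power_point_extended phit phiw) x' => r xr /=; apply/thx.
Qed.

(** Every point of the closure of the stratum [Z] still has at most [n] geometric
    points, so [affine_locus] applies over the quotient by the ideal of [Z]. *)
Lemma stratum_pure n : pure (stratum e n).
Proof.
have [T [t [X [pw flt]]]] := power_exists n fl.
have [T' [t' [X' [pw' flt']]]] := power_exists n.+1 fl.
pose Z := stratum e n; have ZE x : Z x <-> _ := stratumE x pw flt pw' flt'.
pose O := comap f @^-1` [set y : spec A0 | ~ extended t y (omega xs ys X)].
pose O' := comap f @^-1` [set y : spec A0 | ~ extended t' y (omega xs ys X')].
have cf := @comap_continuous _ _ f.
have Oo : open O by move/continuousP: cf; apply; exact: (omega_open nA0 fl ft sep pw flt).
have Oo' : open O' by move/continuousP: cf; apply; exact: (omega_open nA0 fl ft sep pw' flt').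
split.
  exists O, (~` O'); split=> //; first exact: open_closedC.
  apply/seteqP; split=> x; first by move=> /ZE[h h']; split=> //; apply.
  by move=> [h /contrapT h']; apply/ZE.
exists [set setT]; split=> [V ->||V ->]; first exact: affine_openT.
  by apply/seteqP; split=> // x _; exists setT.
pose J := vanishing_ideal Z; pose R : comPzRingType := quot J.
pose pi : {rmorphism A -> R} := quot_pi J.
pose U := reduced_part (Z := Z) setT.
have UE y : U y <-> Z (comap pi y) by split=> [[]|].
have closure (y : spec R) : extended t' (comap f (comap pi y)) (omega xs ys X').
  apply: contrapT => Oy.
  have [r yr rO] := open_basic (x := comap pi y) Oo' Oy; apply: yr.
  have Zr : forall x, Z x -> x r.
    by move=> x /ZE[_ h]; apply: contrapT => /rO; apply.
  have pir : pi r = 0 by apply/quot_pi0; apply: Zr.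
  by suff : y (pi r) by []; rewrite pir; apply: ideal0.
have Uo : open U.
  have -> : U = comap pi @^-1` O.
    apply/seteqP; split=> y; first by move=> /UE /ZE[].
    by move=> h; apply/UE/ZE; split=> //; apply: closure.
  by move: (@comap_continuous _ _ pi) => /continuousP; apply.
have liftZ (K : fieldType) (th : {rmorphism A -> K}) (x : spec A) : Z x ->
    (forall r, th r = 0 <-> x r) -> exists g : {rmorphism R -> K}, forall r, g (pi r) = th r.
  move=> Zx thx; apply: quot_factorP => r Jr; apply/thx.
  exact: (Jr x Zx).
have Ud (r : R) : (forall y, U y -> y r) -> r = 0.
  have [a ->] := quot_piP r => Ua; apply/quot_pi0.
  have Za : forall x, Z x -> x a.
    move=> x Zx; have [K [th [b [thx _ _ _]]]] := geometric_points po fl sep Zx.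
    have [g gE] := liftZ K th x Zx thx.
    have xE : comap pi (kernel_point (g : {rmorphism R -> K})) = x.
      by apply: spec_ext => c; rewrite -thx -gE.
    by rewrite -xE; apply: Ua; apply/UE; rewrite xE.
  exact: Za.
have [BR [eR [v poR]]] := pushout_exists (pi \o f : {rmorphism _ -> _}) e0.
have flR := flat_base_change poR fl; have sepR := separability_base_change poR sep.
have [TR [tR [XR [pwR fltR]]]] := power_exists n flR.
have [XRt _ _] := pwR.
have [phi [phit phiX]] : exists phi : {rmorphism T -> TR},
    phi \o t =1 tR \o (pi \o f) /\ forall i, phi \o X i =1 XR i \o v.
  have [_ univ _] := pw; apply: (univ TR (tR \o (pi \o f) : {rmorphism _ -> _})
    (fun i => XR i \o v : {rmorphism _ -> _})) => i a /=.
  by rewrite -(pushout_glue poR); apply: XRt.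
have phiw : phi (omega xs ys X) = omega (v \o xs) (v \o ys) XR.
  by rewrite omega_morph; exact: (eq_omega xs ys phiX).
apply: (affine_locus sepR pwR fltR Uo Ud) => [V' Y YY|y Uy|y nUy].
- have [a|w [wt wX]] := pushout_lift poR (u' := (Y ord0 \o eR : {rmorphism _ -> _})) (v' := (Y ord0 \o v : {rmorphism _ -> _})).
    by rewrite /= (pushout_glue poR).
  have [psi [psit psiX]] : exists psi : {rmorphism T' -> V'},
      psi \o t' =1 (Y ord0 \o eR) \o (pi \o f) /\ forall i, psi \o X' i =1 Y i \o v.
    have [_ univ _] := pw'; apply: (univ V' ((Y ord0 \o eR) \o (pi \o f) : {rmorphism _ -> _})
      (fun i => Y i \o v : {rmorphism _ -> _})) => i a /=.
    by rewrite -(pushout_glue poR); apply: YY.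
  have psiw : psi (omega xs ys X') = omega (v \o xs) (v \o ys) Y.
    by rewrite omega_morph; exact: (eq_omega xs ys psiX).
  suff : (ideal_span (fun z : V' => False)) (omega (v \o xs) (v \o ys) Y).
    by elim=> [//|//|r s _ -> _ ->|r s _ ->]; rewrite ?addr0 ?mulr0.
  apply: idempotent_in_ideal => [|q _]; first exact: (omega_idem sepR YY).
  rewrite -psiw; pose y := comap (Y ord0 \o eR : {rmorphism _ -> _}) q.
  apply: (extended_prime (q := ideal_pullback psi q) _ (closure y)) => a ya /=.
  by rewrite [psi _]psit.
- have /UE Zy := Uy; have [K [th [a [thx ath aa _]]]] := geometric_points po fl sep Zy.
  have [g gE] := liftZ K th _ Zy thx.
  have /choice[b bP] : forall i, exists b : {rmorphism BR -> K}, b \o eR =1 g /\ b \o v =1 a i.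
    move=> i; apply: (pushout_lift poR (u' := g)) => c /=.
    by rewrite gE [RHS]ath.
  have [i|i j ij|psi [psit psiw]] := power_point (th := g) (a := b) sepR pwR.
  + by have [] := bP i.
  + have [c ac] := aa _ _ ij; exists (v c); have [_ bv] := bP i; have [_ bv'] := bP j.
    by rewrite [b i _]bv [b j _]bv'.
  exists K, g, psi; split=> // r; have [c ->] := quot_piP r.
  by rewrite gE thx.
- rewrite -phiw; have nx : extended t (comap f (comap pi y)) (omega xs ys X).
    apply: contrapT => h; apply: nUy; apply/UE/ZE; split=> //; exact: closure.
  by apply: (extended_map (f := (pi \o f : {rmorphism _ -> _})) phit _ nx).
Qed.

End Strata.

Lemma pure_of_zero_ring (A : comPzRingType) (Z : set (spec A)) : (1 : A) = 0 -> pure Z.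
Proof.
move=> A0; have no (x : spec A) : False.
  by apply: (prime_proper (s := x)); rewrite A0; apply: ideal0.
split; first by exists setT, setT; split; [exact: openT|exact: closedT|apply/seteqP; split=> x].
exists [set setT]; split=> [V ->||V ->]; first exact: affine_openT.
  by apply/seteqP; split=> // x.
have -> : reduced_part (Z := Z) setT = setT; last exact: affine_openT.
by apply/seteqP; split=> // y; case: (no (comap (quot_pi _) y)).
Qed.

Local Close Scope classical_set_scope.

Theorem theorem2 (p : nat) (A B : comPzRingType) (e : {rmorphism A -> B})
    (mu : seq nat) :
  prime p -> p%:R = 0 :> A ->
  etale e -> stratification_sequence e mu ->
  forall l : nat, (l < size mu)%N -> pure (stratum e (nth 0%N mu l)).
Proof.
move=> _ _ et [[_ cards] _] l _.
have [A0|/eqP A1] := pselect ((1 : A) = 0); first exact: pure_of_zero_ring.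
have [A' AE] := nonzero_ring A1; subst A.
have [A0 [B0 [f [e0 [f' [nA0 po fl [I [xs [ys sep]]] ft]]]]]] := noetherian_model et.
apply: (stratum_pure nA0 po fl ft sep) => x.
by have [i _ gx] := cards x; exists (nth 0%N mu i).
Qed.
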